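(* Let $\omega\in\mathcal{W}$, let $0<p<\infty$ and let $\varphi,\psi\in S(\mathbb{D})$. If $C_\varphi-C_\psi$ is bounded on $A^p(\omega)$, then $$\sup_{z\in\mathbb{D}}\rho_{\tau,\varphi,\psi}(z)^2\left(\frac{\omega(z)}{\omega(\varphi(z))}+\frac{\omega(z)}{\omega(\psi(z))}\right)<\infty.$$ If $C_\varphi-C_\psi$ is compact on $A^p(\omega)$, then $$\rho_{\tau,\varphi,\psi}(z)^2\left(\frac{\omega(z)}{\omega(\varphi(z))}+\frac{\omega(z)}{\omega(\psi(z))}\right)\longrightarrow 0\quad\text{as } |z|\to1^-.$$
   Context: $\mathbb{D}$ is the open unit disk, $dA$ the normalized area measure on $\mathbb{D}$, $H(\mathbb{D})$ the space of holomorphic functions on $\mathbb{D}$, $S(\mathbb{D})$ the set of holomorphic self-maps of $\mathbb{D}$, and $C_\varphi f=f\circ\varphi$. Weights are positive integrable radial functions $\omega=e^{-\eta}$ on $\mathbb{D}$, where $\eta$ is a radial function, strictly increasing in $|z|$, with $\Delta\eta>0$ on $\mathbb{D}$. Such a weight belongs to the class $\mathcal{W}$ if there is a differentiable radial function $\tau>0$, $\tau(z)=\tau(|z|)$, such that $(\Delta\eta(z))^{-1/2}$ and $\tau(z)$ are comparable (each bounded by a positive constant times the other on $\mathbb{D}$), $\lim_{r\to1^-}\tau(r)=0$ and $\lim_{r\to1^-}\tau'(r)=0$; for $\omega\in\mathcal{W}$ such a $\tau$ is fixed. For $0<p<\infty$, $L^p(\omega dA)$ is the space of measurable $f$ on $\mathbb{D}$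 with $\|f\|_p^p=\int_{\mathbb{D}}|f(z)\omega(z)|^p\,dA(z)<\infty$, and $A^p(\omega)=L^p(\omega dA)\cap H(\mathbb{D})$. Define $d_\tau(z,w)=\inf_\gamma\int_0^1\frac{|\gamma'(t)|}{\tau(\gamma(t))}\,dt$, the infimum over piecewise smooth curves $\gamma:[0,1]\to\mathbb{D}$ connecting $z$ and $w$; $\rho_\tau(z,w)=1-e^{-d_\tau(z,w)}$; and $\rho_{\tau,\varphi,\psi}(z)=\rho_\tau(\varphi(z),\psi(z))$. *)

(* Defs.v *)
From mathcomp Require Export all_boot all_order all_algebra.
From mathcomp Require Export all_classical all_reals all_analysis.
From mathcomp Require Export complex.

Set Implicit Arguments.
Unset Strict Implicit.
Unset Printing Implicit Defensive.

Import Order.TTheory GRing.Theory Num.Theory numFieldNormedType.Exports.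
Import ComplexField.Normc.

Local Open Scope classical_set_scope.
Local Open Scope ring_scope.
Local Open Scope complex_scope.

(* Functions on the disk are total functions on R[i]; every definition below
   only looks at their values on the disk. *)
Definition disk (R : realType) : set R[i] := [set z | normc z < 1].

Arguments disk {R}.

(* R * R with its Borel sets; it is identified with R[i] by toC. *)
Definition plane (R : realType) : measurableType _ :=
  (measurableTypeR R * measurableTypeR R)%type.

Definition toC (R : realType) (q : R * R) : R[i] := q.1 +i* q.2.

Definition plane_disk (R : realType) : set (plane R) := @toC R @^-1` disk.

Arguments plane_disk {R}.

Lemma invr_pi_ge0 (R : realType) : 0 <= (pi : R)^-1.
Proof. by rewrite invr_ge0 pi_ge0. Qed.

Definition dA (R : realType) : {measure set (plane R) -> \bar R} :=
  mscale (NngNum (invr_pi_ge0 R)) (@lebesgue_measure R \x @lebesgue_measure R)%E.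

Definition holomorphic (R : realType) (f : R[i] -> R[i]) : Prop :=
  forall z : R[i], disk z -> derivable (f : R[i]^o -> R[i]^o) z 1.

Definition self_map (R : realType) (phi : R[i] -> R[i]) : Prop :=
  holomorphic phi /\ forall z, disk z -> disk (phi z).

Definition Lp_norm (R : realType) (omega : R[i] -> R) (p : R)
    (f : R[i] -> R[i]) : \bar R :=
  ((\int[@dA R]_(q in plane_disk)
      ((normc (f (toC q)) * omega (toC q)) `^ p)%:E) `^ p^-1)%E.

Definition Lp (R : realType) (omega : R[i] -> R) (p : R)
    (f : R[i] -> R[i]) : Prop :=
  [/\ measurable_fun plane_disk (fun q => complex.Re (f (toC q))),
      measurable_fun plane_disk (fun q => complex.Im (f (toC q)))
    & (Lp_norm omega p f < +oo)%E].

Definition Ap (R : realType) (omega : R[i] -> R) (p : R)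
    (f : R[i] -> R[i]) : Prop :=
  Lp omega p f /\ holomorphic f.

Definition comp_op (R : realType) (phi f : R[i] -> R[i]) : R[i] -> R[i] :=
  f \o phi.

Definition bounded_op (R : realType) (omega : R[i] -> R) (p : R)
    (T : (R[i] -> R[i]) -> (R[i] -> R[i])) : Prop :=
  (forall f, Ap omega p f -> Ap omega p (T f)) /\
  exists C : R, forall f, Ap omega p f ->
    (Lp_norm omega p (T f) <= C%:E * Lp_norm omega p f)%E.

(* Bounded sets are mapped to relatively (sequentially) compact sets. *)
Definition compact_op (R : realType) (omega : R[i] -> R) (p : R)
    (T : (R[i] -> R[i]) -> (R[i] -> R[i])) : Prop :=
  (forall f, Ap omega p f -> Ap omega p (T f)) /\
  forall f_ : nat -> R[i] -> R[i],
    (forall n, Ap omega p (f_ n)) ->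
    (exists M : R, forall n, (Lp_norm omega p (f_ n) <= M%:E)%E) ->
    exists (s : nat -> nat) (g : R[i] -> R[i]),
      [/\ {homo s : m n / (m < n)%N >-> (m < n)%N},
          Ap omega p g
        & Lp_norm omega p (T (f_ (s n)) \- g) @[n --> \oo] --> 0%E].

Definition radial (R : realType) (u : R[i] -> R) : Prop :=
  forall z w, disk z -> disk w -> normc z = normc w -> u z = u w.

(* Restrictions of u to the horizontal and vertical lines through z. *)
Definition hline (R : realType) (u : R[i] -> R) (z : R[i]) : R -> R :=
  fun t => u (t +i* complex.Im z).

Definition vline (R : realType) (u : R[i] -> R) (z : R[i]) : R -> R :=
  fun t => u (complex.Re z +i* t).

Definition has_laplacian (R : realType) (u : R[i] -> R) (z : R[i]) : Prop :=
  [/\ derivable (hline u z) (complex.Re z) 1,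
      derivable (derive1 (hline u z)) (complex.Re z) 1,
      derivable (vline u z) (complex.Im z) 1
    & derivable (derive1 (vline u z)) (complex.Im z) 1].

Definition laplacian (R : realType) (u : R[i] -> R) (z : R[i]) : R :=
  derive1n 2 (hline u z) (complex.Re z) + derive1n 2 (vline u z) (complex.Im z).

Definition weight (R : realType) (omega eta : R[i] -> R) : Prop :=
  [/\ forall z, disk z -> omega z = expR (- eta z),
      (@dA R).-integrable plane_disk (fun q => (omega (toC q))%:E),
      radial eta,
      forall z w, disk z -> disk w -> normc z < normc w -> eta z < eta w
    & forall z, disk z -> has_laplacian eta z /\ 0 < laplacian eta z].

Definition class_W (R : realType) (omega tau : R[i] -> R) : Prop :=
  exists2 eta : R[i] -> R, weight omega eta &
    (forall z, disk z -> 0 < tau z) /\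
    radial tau /\
    (forall q : R * R, disk (toC q) -> differentiable (tau \o @toC R) q) /\
    (exists2 c : R, 0 < c & forall z, disk z ->
       (laplacian eta z) `^ (- 2^-1) <= c * tau z /\
       tau z <= c * (laplacian eta z) `^ (- 2^-1)) /\
    tau r%:C @[r --> 1^'-] --> 0 /\
    derive1 (fun t : R => tau t%:C) r @[r --> 1^'-] --> 0.

(* One-sided derivatives are taken at the endpoints. *)
Definition C1_on (R : realType) (a b : R) (f : R -> R) : Prop :=
  exists2 df : R -> R, {within `[a, b], continuous df} &
    forall t, t \in `[a, b] ->
      (f s - f t) / (s - t) @[s --> within `[a, b] t^'] --> df t.

Definition piecewise_smooth (R : realType) (gamma : R -> R[i]) : Prop :=
  exists (n : nat) (t : nat -> R),
    [/\ t 0%N = 0, t n = 1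
      & forall i, (i < n)%N ->
          [/\ t i < t i.+1,
              C1_on (t i) (t i.+1) (fun s => complex.Re (gamma s))
            & C1_on (t i) (t i.+1) (fun s => complex.Im (gamma s))]].

Definition curve (R : realType) (z w : R[i]) (gamma : R -> R[i]) : Prop :=
  [/\ piecewise_smooth gamma,
      forall t, t \in `[0, 1] -> disk (gamma t),
      gamma 0 = z
    & gamma 1 = w].

Definition speed (R : realType) (gamma : R -> R[i]) (t : R) : R :=
  normc (derive1 (fun s => complex.Re (gamma s)) t +i*
         derive1 (fun s => complex.Im (gamma s)) t).

Definition tau_length (R : realType) (tau : R[i] -> R) (gamma : R -> R[i]) : R :=
  \int[@lebesgue_measure R]_(t in `[0, 1]) (speed gamma t / tau (gamma t)).

Definition d_tau (R : realType) (tau : R[i] -> R) (z w : R[i]) : R :=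
  inf [set tau_length tau gamma | gamma in curve z w].

Definition rho_tau (R : realType) (tau : R[i] -> R) (z w : R[i]) : R :=
  1 - expR (- d_tau tau z w).

Definition rho_tau_maps (R : realType) (tau : R[i] -> R)
    (phi psi : R[i] -> R[i]) (z : R[i]) : R :=
  rho_tau tau (phi z) (psi z).

(* Main.v *)
(* Put X = omega(z) / omega(a), where a = phi(z), b = psi(z), and
   kappa = |a - b| / (tau(a) + |a - b|). Integration along a segment gives
   rho_tau(a, b) <= 3 kappa when |a| is near 1.

   Lower bounds for C_phi - C_psi come from the test functions
     (zeta / a) ^ n * (mean of (zeta / a) ^ k over k < K) ^ m * (zeta - b)
   with n close to |a| * eta'(|a|) and K close to 1 / tau(a). Suitably normalized,
   they are bounded in A^p(omega), vanish at b, have size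
   kappa * tau(a) ^ (-2/p) / omega(a) at a, and tend to 0 pointwise as |a| -> 1.

   Upper bounds come from the point evaluation estimate
   |g(z)| omega(z) tau(z) ^ (2/p) <= C ||g||, obtained by applying the submean value
   property of |g| ^ p to g * zeta ^ (-n): radially,
   zeta ^ n balances omega on squares of side comparable to tau(z).

   Together, rho * X <= C ||(C_phi - C_psi) f|| (tau(a) / tau(z)) ^ (2/p). If
   |a| <= |z|, then tau(a) <= 2 tau(z) or X is small. If |z| < |a|, then
   tau(a) / tau(z) <= 1 + C log X, and this logarithmic loss is compensated by the
   second factor rho, since rho ^ 2 * X = (rho * X) ^ 2 / X. *)
Require Import Defs.
From mathcomp Require Import measurable_realfun ring lra.
Set Implicit Arguments.
Unset Strict Implicit.
Unset Printing Implicit Defensive.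
Import Order.TTheory GRing.Theory Num.Theory numFieldNormedType.Exports.
Import ComplexField.Normc.
Local Open Scope classical_set_scope.
Local Open Scope ring_scope.
Local Open Scope complex_scope.

(** * Goursat's theorem on rectangles *)

(** The exponent [h] of the weight is convex as a function of [ln r], with slope [N r = r * h' r],
    because the Laplacian of a radial function is [N' r / r]. The logarithms [n * ln r] of monomials
    therefore play the role of tangent lines of [h]. A tangent at [s] stays below [h] everywhere,
    which keeps the test functions bounded on the whole disk; it departs from [h] by a bounded
    amount for [|r - s| <= tau / 2], since [N'] is of order [tau ^ (-2)]. Rounding [N s] to an
    integer costs one more bounded factor. Monomials do not decay in the angular direction. The
    geometric mean supplies this decay at scale [tau]; the growth that it causes beyond [|a|] is
    absorbed because [N] increases by any prescribed multiple of [1 / tau] over a distance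
    comparable to [tau]. As [p] may be less than 1, the triangle inequality of the norm and duality
    are avoided. The submean value property of [|g| ^ p] comes from Cauchy's estimate on rectangles,
    a shape adapted to the product structure of the area measure: Tonelli's theorem selects sides on
    which [|g|] has a small integral. *)

Definition sint (R : realType) (a b : R) (f : R -> R) : R :=
  \int[@lebesgue_measure R]_(x in `[a, b]) f x.

(** Continuity at the end points is two-sided. The integrands below come from functions that are
    complex differentiable at every point of the closed segment, so this form is available and
    passes to subsegments at once. *)
Definition cont_seg (R : realType) (a b : R) (f : R -> R) : Prop :=
  forall x, a <= x <= b -> {for x, continuous f}.

Lemma cont_seg_integrable (R : realType) (a b : R) (f : R -> R) :
  cont_seg a b f ->
  (@lebesgue_measure R).-integrable `[a, b] (EFin \o f).
Proof.
move=> cf; apply: continuous_compact_integrable; first exact: segment_compact.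
apply: continuous_in_subspaceT => x; rewrite inE /= in_itv /= => xab.
exact: cf.
Qed.

Lemma cont_segS (R : realType) (a b c d : R) (f : R -> R) :
  c <= a -> b <= d -> cont_seg c d f -> cont_seg a b f.
Proof. by move=> ca bd h x xab; apply: h; lra. Qed.

Lemma cont_segD (R : realType) (a b : R) (f g : R -> R) :
  cont_seg a b f -> cont_seg a b g -> cont_seg a b (fun x => f x + g x).
Proof. by move=> cf cg x xab; apply: continuousD; [exact: cf|exact: cg]. Qed.

Lemma cont_segB (R : realType) (a b : R) (f g : R -> R) :
  cont_seg a b f -> cont_seg a b g -> cont_seg a b (fun x => f x - g x).
Proof. by move=> cf cg x xab; apply: continuousB; [exact: cf|exact: cg]. Qed.

Lemma sintD (R : realType) (a b : R) (f g : R -> R) :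
  cont_seg a b f -> cont_seg a b g ->
  sint a b (fun x => f x + g x) = sint a b f + sint a b g.
Proof. by move=> cf cg; rewrite /sint RintegralD//; exact: cont_seg_integrable. Qed.

Lemma sint_split (R : realType) (a m b : R) (f : R -> R) :
  a <= m -> m <= b -> cont_seg a b f ->
  sint a b f = sint a m f + sint m b f.
Proof.
move=> am mb cf; rewrite /sint.
have := @Rintegral_itvB R f (BLeft a) (BRight b) m (cont_seg_integrable cf).
rewrite !bnd_simp => /(_ am mb) H.
rewrite -(@Rintegral_itv_obnd_cbnd R m (BRight b)).
  by rewrite -H addrC subrK.
apply: integrableS (cont_seg_integrable cf) => //.
by apply: subset_itv; rewrite !bnd_simp.
Qed.

Lemma sint_le (R : realType) (a b : R) (f g : R -> R) :
  cont_seg a b f -> cont_seg a b g -> (forall x, a <= x <= b -> f x <= g x) ->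
  sint a b f <= sint a b g.
Proof.
move=> cf cg fg; apply: le_Rintegral => //; try exact: cont_seg_integrable.
Qed.

Lemma sint_cst (R : realType) (a b k : R) :
  a <= b -> sint a b (fun=> k) = k * (b - a).
Proof.
move=> ab; rewrite /sint Rintegral_cst//.
have H : (@lebesgue_measure R `[a, b]%classic = (b - a)%:E)%E.
  rewrite lebesgue_measure_itv /= lte_fin.
  by move: ab; rewrite le_eqVlt => /predU1P[->|->] //; rewrite ltxx subrr.
by congr (_ * _); transitivity (fine (b - a)%:E) => //; congr fine; exact: H.
Qed.

Lemma cont_seg_cst (R : realType) (a b k : R) : cont_seg a b (fun=> k).
Proof. by move=> x _; exact: cst_continuous. Qed.

Lemma sint_near_cst (R : realType) (a b k e : R) (f : R -> R) :
  a <= b -> cont_seg a b f -> (forall x, a <= x <= b -> `|f x - k| <= e) ->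
  `|sint a b f - k * (b - a)| <= e * (b - a).
Proof.
move=> ab cf fk.
have h1 : sint a b f <= (k + e) * (b - a).
  rewrite -sint_cst//; apply: sint_le => //; first exact: cont_seg_cst.
  by move=> x /fk; rewrite ler_norml => /andP[]; lra.
have h2 : (k - e) * (b - a) <= sint a b f.
  rewrite -sint_cst//; apply: sint_le => //; first exact: cont_seg_cst.
  by move=> x /fk; rewrite ler_norml => /andP[]; lra.
by rewrite ler_norml; apply/andP; split; lra.
Qed.

(* [P a b c d] is a property of the rectangle [a, b] x [c, d]. *)
Lemma rect_bisect (R : realType) (P : R -> R -> R -> R -> Prop) (a b c d : R) :
  a <= b -> c <= d ->
  (forall a' b' c' d', a <= a' -> a' <= b' -> b' <= b ->
     c <= c' -> c' <= d' -> d' <= d ->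
     let m := (a' + b') / 2 in let n := (c' + d') / 2 in
     P a' m c' n -> P m b' c' n -> P a' m n d' -> P m b' n d' ->
     P a' b' c' d') ->
  (forall x y, a <= x <= b -> c <= y <= d -> exists2 e, 0 < e &
     forall a' b' c' d', a <= a' -> a' <= x <= b' -> b' <= b ->
       c <= c' -> c' <= y <= d' -> d' <= d ->
       (b' - a') + (d' - c') < e -> P a' b' c' d') ->
  P a b c d.
Proof.
move=> ab cd Pq Ploc; apply: contrapT => nP.
pose ok (q : R * R * R * R) := let '(a', b', c', d') := q in
  [/\ [/\ a <= a', a' <= b' & b' <= b], [/\ c <= c', c' <= d' & d' <= d]
    & ~ P a' b' c' d'].
pose sub (q q' : R * R * R * R) :=
  let '(a1, b1, c1, d1) := q in let '(a2, b2, c2, d2) := q' in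
  [/\ a1 <= a2, b2 <= b1, c1 <= c2 & d2 <= d1] /\
  (b2 - a2) + (d2 - c2) = ((b1 - a1) + (d1 - c1)) / 2.
(* Some quarter of a bad rectangle is bad. With [ok q] as a premise the claim holds for every [q],
   so [choice] yields a total successor map. *)
have step q : exists q', ok q -> ok q' /\ sub q q'.
  have [okq|] := pselect (ok q); last by move=> nok; exists q.
  move: q okq => [[[a1 b1] c1] d1] [[h1 h2 h3] [h4 h5 h6] nPq].
  set m := (a1 + b1) / 2; set n := (c1 + d1) / 2.
  have [P1|P1] := pselect (P a1 m c1 n); last first.
    exists (a1, m, c1, n) => _.
    by split; split => //; try split => //; rewrite /m /n; lra.
  have [P2|P2] := pselect (P m b1 c1 n); last first.
    exists (m, b1, c1, n) => _.
    by split; split => //; try split => //; rewrite /m /n; lra.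
  have [P3|P3] := pselect (P a1 m n d1); last first.
    exists (a1, m, n, d1) => _.
    by split; split => //; try split => //; rewrite /m /n; lra.
  have [P4|P4] := pselect (P m b1 n d1); last first.
    exists (m, b1, n, d1) => _.
    by split; split => //; try split => //; rewrite /m /n; lra.
  by exfalso; apply: nPq; apply: Pq.
have [nx nxP] := choice step.
pose s := fun k => iter k nx (a, b, c, d).
have oks k : ok (s k).
  by elim: k => [|k IH] /=; [split|have [] := nxP _ IH].
have subs k : sub (s k) (s k.+1) by have [] := nxP _ (oks k).
pose A k := (s k).1.1.1; pose B k := (s k).1.1.2.
pose C k := (s k).1.2; pose D k := (s k).2.
have step1 k : [/\ A k <= A k.+1, B k.+1 <= B k, C k <= C k.+1 & D k.+1 <= D k].
  move: (subs k); rewrite /A /B /C /D.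
  by case: (s k) => [[[? ?] ?] ?]; case: (s k.+1) => [[[? ?] ?] ?] [].
have step2 k : (B k.+1 - A k.+1) + (D k.+1 - C k.+1) =
     ((B k - A k) + (D k - C k)) / 2.
  move: (subs k); rewrite /A /B /C /D.
  by case: (s k) => [[[? ?] ?] ?]; case: (s k.+1) => [[[? ?] ?] ?] [].
have step3 k : [/\ [/\ a <= A k, A k <= B k & B k <= b],
    [/\ c <= C k, C k <= D k & D k <= d] & ~ P (A k) (B k) (C k) (D k)].
  by move: (oks k); rewrite /A /B /C /D; case: (s k) => [[[? ?] ?] ?].
have mono j k : [/\ A j <= A (j + k)%N, B (j + k)%N <= B j,
    C j <= C (j + k)%N & D (j + k)%N <= D j].
  elim: k => [|k [i1 i2 i3 i4]]; first by rewrite addn0.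
  by have [j1 j2 j3 j4] := step1 (j + k)%N; rewrite addnS; split; lra.
have AB j k : A j <= B k /\ C j <= D k.
  have [i1 _ i3 _] := mono j k; have [_ i2 _ i4] := mono k j.
  by have [[_ k1 _] [_ k2 _] _] := step3 (j + k)%N; rewrite addnC in i2 i4; split; lra.
(* The common point of the nested rectangles; the local hypothesis at this point rules out the small
   bad ones. *)
pose x := sup (range A); pose y := sup (range C).
have Ax k : A k <= x <= B k.
  apply/andP; split.
    apply: ub_le_sup; last by exists k.
    by exists (B 0%N) => _ [j _ <-]; have [] := AB j 0%N.
  apply: ge_sup; first by exists (A 0%N), 0%N.
  by move=> _ [j _ <-]; have [] := AB j k.
have Cy k : C k <= y <= D k.
  apply/andP; split.
    apply: ub_le_sup; last by exists k.
    by exists (D 0%N) => _ [j _ <-]; have [] := AB j 0%N.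
  apply: ge_sup; first by exists (C 0%N), 0%N.
  by move=> _ [j _ <-]; have [] := AB j k.
have [||e e0 He] := Ploc x y.
- by have := Ax 0%N; rewrite /A /B /=.
- by have := Cy 0%N; rewrite /C /D /=.
have szE k : (B k - A k) + (D k - C k) = ((b - a) + (d - c)) / 2 ^+ k.
  elim: k => [|k IH]; first by rewrite expr0 divr1.
  by rewrite step2 IH exprS invfM; ring.
have [k kP] : exists k : nat, ((b - a) + (d - c)) / 2 ^+ k < e.
  have [k Hk] : exists k : nat, ((b - a) + (d - c)) / e < k%:R.
    by exists (Num.truncn (((b - a) + (d - c)) / e)).+1; exact: truncnS_gt.
  exists k; rewrite ltr_pdivrMr ?exprn_gt0// mulrC.
  rewrite ltr_pdivrMr// in Hk; apply: (lt_le_trans Hk).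
  apply: ler_wpM2r; first exact: ltW.
by rewrite -natrX ler_nat ltnW// ltn_expl.
have [[h1 h2 h3] [h4 h5 h6] nPk] := step3 k.
by apply: nPk; apply: He => //; rewrite szE.
Qed.

(** * The modulus on [R[i]] and complex differentiability in real terms *)

Lemma norm_normc (R : realType) (x : R[i]) : `|x| = (normc x)%:C.
Proof. by []. Qed.

Lemma normc_ge0 (R : realType) (x : R[i]) : 0 <= normc x.
Proof. by case: x => u v; exact: sqrtr_ge0. Qed.

Lemma normc_gt0 (R : realType) (x : R[i]) : x != 0 -> 0 < normc x.
Proof.
move=> x0; rewrite lt_def normc_ge0 andbT.
by apply: contra x0 => /eqP/eq0_normc ->.
Qed.

Lemma normc_Re (R : realType) (z : R[i]) : `|complex.Re z| <= normc z.
Proof.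
case: z => x y; rewrite /normc /= -sqrtr_sqr ler_sqrt ?addr_ge0 ?sqr_ge0//.
by rewrite lerDl sqr_ge0.
Qed.

Lemma normc_Im (R : realType) (z : R[i]) : `|complex.Im z| <= normc z.
Proof.
case: z => x y; rewrite /normc /= -sqrtr_sqr ler_sqrt ?addr_ge0 ?sqr_ge0//.
by rewrite lerDr sqr_ge0.
Qed.

Lemma normc_le1 (R : realType) (z : R[i]) :
  normc z <= `|complex.Re z| + `|complex.Im z|.
Proof.
case: z => x y; rewrite /normc /= -[leRHS]ger0_norm ?addr_ge0// -sqrtr_sqr.
rewrite ler_sqrt ?sqr_ge0// sqrrD !real_normK ?num_real//.
by rewrite lerD2r lerDl mulrn_wge0 ?mulr_ge0.
Qed.

Lemma normcD (R : realType) (x y : R[i]) : normc (x + y) <= normc x + normc y.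
Proof. by rewrite -lecR rmorphD /= -!norm_normc ler_normD. Qed.

Lemma normc_exp (R : realType) (w : R[i]) (n : nat) : normc (w ^+ n) = normc w ^+ n.
Proof.
elim: n => [|n IH]; first by rewrite !expr0 normc1.
by rewrite !exprS normcM IH.
Qed.

(** Balls of [R[i]] have radii in [R[i]]; a positive one is real, which turns the limit of
    difference quotients into a first-order expansion with real [e] and [d]. *)
Lemma derivable_normc (R : realType) (g : R[i] -> R[i]) (z : R[i]) :
  derivable (g : R[i]^o -> R[i]^o) z 1 ->
  exists D : R[i], forall e : R, 0 < e -> exists2 d : R, 0 < d &
    forall w, normc (w - z) < d ->
      normc (g w - g z - D * (w - z)) <= e * normc (w - z).
Proof.
move=> /cvg_ex[/= D Hd]; exists D => e e0.
have e0' : 0 < e%:C :> R[i] by rewrite ltcR.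
move/cvgrPdist_lt : Hd => /(_ _ e0').
move=> /nbhs_ballP[/= d d0 dP].
have [d1 dE] : exists d1 : R, d = d1%:C.
  by exists (complex.Re d); apply/esym/RRe_real; exact: gtr0_real.
move: d0 dP; rewrite dE ltcR => d0 dP.
exists d1 => // w wz.
have [->|wz0] := eqVneq w z.
  by rewrite !subrr mulr0 subr0 normc0 mulr0.
have wz1 : w - z != 0 by rewrite subr_eq0.
have bw : ball (0 : R[i]^o) d1%:C (w - z).
  by rewrite -ball_normE /ball_ /= sub0r normrN norm_normc ltcR.
have := dP _ bw wz1.
have gs : (w - z)%:A + z = w :> R[i].
  by rewrite /GRing.scale /= mulr1 subrK.
rewrite gs norm_normc ltcR => /ltW H.
have -> : g w - g z - D * (w - z) =
    - ((D - (w - z)^-1 *: (g w - g z : R[i]^o)) * (w - z)).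
  by rewrite /GRing.scale /= mulrBl opprB mulrAC mulVf// mul1r.
by rewrite normcN normcM ler_wpM2r// normc_ge0.
Qed.

Lemma derivable_cvg_normc (R : realType) (g : R[i] -> R[i]) (z : R[i]) :
  derivable (g : R[i]^o -> R[i]^o) z 1 ->
  forall e : R, 0 < e -> exists2 d : R, 0 < d &
    forall w, normc (w - z) < d -> normc (g w - g z) <= e.
Proof.
move=> /derivable_normc[D HD] e e0.
have [d d0 dP] := HD 1 ltr01.
pose k := normc D + 1.
have k0 : 0 < k by rewrite ltr_wpDl// normc_ge0.
exists (Num.min d (e / k)); first by rewrite lt_min d0 divr_gt0.
move=> w; rewrite lt_min => /andP[/dP wd we].
have -> : g w - g z = (g w - g z - D * (w - z)) + D * (w - z) by rewrite subrK.
apply: (le_trans (normcD _ _)); rewrite normcM.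
move: we; rewrite ltr_pdivlMr// => /ltW; apply: le_trans.
by move: wd; rewrite /k; lra.
Qed.

(** [F] stands for [Re], [Im] or [normc], all 1-Lipschitz for the modulus, so one argument serves
    the three kinds of integrands. *)
Lemma derivable_cont_line (R : realType) (g : R[i] -> R[i]) (x y : R)
    (F : R[i] -> R) :
  derivable (g : R[i]^o -> R[i]^o) (x +i* y) 1 ->
  (forall u v, `|F u - F v| <= normc (u - v)) ->
  {for x, continuous (fun t => F (g (t +i* y)))} /\
  {for y, continuous (fun t => F (g (x +i* t)))}.
Proof.
move=> dg HF; split; apply/cvgrPdist_le => e e0;
  have [d d0 dP] := derivable_cvg_normc dg e0;
  apply/nbhs_ballP; exists d => //= t; rewrite /ball /= => xt;
  (apply: (le_trans (HF _ _)); rewrite -opprB normcN; apply: dP;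
   rewrite /normc /= ?subrr ?expr0n ?addr0 ?add0r /= sqrtr_sqr distrC//).
Qed.

Lemma Re_lip (R : realType) (u v : R[i]) :
  `|complex.Re u - complex.Re v| <= normc (u - v).
Proof. by apply: le_trans (normc_Re _); rewrite raddfB. Qed.

Lemma Im_lip (R : realType) (u v : R[i]) :
  `|complex.Im u - complex.Im v| <= normc (u - v).
Proof. by apply: le_trans (normc_Im _); rewrite raddfB. Qed.

Lemma normc_lip (R : realType) (u v : R[i]) :
  `|normc u - normc v| <= normc (u - v).
Proof.
have h1 := normcD (u - v) v; have h2 := normcD (v - u) u.
rewrite subrK in h1; rewrite subrK -opprB normcN in h2.
by rewrite ler_norml; apply/andP; split; lra.
Qed.

Definition dble (R : realType) (g : R[i] -> R[i]) (x y : R) : Prop :=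
  derivable (g : R[i]^o -> R[i]^o) (x +i* y) 1.

(* The real part of the counterclockwise integral of [g] along the boundary of
   [a, b] x [c, d]. *)
Definition bdry (R : realType) (g : R[i] -> R[i]) (a b c d : R) : R :=
  sint a b (fun x => complex.Re (g (x +i* c)) - complex.Re (g (x +i* d))) -
  sint c d (fun y => complex.Im (g (b +i* y)) - complex.Im (g (a +i* y))).

Lemma cont_segh (R : realType) (g : R[i] -> R[i]) (F : R[i] -> R) (a b c : R) :
  (forall u v, `|F u - F v| <= normc (u - v)) ->
  (forall x, a <= x <= b -> dble g x c) ->
  cont_seg a b (fun x => F (g (x +i* c))).
Proof. by move=> HF dg x /dg/derivable_cont_line /(_ HF)[]. Qed.

Lemma cont_segv (R : realType) (g : R[i] -> R[i]) (F : R[i] -> R) (a c d : R) :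
  (forall u v, `|F u - F v| <= normc (u - v)) ->
  (forall y, c <= y <= d -> dble g a y) ->
  cont_seg c d (fun y => F (g (a +i* y))).
Proof. by move=> HF dg x /dg/derivable_cont_line /(_ HF)[]. Qed.

Lemma bdry_splitx (R : realType) (g : R[i] -> R[i]) (a m b c d : R) :
  a <= m -> m <= b ->
  (forall x, a <= x <= b -> dble g x c /\ dble g x d) ->
  (forall y, c <= y <= d -> [/\ dble g a y, dble g m y & dble g b y]) ->
  bdry g a b c d = bdry g a m c d + bdry g m b c d.
Proof.
move=> am mb dx dy; rewrite /bdry (@sint_split _ a m b)//; last first.
  by apply: cont_segB; (apply: cont_segh; [exact: Re_lip | move=> x /dx[]]).
set I1 := sint a m _; set I2 := sint m b _.
suff -> : sint c d (fun y => complex.Im (g (b +i* y)) - complex.Im (g (a +i* y)))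
   = sint c d (fun y => complex.Im (g (m +i* y)) - complex.Im (g (a +i* y))) +
     sint c d (fun y => complex.Im (g (b +i* y)) - complex.Im (g (m +i* y))).
  by ring.
have ca : cont_seg c d (fun y => complex.Im (g (a +i* y))).
  by apply: cont_segv; [exact: Im_lip | move=> y /dy[]].
have cb : cont_seg c d (fun y => complex.Im (g (b +i* y))).
  by apply: cont_segv; [exact: Im_lip | move=> y /dy[]].
have cm : cont_seg c d (fun y => complex.Im (g (m +i* y))).
  by apply: cont_segv; [exact: Im_lip | move=> y /dy[]].
rewrite -sintD; [|exact: cont_segB..].
by congr sint; apply/funext => y; ring.
Qed.

Lemma bdry_splity (R : realType) (g : R[i] -> R[i]) (a b c m d : R) :
  c <= m -> m <= d ->
  (forall x, a <= x <= b -> [/\ dble g x c, dble g x m & dble g x d]) ->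
  (forall y, c <= y <= d -> dble g a y /\ dble g b y) ->
  bdry g a b c d = bdry g a b c m + bdry g a b m d.
Proof.
move=> cm md dx dy; rewrite /bdry (@sint_split _ c m d)//; last first.
  by apply: cont_segB; (apply: cont_segv; [exact: Im_lip | move=> x /dy[]]).
set I1 := sint c m _; set I2 := sint m d _.
suff -> : sint a b (fun x => complex.Re (g (x +i* c)) - complex.Re (g (x +i* d)))
   = sint a b (fun x => complex.Re (g (x +i* c)) - complex.Re (g (x +i* m))) +
     sint a b (fun x => complex.Re (g (x +i* m)) - complex.Re (g (x +i* d))).
  by ring.
have ca : cont_seg a b (fun x => complex.Re (g (x +i* c))).
  by apply: cont_segh; [exact: Re_lip | move=> y /dx[]].
have cb : cont_seg a b (fun x => complex.Re (g (x +i* d))).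
  by apply: cont_segh; [exact: Re_lip | move=> y /dx[]].
have cm' : cont_seg a b (fun x => complex.Re (g (x +i* m))).
  by apply: cont_segh; [exact: Re_lip | move=> y /dx[]].
rewrite -sintD; [|exact: cont_segB..].
by congr sint; apply/funext => y; ring.
Qed.

(** The affine approximation of [g] at [p] contributes nothing: on it, each of the two integrals of
    differences between opposite sides equals [Im D] times the area, and [bdry] subtracts them. Only
    the error term remains. *)
Lemma bdry_small (R : realType) (g : R[i] -> R[i]) (p D : R[i]) (e a b c d : R) :
  a <= b -> c <= d -> 0 <= e ->
  (forall x y, a <= x <= b -> c <= y <= d ->
     dble g x y /\
     normc (g (x +i* y) - g p - D * (x +i* y - p)) <= e * (b - a + (d - c))) ->
  `|bdry g a b c d| <= 2 * e * (b - a + (d - c)) ^+ 2.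
Proof.
move=> ab cd e0 H.
have ain : a <= a <= b by lra.
have bin : a <= b <= b by lra.
have cin : c <= c <= d by lra.
have din : c <= d <= d by lra.
set s := b - a + (d - c) in H *.
have E1 : `|sint a b (fun x => complex.Re (g (x +i* c)) - complex.Re (g (x +i* d)))
     - complex.Im D * (d - c) * (b - a)| <= 2 * e * s * (b - a).
  apply: sint_near_cst => //.
    by apply: cont_segB; (apply: cont_segh; [exact: Re_lip|]);
      move=> x xab; [have [] := H x c xab cin|have [] := H x d xab din].
  move=> x xab; have [_ /(le_trans (normc_Re _)) h1] := H x c xab cin.
  have [_ /(le_trans (normc_Re _)) h2] := H x d xab din.
  move: h1 h2; case: (g p) => gp1 gp2; case: D {H} => D1 D2; case: p => p1 p2.
  case: (g (x +i* c)) => u1 v1; case: (g (x +i* d)) => u2 v2 /=.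
  by rewrite !ler_norml => /andP[? ?] /andP[? ?]; apply/andP; split; lra.
have E2 : `|sint c d (fun y => complex.Im (g (b +i* y)) - complex.Im (g (a +i* y)))
     - complex.Im D * (b - a) * (d - c)| <= 2 * e * s * (d - c).
  apply: sint_near_cst => //.
    by apply: cont_segB; (apply: cont_segv; [exact: Im_lip|]);
      move=> y yab; [have [] := H b y bin yab|have [] := H a y ain yab].
  move=> x xab; have [_ /(le_trans (normc_Im _)) h1] := H a x ain xab.
  have [_ /(le_trans (normc_Im _)) h2] := H b x bin xab.
  move: h1 h2; case: (g p) => gp1 gp2; case: D {H E1} => D1 D2; case: p => p1 p2.
  case: (g (a +i* x)) => u1 v1; case: (g (b +i* x)) => u2 v2 /=.
  by rewrite !ler_norml => /andP[? ?] /andP[? ?]; apply/andP; split; lra.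
rewrite /bdry; move: E1 E2; set I1 := sint _ _ _; set I2 := sint _ _ _.
rewrite !ler_norml => /andP[? ?] /andP[? ?].
by rewrite (_ : 2 * e * s ^+ 2 = 2 * e * s * (b - a) + 2 * e * s * (d - c));
  [apply/andP; split; lra | rewrite /s; ring].
Qed.

(** With [s] the half-perimeter, the bound [2 * e * s ^+ 2] is additive under quartering because
    [4 * (s / 2) ^+ 2 = s ^+ 2], and [bdry_small] provides it near each point. Vanishing of the real
    part is enough later, as a unimodular factor in the Cauchy kernel makes the contribution of the
    pole real. *)
Lemma goursat (R : realType) (g : R[i] -> R[i]) (a b c d : R) :
  a <= b -> c <= d ->
  (forall x y, a <= x <= b -> c <= y <= d -> dble g x y) ->
  bdry g a b c d = 0.
Proof.
move=> ab cd dg.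
suff H e : 0 < e -> `|bdry g a b c d| <= 2 * e * (b - a + (d - c)) ^+ 2.
  apply/eqP; rewrite -normr_eq0; apply/eqP/le_anti; rewrite normr_ge0 andbT.
  apply/ler_addgt0Pr => e e0; rewrite add0r.
  set s := (b - a + (d - c)) ^+ 2 in H.
  have s0 : 0 <= s by rewrite sqr_ge0.
  apply: le_trans (H (e / (2 * (s + 1))) _) _.
    by rewrite divr_gt0// mulr_gt0// ltr_wpDl.
  rewrite [leLHS](_ : _ = e * (s / (s + 1))); last first.
    by field; rewrite gt_eqF// ltr_wpDl.
  by rewrite ger_pMr// ler_pdivrMr ?ltr_wpDl// mul1r lerDl.
move=> e0.
pose P a' b' c' d' := `|bdry g a' b' c' d'| <= 2 * e * (b' - a' + (d' - c')) ^+ 2.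
apply: (@rect_bisect R P) => //.
  move=> a' b' c' d' aa ab' bb cc cd' dd m n; rewrite /P.
  have dg' x y : a' <= x <= b' -> c' <= y <= d' -> dble g x y.
    by move=> xab ycd; apply: dg; lra.
  have mab : a' <= m <= b' by rewrite /m; lra.
  have ncd : c' <= n <= d' by rewrite /n; lra.
  rewrite (@bdry_splitx _ g a' m b' c' d'); [|lra|lra| |]; last 2 first.
  - by move=> x xab; split; apply: dg'; lra.
  - by move=> y ycd; split; apply: dg'; lra.
  rewrite (@bdry_splity _ g a' m c' n d'); [|lra|lra| |]; last 2 first.
  - by move=> x xab; split; apply: dg'; lra.
  - by move=> y ycd; split; apply: dg'; lra.
  rewrite (@bdry_splity _ g m b' c' n d'); [|lra|lra| |]; last 2 first.
  - by move=> x xab; split; apply: dg'; lra.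
  - by move=> y ycd; split; apply: dg'; lra.
  set s := b' - a' + (d' - c').
  rewrite (_ : m - a' + (n - c') = s / 2); last by rewrite /m /n /s; field.
  rewrite (_ : b' - m + (n - c') = s / 2); last by rewrite /m /n /s; field.
  rewrite (_ : m - a' + (d' - n) = s / 2); last by rewrite /m /n /s; field.
  rewrite (_ : b' - m + (d' - n) = s / 2); last by rewrite /m /n /s; field.
  rewrite (_ : 2 * e * s ^+ 2 = 4 * (2 * e * (s / 2) ^+ 2)); last by field.
  rewrite !ler_norml => /andP[? ?] /andP[? ?] /andP[? ?] /andP[? ?].
  by apply/andP; split; lra.
move=> x y xab ycd.
have [D HD] := derivable_normc (dg x y xab ycd).
have [d0 d00 dP] := HD e e0.
exists d0 => // a' b' c' d' aa xab' bb cc ycd' dd sz.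
apply: (@bdry_small _ g (x +i* y) D) => //; [lra|lra|exact: ltW|].
move=> x' y' x'ab y'cd; split; first by apply: dg; lra.
have nle : normc (x' +i* y' - x +i* y) <= b' - a' + (d' - c').
  apply: le_trans (normc_le1 _) _ => /=; apply: lerD.
    by rewrite ler_norml; apply/andP; split; lra.
  by rewrite ler_norml; apply/andP; split; lra.
apply: le_trans (dP _ _) _; first exact: le_lt_trans nle _.
by rewrite ler_wpM2l// ltW.
Qed.

(** * The Cauchy estimate on rectangles *)

Lemma sqr_normcE (R : realType) (h : R[i]) :
  normc h ^+ 2 = complex.Re h ^+ 2 + complex.Im h ^+ 2.
Proof. by case: h => u v; rewrite /normc sqr_sqrtr// addr_ge0// sqr_ge0. Qed.

Lemma sqr_le_of_abs (R : realType) (t s : R) : - s <= t <= s -> t ^+ 2 <= s ^+ 2.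
Proof. by move=> /andP[? ?]; nra. Qed.

(** For [w = -iG] the real and imaginary parts of [w / h] are exactly [- G * Im h / |h| ^ 2] and
    [- G * Re h / |h| ^ 2]; moving [w] by at most [G / 4] moves the quotient by at most
    [G / (4 * |h|)]. *)
Lemma kernel_est (R : realType) (G : R) (w h : R[i]) :
  h != 0 -> normc (w + (0 +i* G)) <= G / 4 ->
  `|complex.Re (w / h) + G * complex.Im h / normc h ^+ 2| <= G / 4 / normc h /\
  `|complex.Im (w / h) + G * complex.Re h / normc h ^+ 2| <= G / 4 / normc h.
Proof.
move=> h0 wG; have n0 := normc_gt0 h0.
have -> : w / h = (w + (0 +i* G)) / h - (0 +i* G) / h by rewrite -mulrBl addrK.
have e1 : normc ((w + (0 +i* G)) / h) <= G / 4 / normc h.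
  by rewrite normcM normcV ler_wpM2r// invr_ge0 ltW.
move: e1; set E := (_ / h) => e1.
have -> : (0 +i* G) / h = (G * complex.Im h / normc h ^+ 2) +i*
    (G * complex.Re h / normc h ^+ 2).
  have s0 : complex.Re h ^+ 2 + complex.Im h ^+ 2 != 0.
    by rewrite -sqr_normcE gt_eqF// exprn_gt0.
  rewrite sqr_normcE; apply: (mulIf h0); rewrite mulfVK//.
  case: h s0 {h0 n0 E e1} => X Y /= s0; apply/eqP; rewrite eq_complex /=.
  by apply/andP; split; apply/eqP; field.
have := normc_Re E; have := normc_Im E; case: E e1 => a b /= e1 h1 h2.
by rewrite !subrK; split; [exact: le_trans h2 _|exact: le_trans h1 _].
Qed.

(** On the boundary of the square, [s <= |h|] and [|h| ^ 2 <= 2 * s ^ 2]. The main term of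
    [kernel_est] is then at least [G / (2 * s)] in absolute value and the error at most
    [G / (4 * s)], so the sign on each side is that of the main term. *)
Lemma kernel_square (R : realType) (G s : R) (w h : R[i]) :
  0 < G -> 0 < s -> `|complex.Re h| <= s -> `|complex.Im h| <= s ->
  `|complex.Re h| = s \/ `|complex.Im h| = s ->
  normc (w + (0 +i* G)) <= G / 4 ->
  [/\ h != 0,
     (complex.Re h = s -> complex.Im (w / h) <= - (G / (4 * s))),
     (complex.Re h = - s -> G / (4 * s) <= complex.Im (w / h)),
     (complex.Im h = s -> complex.Re (w / h) <= - (G / (4 * s))) &
     (complex.Im h = - s -> G / (4 * s) <= complex.Re (w / h))].
Proof.
move=> G0 s0 hX hY hs wG.
have sn : s <= normc h by case: hs => <-; [exact: normc_Re|exact: normc_Im].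
have n0 : 0 < normc h by exact: lt_le_trans sn.
have h0 : h != 0 by apply: contraTneq n0 => ->; rewrite normc0 ltxx.
have hsq : normc h ^+ 2 <= 2 * s ^+ 2.
  rewrite sqr_normcE mulr_natl mulr2n; apply: lerD; apply: sqr_le_of_abs;
  by rewrite -ler_norml.
have [] := kernel_est h0 wG.
set A := G / 4 / normc h; set u := w / h.
have hA : A <= G / (4 * s).
  rewrite /A invfM mulrA; apply: ler_wpM2l; first by rewrite divr_ge0 ?ltW.
  by rewrite lef_pV2 ?posrE.
have hB : G / (2 * s) <= G * s / normc h ^+ 2.
  rewrite -mulrA; apply: ler_wpM2l; first exact: ltW.
  rewrite ler_pdivlMr ?exprn_gt0// mulrC.
  by rewrite ler_pdivrMr ?mulr_gt0// mulrCA -expr2.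
have hC : G / (2 * s) = 2 * (G / (4 * s)) by field; rewrite gt_eqF.
rewrite !ler_norml => /andP[e1 e2] /andP[e3 e4]; split => // hx'.
- by move: e4; rewrite hx'; clear -hA hB hC; lra.
- by move: e3; rewrite hx' mulrN mulNr; clear -hA hB hC; lra.
- by move: e2; rewrite hx'; clear -hA hB hC; lra.
- by move: e1; rewrite hx' mulrN mulNr; clear -hA hB hC; lra.
Qed.

Definition hder (R : realType) (f : R[i] -> R[i]) (z : R[i]) : Prop :=
  derivable (f : R[i]^o -> R[i]^o) z 1.

Lemma hder_cst (R : realType) (k z : R[i]) : hder (fun=> k) z.
Proof. exact: derivable_cst. Qed.

Arguments hder_cst {R} k z.

Lemma hder_id (R : realType) (z : R[i]) : hder id z.
Proof. exact: derivable_id. Qed.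

Arguments hder_id {R} z.

Lemma hderD (R : realType) (f g : R[i] -> R[i]) (z : R[i]) :
  hder f z -> hder g z -> hder (fun w => f w + g w) z.
Proof. exact: derivableD. Qed.
Arguments hderD {R f g z} _ _.

Lemma hderB (R : realType) (f g : R[i] -> R[i]) (z : R[i]) :
  hder f z -> hder g z -> hder (fun w => f w - g w) z.
Proof. exact: derivableB. Qed.
Arguments hderB {R f g z} _ _.

Lemma hderM (R : realType) (f g : R[i] -> R[i]) (z : R[i]) :
  hder f z -> hder g z -> hder (fun w => f w * g w) z.
Proof. exact: (@derivableM _ R[i]^o). Qed.
Arguments hderM {R f g z} _ _.

Lemma hderV (R : realType) (f : R[i] -> R[i]) (z : R[i]) :
  f z != 0 -> hder f z -> hder (fun w => (f w)^-1) z.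
Proof. exact: (@derivableV _ R[i]^o). Qed.
Arguments hderV {R f z} _ _.

Lemma hderX (R : realType) (f : R[i] -> R[i]) (n : nat) (z : R[i]) :
  hder f z -> hder (fun w => f w ^+ n) z.
Proof.
move=> df; elim: n => [|n IH]; first exact: hder_cst.
rewrite (_ : (fun w => _) = (fun w => f w * f w ^+ n)); first exact: hderM.
by apply/funext => w; rewrite exprS.
Qed.
Arguments hderX {R f} n {z} _.

Lemma dble_kernel (R : realType) (g : R[i] -> R[i]) (k z : R[i]) (x y : R) :
  dble g x y -> x +i* y != z ->
  dble (fun w => k * g w / (w - z)) x y.
Proof.
move=> dg xyz; have d1 := hderM (hder_cst k _) (dg : hder g _).
have d2 := hderB (hder_id (x +i* y)) (hder_cst z _).
by apply: hderM d1 (hderV _ d2); rewrite subr_eq0.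
Qed.

(** The frame between the two rectangles is cut into a left, a right, a bottom and a top rectangle,
    on each of which [goursat] applies. A pole of [g] strictly inside the inner rectangle is
    allowed. *)
Lemma bdry_frame (R : realType) (g : R[i] -> R[i]) (x1 x2 y1 y2 a b c d : R) :
  x1 <= a -> a < b -> b <= x2 -> y1 <= c -> c < d -> d <= y2 ->
  (forall x y, x1 <= x <= x2 -> y1 <= y <= y2 ->
    ~~ ((a < x < b) && (c < y < d)) -> dble g x y) ->
  bdry g x1 x2 y1 y2 = bdry g a b c d.
Proof.
move=> xa ab bx yc cd dy dg.
have D x y : x1 <= x <= x2 -> y1 <= y <= y2 ->
    [\/ x <= a, b <= x, y <= c | d <= y] -> dble g x y.
  move=> hx hy h; apply: dg => //; apply/negP => /andP[/andP[? ?] /andP[? ?]].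
  by case: h; lra.
rewrite (@bdry_splitx _ g x1 a x2 y1 y2); [|lra|lra| |]; last 2 first.
- by move=> x ?; split; apply: D; try lra; [apply: Or43|apply: Or44]; lra.
- move=> y ?; split; apply: D; try lra; [apply: Or41|apply: Or41|apply: Or42]; lra.
rewrite (@bdry_splitx _ g a b x2 y1 y2); [|lra|lra| |]; last 2 first.
- by move=> x ?; split; apply: D; try lra; [apply: Or43|apply: Or44]; lra.
- move=> y ?; split; apply: D; try lra; [apply: Or41|apply: Or42|apply: Or42]; lra.
rewrite (@bdry_splity _ g a b y1 c y2); [|lra|lra| |]; last 2 first.
- by move=> x ?; split; apply: D; try lra;
    [apply: Or43|apply: Or43|apply: Or44]; lra.
- by move=> y ?; split; apply: D; try lra; [apply: Or41|apply: Or42]; lra.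
rewrite (@bdry_splity _ g a b c d y2); [|lra|lra| |]; last 2 first.
- by move=> x ?; split; apply: D; try lra;
    [apply: Or43|apply: Or44|apply: Or44]; lra.
- by move=> y ?; split; apply: D; try lra; [apply: Or41|apply: Or42]; lra.
rewrite (@goursat _ g x1 a); [|lra|lra|]; last first.
  by move=> x y ? ?; apply: D; try lra; apply: Or41; lra.
rewrite (@goursat _ g b x2); [|lra|lra|]; last first.
  by move=> x y ? ?; apply: D; try lra; apply: Or42; lra.
rewrite (@goursat _ g a b y1); [|lra|lra|]; last first.
  by move=> x y ? ?; apply: D; try lra; apply: Or43; lra.
rewrite (@goursat _ g a b d); [|lra|lra|]; last first.
  by move=> x y ? ?; apply: D; try lra; apply: Or44; lra.
by rewrite !add0r !addr0.
Qed.

Lemma sintMl (R : realType) (a b k : R) (f : R -> R) :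
  cont_seg a b f -> sint a b (fun x => k * f x) = k * sint a b f.
Proof. by move=> cf; rewrite /sint RintegralZl//; exact: cont_seg_integrable. Qed.

Lemma cont_segMl (R : realType) (a b k : R) (f : R -> R) :
  cont_seg a b f -> cont_seg a b (fun x => k * f x).
Proof. by move=> cf x hx; apply: continuousM; [exact: cst_continuous|exact: cf]. Qed.

Lemma bdry_ge (R : realType) (H : R[i] -> R[i]) (a b c d e : R) :
  a <= b -> c <= d ->
  (forall x, a <= x <= b -> [/\ dble H x c, dble H x d,
     e <= complex.Re (H (x +i* c)) & complex.Re (H (x +i* d)) <= - e]) ->
  (forall y, c <= y <= d -> [/\ dble H a y, dble H b y,
     e <= complex.Im (H (a +i* y)) & complex.Im (H (b +i* y)) <= - e]) ->
  2 * e * (b - a) + 2 * e * (d - c) <= bdry H a b c d.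
Proof.
move=> ab cd Hx Hy; rewrite /bdry; apply: lerD.
  rewrite -sint_cst//; apply: sint_le; first exact: cont_seg_cst.
    by apply: cont_segB; (apply: cont_segh; [exact: Re_lip|move=> x /Hx[]]).
  by move=> x /Hx[_ _]; lra.
rewrite lerNr -mulNr -sint_cst//; apply: sint_le; last 2 first.
- exact: cont_seg_cst.
- by move=> x /Hy[_ _]; lra.
by apply: cont_segB; (apply: cont_segv; [exact: Im_lip|move=> x /Hy[]]).
Qed.

Lemma bdry_le (R : realType) (g H : R[i] -> R[i]) (a b c d k : R) :
  (forall x, a <= x <= b -> [/\ dble g x c, dble g x d, dble H x c & dble H x d]) ->
  (forall x, a <= x <= b -> normc (H (x +i* c)) <= k * normc (g (x +i* c)) /\
    normc (H (x +i* d)) <= k * normc (g (x +i* d))) ->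
  (forall y, c <= y <= d -> [/\ dble g a y, dble g b y, dble H a y & dble H b y]) ->
  (forall y, c <= y <= d -> normc (H (a +i* y)) <= k * normc (g (a +i* y)) /\
    normc (H (b +i* y)) <= k * normc (g (b +i* y))) ->
  bdry H a b c d <=
    k * (sint a b (fun x => normc (g (x +i* c)) + normc (g (x +i* d))) +
         sint c d (fun y => normc (g (a +i* y)) + normc (g (b +i* y)))).
Proof.
move=> Dx Hx Dy Hy.
have c1 : cont_seg a b (fun x => normc (g (x +i* c)) + normc (g (x +i* d))).
  by apply: cont_segD; (apply: cont_segh; [exact: normc_lip|move=> x /Dx[]]).
have c2 : cont_seg c d (fun y => normc (g (a +i* y)) + normc (g (b +i* y))).
  by apply: cont_segD; (apply: cont_segv; [exact: normc_lip|move=> x /Dy[]]).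
rewrite /bdry mulrDr; apply: lerD.
  rewrite -sintMl//; apply: sint_le; last 2 first.
  - exact: cont_segMl.
  - move=> x /Hx[]; have := normc_Re (H (x +i* c)); have := normc_Re (H (x +i* d)).
    by rewrite !ler_norml => /andP[? ?] /andP[? ?] ? ?; lra.
  by apply: cont_segB; (apply: cont_segh; [exact: Re_lip|move=> x /Dx[]]).
rewrite lerNl -mulNr -sintMl//; apply: sint_le.
- exact: cont_segMl.
- by apply: cont_segB; (apply: cont_segv; [exact: Im_lip|move=> x /Dy[]]).
- move=> y /Hy[]; have := normc_Im (H (a +i* y)); have := normc_Im (H (b +i* y)).
  by rewrite !ler_norml => /andP[? ?] /andP[? ?] ? ?; lra.
Qed.

(* [H w = k * g w / (w - z)] with [k] a unimodular constant such that the small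
   loop around [z] contributes a positive real number to [bdry H]. *)
Lemma cauchy_rect (R : realType) (g : R[i] -> R[i]) (p q x1 x2 y1 y2 rho : R) :
  0 < rho -> x1 <= p - rho -> p + rho <= x2 -> y1 <= q - rho -> q + rho <= y2 ->
  (forall x y, x1 <= x <= x2 -> y1 <= y <= y2 -> dble g x y) ->
  2 * rho * normc (g (p +i* q)) <=
    sint x1 x2 (fun x => normc (g (x +i* y1)) + normc (g (x +i* y2))) +
    sint y1 y2 (fun y => normc (g (x1 +i* y)) + normc (g (x2 +i* y))).
Proof.
move=> rho0 hx1 hx2 hy1 hy2 dg.
set z := p +i* q; set G := normc (g z).
have [G0|G0] := eqVneq G 0.
  rewrite G0 mulr0; apply: addr_ge0; apply: Rintegral_ge0 => x _;
  by apply: addr_ge0; exact: normc_ge0.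
have Gp : 0 < G by rewrite lt_def G0 normc_ge0.
have gz0 : g z != 0 by apply: contra G0 => /eqP; rewrite /G => ->; rewrite normc0.
pose k := (0 -i* G) / g z.
have nk : normc k = 1.
  by rewrite normcM normcV /normc /= expr0n add0r sqrrN sqrtr_sqr gtr0_norm// divff.
have kz : k * g z = 0 -i* G by rewrite /k divfK.
pose H := fun w => k * g w / (w - z).
have Hn w : normc (H w) = normc (g w) / normc (w - z).
  by rewrite /H normcM normcV normcM nk mul1r.
have dH x y : x1 <= x <= x2 -> y1 <= y <= y2 -> x +i* y != z -> dble H x y.
  by move=> hx hy xyz; apply: dble_kernel => //; exact: dg.
have dgz : dble g p q by apply: dg; lra.
(* On a small enough square around [z], [k * g] stays within [G / 4] of [-iG], as [kernel_square]
   requires. Half side [s <= d / 4] keeps [|x - p| + |y - q| <= 2 * s] below [d]. *)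
have [d d0 dP] := derivable_cvg_normc dgz (divr_gt0 Gp (ltr0n _ 4)).
have [s [s0 sd sr]] : exists s, [/\ 0 < s, s <= d / 4 & s <= rho].
  exists (Num.min (d / 4) rho).
  by rewrite lt_min rho0 divr_gt0// !ge_min !lexx orbT.
have E : bdry H x1 x2 y1 y2 = bdry H (p - s) (p + s) (q - s) (q + s).
  apply: bdry_frame; try lra.
  move=> x y hx hy nin; apply: dH => //; apply: contra nin => /eqP[-> ->].
  by apply/andP; split; lra.
have small x y : p - s <= x <= p + s -> q - s <= y <= q + s ->
    (`|x - p| = s \/ `|y - q| = s) ->
  [/\ dble H x y, (x - p = s -> complex.Im (H (x +i* y)) <= - (G / (4 * s))),
     (x - p = - s -> G / (4 * s) <= complex.Im (H (x +i* y))),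
     (y - q = s -> complex.Re (H (x +i* y)) <= - (G / (4 * s))) &
     (y - q = - s -> G / (4 * s) <= complex.Re (H (x +i* y)))].
  move=> hx hy hs.
  have hX : `|x - p| <= s by rewrite ler_norml; clear -hx; lra.
  have hY : `|y - q| <= s by rewrite ler_norml; clear -hy; lra.
  have wG : normc (k * g (x +i* y) + (0 +i* G)) <= G / 4.
    rewrite (_ : _ + _ = k * (g (x +i* y) - g z)); last first.
      rewrite mulrBr kz; congr (_ + _); apply/eqP.
      by rewrite eq_complex /= oppr0 opprK !eqxx.
    rewrite normcM nk mul1r; apply: dP; apply: le_lt_trans (normc_le1 _) _ => /=.
    by clear -hX hY sd d0; lra.
  have [|||h0 c1 c2 c3 c4] := @kernel_square _ G s _ (x +i* y - z) Gp s0 _ _ _ wG.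
  - exact: hX.
  - exact: hY.
  - exact: hs.
  split; [apply: dH|exact: c1|exact: c2|exact: c3|exact: c4].
  - by clear -hx hx1 hx2 sr; lra.
  - by clear -hy hy1 hy2 sr; lra.
  - by rewrite -subr_eq0.
(* Each of the four sides has length [2 * s] and contributes at least
   [2 * s * (G / (4 * s)) = G / 2]. *)
have L : 2 * G <= bdry H (p - s) (p + s) (q - s) (q + s).
  have e1 : forall t, `|t - s - t| = s.
    by move=> t; rewrite addrC addKr normrN gtr0_norm.
  have e2 : forall t, `|t + s - t| = s by move=> t; rewrite addrC addKr gtr0_norm.
  have f1 t : t - s <= t - s <= t + s by clear -s0; lra.
  have f2 t : t - s <= t + s <= t + s by clear -s0; lra.
  have h1 t : t - s - t = - s by ring.
  have h2 t : t + s - t = s by ring.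
  rewrite [leLHS](_ : _ = 2 * (G / (4 * s)) * (p + s - (p - s)) +
    2 * (G / (4 * s)) * (q + s - (q - s))); last by field; rewrite gt_eqF.
  apply: bdry_ge; [by clear -s0; lra|by clear -s0; lra| |].
  - move=> x hx.
    have [d1 _ _ _ i1] := small _ _ hx (f1 q) (or_intror (e1 q)).
    have [d2 _ _ i2 _] := small _ _ hx (f2 q) (or_intror (e2 q)).
    by split; [exact: d1|exact: d2|exact: i1|exact: i2].
  - move=> y hy.
    have [d1 _ i1 _ _] := small _ _ (f1 p) hy (or_introl (e1 p)).
    have [d2 i2 _ _ _] := small _ _ (f2 p) hy (or_introl (e2 p)).
    by split; [exact: d1|exact: d2|exact: i1|exact: i2].
have far2 x y : (rho <= `|x - p| \/ rho <= `|y - q|) -> rho <= normc (x +i* y - z).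
  move=> [h|h]; apply: (le_trans h).
    exact: le_trans (normc_Re (x +i* y - z)).
  exact: le_trans (normc_Im (x +i* y - z)).
have far x y : (rho <= `|x - p| \/ rho <= `|y - q|) ->
    normc (H (x +i* y)) <= rho^-1 * normc (g (x +i* y)).
  move=> /far2 hr; rewrite Hn mulrC; apply: ler_wpM2r; first exact: normc_ge0.
  by rewrite lef_pV2 ?posrE//; exact: lt_le_trans hr.
have dfar x y : x1 <= x <= x2 -> y1 <= y <= y2 ->
    (rho <= `|x - p| \/ rho <= `|y - q|) -> dble H x y.
  move=> hx hy /far2 h; apply: dH => //; apply/eqP => xyz.
  by move: h; rewrite xyz subrr normc0 leNgt rho0.
have hx1' : rho <= `|x1 - p| by rewrite ler_normr; apply/orP; right; clear -hx1; lra.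
have hx2' : rho <= `|x2 - p| by rewrite ler_normr; apply/orP; left; clear -hx2; lra.
have hy1' : rho <= `|y1 - q| by rewrite ler_normr; apply/orP; right; clear -hy1; lra.
have hy2' : rho <= `|y2 - q| by rewrite ler_normr; apply/orP; left; clear -hy2; lra.
have g1 : x1 <= x1 <= x2 by clear -hx1 hx2 rho0; lra.
have g2 : x1 <= x2 <= x2 by clear -hx1 hx2 rho0; lra.
have g3 : y1 <= y1 <= y2 by clear -hy1 hy2 rho0; lra.
have g4 : y1 <= y2 <= y2 by clear -hy1 hy2 rho0; lra.
(* The inner loop gives the lower bound [2 * G]; on the outer one [|w - z| >= rho], hence
   [|H| <= |g| / rho]. *)
rewrite -E in L; rewrite mulrAC mulrC -ler_pdivlMl//; apply: (le_trans L).
apply: bdry_le.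
- move=> x hx; split; [exact: dg|exact: dg|apply: dfar => //|apply: dfar => //];
  by right.
- by move=> x hx; split; apply: far; right.
- move=> x hx; split; [exact: dg|exact: dg|apply: dfar => //|apply: dfar => //];
  by left.
- by move=> x hx; split; apply: far; left.
Qed.

(** * The submean value property on squares *)

Definition square (R : realType) (p q r : R) : set (plane R) :=
  `[p - r, p + r]%classic `*` `[q - r, q + r]%classic.

Lemma measurable_square (R : realType) (p q r : R) : measurable (square p q r).
Proof. by apply: measurableX; exact: measurable_itv. Qed.

Lemma squareP (R : realType) (p q r : R) (w : plane R) :
  square p q r w <-> p - r <= w.1 <= p + r /\ q - r <= w.2 <= q + r.
Proof. by rewrite /square /= !in_itv. Qed.

Definition leb2 (R : realType) : {measure set (plane R) -> \bar R} :=
  (@lebesgue_measure R \x @lebesgue_measure R)%E.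

Lemma tonelli12 (R : realType) (f : plane R -> \bar R) :
  measurable_fun setT f -> (forall w, 0 <= f w)%E ->
  (\int[@leb2 R]_w f w =
   \int[@lebesgue_measure R]_x \int[@lebesgue_measure R]_y f (x, y))%E.
Proof. by move=> mf f0; rewrite /leb2 fubini_tonelli1. Qed.

Lemma tonelli21 (R : realType) (f : plane R -> \bar R) :
  measurable_fun setT f -> (forall w, 0 <= f w)%E ->
  (\int[@leb2 R]_w f w =
   \int[@lebesgue_measure R]_y \int[@lebesgue_measure R]_x f (x, y))%E.
Proof. by move=> mf f0; rewrite /leb2 fubini_tonelli2. Qed.

Lemma lebesgue_segE (R : realType) (a b : R) :
  a <= b -> (@lebesgue_measure R `[a, b]%classic = (b - a)%:E)%E.
Proof.
move=> ab; rewrite lebesgue_measure_itv /= lte_fin.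
by move: ab; rewrite le_eqVlt => /predU1P[->|->] //; rewrite ltxx subrr.
Qed.

(** Otherwise [F] exceeds [c] on all of [[a, b]] and its integral is too large. This selects lines
    on which the one-dimensional integral of [|g|] is controlled by the area integral. *)
Lemma slice_small (R : realType) (F : R -> \bar R) (a b c I : R) :
  measurable_fun setT F -> (forall x, 0 <= F x)%E -> a < b -> 0 <= c ->
  (\int[@lebesgue_measure R]_x F x <= I%:E)%E -> I < c * (b - a) ->
  exists2 x, a <= x <= b & (F x <= c%:E)%E.
Proof.
move=> mF F0 ab c0 HI Ic; apply: contrapT => nex.
have H x : a <= x <= b -> (c%:E <= F x)%E.
  move=> xab; rewrite leNgt; apply/negP => Fc; apply: nex; exists x => //.
  exact: ltW.
have : (\int[@lebesgue_measure R]_(x in `[a, b]) (c%:E) <= I%:E)%E.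
  apply: le_trans HI; apply: (@le_trans _ _ (\int[@lebesgue_measure R]_(x in `[a, b]) F x)%E).
    apply: ge0_le_integral => //.
    - exact: measurable_funTS.
  by apply: ge0_subset_integral => //.
rewrite integral_cst// => K.
have : (c%:E * (b - a)%:E <= I%:E)%E.
  by rewrite -(lebesgue_segE (ltW ab)); exact: K.
by rewrite -EFinM lee_fin leNgt Ic.
Qed.

Lemma sint_le_slice (R : realType) (f : R -> R) (a b c d k : R) :
  c <= a -> b <= d -> cont_seg c d f -> (forall x, 0 <= f x) ->
  (\int[@lebesgue_measure R]_(x in `[c, d]) (f x)%:E <= k%:E)%E ->
  sint a b f <= k.
Proof.
move=> ca bd cf f0 H.
have cab := cont_segS ca bd cf.
rewrite -lee_fin /sint /Rintegral fineK; last first.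
  apply: integrable_fin_num => //; exact: cont_seg_integrable.
apply: le_trans H; apply: ge0_subset_integral => //.
- by apply: measurable_int (cont_seg_integrable cf).
- by move=> x _; rewrite lee_fin.
- by apply: subset_itv; rewrite !bnd_simp.
Qed.

(** Sides at distance between [r / 2] and [r] from the centre are chosen so that each integral of
    [|g|] is at most [c], roughly [2 * I / r]. Then [cauchy_rect] with [rho = r / 2] gives
    [r * |g| <= 4 * c], whence the constant 8. *)
Lemma submean1 (R : realType) (g : R[i] -> R[i]) (p q r I : R) :
  0 < r ->
  (forall x y, p - r <= x <= p + r -> q - r <= y <= q + r -> dble g x y) ->
  measurable_fun (square p q r) (fun w : plane R => normc (g (toC w))) ->
  (\int[@leb2 R]_(w in square p q r) (normc (g (toC w)))%:E <= I%:E)%E ->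
  r ^+ 2 * normc (g (p +i* q)) <= 8 * I.
Proof.
move=> r0 dg mg HI.
pose f := (fun w : plane R => (normc (g (toC w)))%:E) \_ (square p q r).
have mf : measurable_fun setT f.
  apply/(measurable_restrictT _ (measurable_square p q r)).
  exact/measurable_EFinP.
have f0 w : (0 <= f w)%E by rewrite /f patchE; case: ifP => // _; rewrite lee_fin normc_ge0.
have If : (\int[@leb2 R]_w f w <= I%:E)%E by rewrite -integral_mkcond.
have I0 : 0 <= I.
  rewrite -lee_fin; apply: le_trans If; exact: integral_ge0.
have fE x y : p - r <= x <= p + r -> q - r <= y <= q + r ->
    f (x, y) = (normc (g (x +i* y)))%:E.
  by move=> hx hy; rewrite /f patchE mem_set//; apply/squareP.
pose F1 (x : R) : \bar R := (\int[@lebesgue_measure R]_y f (x, y))%E.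
pose F2 (y : R) : \bar R := (\int[@lebesgue_measure R]_x f (x, y))%E.
have mF1 : measurable_fun setT F1 by exact: measurable_fun_fubini_tonelli_F.
have mF2 : measurable_fun setT F2 by exact: measurable_fun_fubini_tonelli_G.
have F10 x : (0 <= F1 x)%E by exact: integral_ge0.
have F20 x : (0 <= F2 x)%E by exact: integral_ge0.
have IF1 : (\int[@lebesgue_measure R]_x F1 x <= I%:E)%E by rewrite -tonelli12.
have IF2 : (\int[@lebesgue_measure R]_x F2 x <= I%:E)%E by rewrite -tonelli21.
apply/ler_addgt0Pr => e e0.
(* [slice_small] wants a strict inequality on intervals of length [r / 2]; the excess [e / 8]
   becomes exactly [e] in the final bound. *)
pose c := 2 * (I + e / 8) / r.
have c0 : 0 <= c by rewrite /c divr_ge0 ?(ltW r0)// mulr_ge0// addr_ge0// divr_ge0// ltW.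
have Ic : I < c * (r / 2).
  rewrite /c (_ : _ * _ = I + e / 8); last by field; rewrite gt_eqF.
  by rewrite ltrDl divr_gt0.
have V x a b : p - r <= x <= p + r -> q - r <= a -> b <= q + r -> (F1 x <= c%:E)%E ->
    sint a b (fun y => normc (g (x +i* y))) <= c.
  move=> hx ha hb hF; apply: (sint_le_slice ha hb).
  - by apply: cont_segv; [exact: normc_lip|move=> y hy; exact: dg].
  - by move=> y; exact: normc_ge0.
  - apply: le_trans hF; rewrite /F1 integral_mkcond.
    apply: ge0_le_integral => //.
    + by move=> y _; rewrite patchE; case: ifP => // _; rewrite lee_fin normc_ge0.
    + apply/(measurable_restrictT _ (measurable_itv _)).
      by apply: measurable_int (cont_seg_integrable _); apply: cont_segv;
        [exact: normc_lip|move=> y hy; exact: dg].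
    + exact: measurableT_comp.
    + move=> y _; rewrite patchE; case: ifPn => // /set_mem /=.
      by rewrite in_itv /= => hy; rewrite fE.
have W y a b : q - r <= y <= q + r -> p - r <= a -> b <= p + r -> (F2 y <= c%:E)%E ->
    sint a b (fun x => normc (g (x +i* y))) <= c.
  move=> hx ha hb hF; apply: (sint_le_slice ha hb).
  - by apply: cont_segh; [exact: normc_lip|move=> x hy; exact: dg].
  - by move=> x; exact: normc_ge0.
  - apply: le_trans hF; rewrite /F2 integral_mkcond.
    apply: ge0_le_integral => //.
    + by move=> x _; rewrite patchE; case: ifP => // _; rewrite lee_fin normc_ge0.
    + apply/(measurable_restrictT _ (measurable_itv _)).
      by apply: measurable_int (cont_seg_integrable _); apply: cont_segh;
        [exact: normc_lip|move=> x hy; exact: dg].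
    + exact: measurableT_comp.
    + move=> x _; rewrite patchE; case: ifPn => // /set_mem /=.
      by rewrite in_itv /= => hy; rewrite fE.
have [||x1 hx1 Fx1] := slice_small mF1 F10 _ c0 IF1 (a := p - r) (b := p - r / 2).
- by clear -r0; lra.
- by rewrite (_ : p - r / 2 - (p - r) = r / 2)//; field.
have [||x2 hx2 Fx2] := slice_small mF1 F10 _ c0 IF1 (a := p + r / 2) (b := p + r).
- by clear -r0; lra.
- by rewrite (_ : p + r - (p + r / 2) = r / 2)//; field.
have [||y1 hy1 Fy1] := slice_small mF2 F20 _ c0 IF2 (a := q - r) (b := q - r / 2).
- by clear -r0; lra.
- by rewrite (_ : q - r / 2 - (q - r) = r / 2)//; field.
have [||y2 hy2 Fy2] := slice_small mF2 F20 _ c0 IF2 (a := q + r / 2) (b := q + r).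
- by clear -r0; lra.
- by rewrite (_ : q + r - (q + r / 2) = r / 2)//; field.
have dg' x y : x1 <= x <= x2 -> y1 <= y <= y2 -> dble g x y.
  move=> hx hy; apply: dg; [by clear -hx hx1 hx2; lra|by clear -hy hy1 hy2; lra].
have := @cauchy_rect _ g p q x1 x2 y1 y2 (r / 2) _ _ _ _ _ dg'.
have [q1 q2 q3 q4] : [/\ p - r <= x1 <= p + r, p - r <= x2 <= p + r,
  q - r <= y1 <= q + r & q - r <= y2 <= q + r].
  by split; [clear -hx1 r0|clear -hx2 r0|clear -hy1 r0|clear -hy2 r0]; lra.
have [q5 q6 q7 q8] : [/\ p - r <= x1, x2 <= p + r, q - r <= y1 & y2 <= q + r].
  by split; [clear -hx1|clear -hx2|clear -hy1|clear -hy2]; lra.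
have r1 : x1 <= x2 by clear -hx1 hx2 r0; lra.
have r2 : y1 <= y2 by clear -hy1 hy2 r0; lra.
rewrite !sintD; first last.
- by apply: cont_segh; [exact: normc_lip|move=> x hx; apply: dg' => //; clear -r2; lra].
- by apply: cont_segh; [exact: normc_lip|move=> x hx; apply: dg' => //; clear -r2; lra].
- by apply: cont_segv; [exact: normc_lip|move=> x hx; apply: dg' => //; clear -r1; lra].
- by apply: cont_segv; [exact: normc_lip|move=> x hx; apply: dg' => //; clear -r1; lra].
have s1 := W y1 _ _ q3 q5 q6 Fy1; have s2 := W y2 _ _ q4 q5 q6 Fy2.
have s3 := V x1 _ _ q1 q7 q8 Fx1; have s4 := V x2 _ _ q2 q7 q8 Fx2.
move=> H; have {H} : 2 * (r / 2) * normc (g (p +i* q)) <= 4 * c.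
  apply: le_trans (H _ _ _ _ _) _.
  - by rewrite divr_gt0.
  - by clear -hx1; lra.
  - by clear -hx2; lra.
  - by clear -hy1; lra.
  - by clear -hy2; lra.
  - by clear -s1 s2 s3 s4; lra.
have -> : 2 * (r / 2) = r by field.
move=> H; have := ler_wpM2l (ltW r0) H.
rewrite mulrA -expr2 /c (_ : r * _ = 8 * I + e)//.
by field; rewrite gt_eqF.
Qed.

(** * The submean value property for powers of the modulus *)

Lemma powR_homo (R : realType) (r x y : R) :
  0 <= r -> 0 <= x -> x <= y -> x `^ r <= y `^ r.
Proof.
by move=> r0 x0 xy; apply: ge0_ler_powR; rewrite ?nnegrE// (le_trans x0 xy).
Qed.

Lemma powR_nhomo (R : realType) (r x y : R) :
  r <= 0 -> 0 < x -> x <= y -> y `^ r <= x `^ r.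
Proof.
move=> r0 x0 xy; have y0 := lt_le_trans x0 xy.
have e z : z `^ r = (z `^ (- r))^-1 by rewrite -powRN opprK.
rewrite !e lef_pV2 ?posrE ?powR_gt0//.
by apply: powR_homo => //; [rewrite oppr_ge0|exact: ltW].
Qed.

Lemma gt0_powRD (R : realType) (x r s : R) :
  0 < x -> x `^ (r + s) = x `^ r * x `^ s.
Proof. by move=> x0; rewrite powRD// (gt_eqF x0) implybT. Qed.

Lemma leb2_square (R : realType) (p q r : R) :
  0 <= r -> (@leb2 R (square p q r) = (4 * r ^+ 2)%:E)%E.
Proof.
move=> r0.
have e (t : R) : @lebesgue_measure R `[t - r, t + r]%classic = (2 * r)%:E.
  by rewrite lebesgue_segE; [congr EFin; ring|clear -r0; lra].
transitivity (@lebesgue_measure R `[(p - r)%R, (p + r)%R]%classic *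
    @lebesgue_measure R `[(q - r)%R, (q + r)%R]%classic)%E.
  by apply: product_measure1E; exact: measurable_itv.
by rewrite !e -EFinM; congr EFin; ring.
Qed.

(** A pointwise bound of [|g|] by a constant plus a multiple of [|g| ^ pp] reduces the exponent [pp]
    to the exponent 1; [4 * r ^+ 2] is the area of the square. The cases [pp >= 1] and [pp < 1]
    differ only in how such a bound is found. *)
Lemma submean_dom (R : realType) (g : R[i] -> R[i]) (pp p q r I l k : R) :
  0 < r -> 0 <= l -> 0 <= k ->
  (forall x y, p - r <= x <= p + r -> q - r <= y <= q + r ->
     dble g x y /\ normc (g (x +i* y)) <= l + k * normc (g (x +i* y)) `^ pp) ->
  measurable_fun (square p q r) (fun w : plane R => normc (g (toC w))) ->
  (\int[@leb2 R]_(w in square p q r) (normc (g (toC w)) `^ pp)%:E <= I%:E)%E ->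
  r ^+ 2 * normc (g (p +i* q)) <= 8 * (l * (4 * r ^+ 2) + k * I).
Proof.
move=> r0 l0 k0 H mg HI; apply: submean1 => // [x y hx hy|].
  by have [] := H x y hx hy.
have ms := measurable_square p q r.
have mp : measurable_fun (square p q r)
    (fun w : plane R => normc (g (toC w)) `^ pp).
  exact: (measurableT_comp (measurable_powR pp) mg).
apply: (@le_trans _ _ (\int[@leb2 R]_(w in square p q r)
    (l%:E + k%:E * (normc (g (toC w)) `^ pp)%:E))%E).
  apply: ge0_le_integral => //.
  - by move=> w _; rewrite lee_fin normc_ge0.
  - exact/measurable_EFinP.
  - apply: emeasurable_funD; first exact: measurable_cst.
    by apply: measurable_funeM; exact/measurable_EFinP.
  - by move=> [x y] /squareP[hx hy]; rewrite -EFinM -EFinD lee_fin; have [] := H x y hx hy.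
rewrite ge0_integralD//; last 2 first.
- by move=> w _; rewrite -EFinM lee_fin mulr_ge0// powR_ge0.
- by apply: measurable_funeM; exact/measurable_EFinP.
rewrite ge0_integralZl//; last 2 first.
- exact/measurable_EFinP.
- by move=> w _; rewrite lee_fin powR_ge0.
rewrite integral_cst// EFinD; apply: leeD; last first.
  by rewrite EFinM; apply: lee_wpmul2l.
rewrite EFinM; apply: lee_wpmul2l; first by rewrite lee_fin.
by rewrite leb2_square// ltW.
Qed.

(** Bisection again: boundedness passes from quarters to the whole and holds near each point by
    continuity. *)
Lemma dble_bounded (R : realType) (g : R[i] -> R[i]) (a b c d : R) :
  a <= b -> c <= d ->
  (forall x y, a <= x <= b -> c <= y <= d -> dble g x y) ->
  exists B, forall x y, a <= x <= b -> c <= y <= d -> normc (g (x +i* y)) <= B.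
Proof.
move=> ab cd dg.
pose P (a b c d : R) := exists B, forall x y, a <= x <= b -> c <= y <= d ->
  normc (g (x +i* y)) <= B.
apply: (@rect_bisect R P) => //.
  move=> a1 b1 c1 d1 _ _ _ _ _ _ m n [B1 H1] [B2 H2] [B3 H3] [B4 H4].
  exists (Num.max (Num.max B1 B2) (Num.max B3 B4)) => x y hx hy.
  rewrite !le_max -!orbA.
  have [xm|xm] := leP x m; have [yn|yn] := leP y n.
  - by rewrite H1//; lra.
  - by rewrite H3 ?orbT//; lra.
  - by rewrite H2 ?orbT//; lra.
  - by rewrite H4 ?orbT//; lra.
move=> x y hx hy; have [e e0 He] := derivable_cvg_normc (dg x y hx hy) ltr01.
exists e => // a1 b1 c1 d1 _ hx1 _ _ hy1 _ sz.
exists (1 + normc (g (x +i* y))) => x' y' hx' hy'.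
have : normc (g (x' +i* y') - g (x +i* y)) <= 1.
  apply: He; apply: le_lt_trans (normc_le1 _) _ => /=.
  apply: le_lt_trans sz; apply: lerD.
    by rewrite ler_norml; apply/andP; split; lra.
  by rewrite ler_norml; apply/andP; split; lra.
by move=> h; have := normcD (g (x' +i* y') - g (x +i* y)) (g (x +i* y)); rewrite subrK; lra.
Qed.

(** Where [|g| > l], the exponent [1 - pp <= 0] gives [|g| <= l ^ (1 - pp) * |g| ^ pp]. With
    [l = G / 64] the constant term of [submean_dom] is [8 * l * 4 * r ^ 2 = r ^ 2 * G / 2], half of
    the left-hand side, and is absorbed. *)
Lemma submeanp_ge1 (R : realType) (g : R[i] -> R[i]) (pp p q r I : R) :
  1 <= pp -> 0 < r ->
  (forall x y, p - r <= x <= p + r -> q - r <= y <= q + r -> dble g x y) ->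
  measurable_fun (square p q r) (fun w : plane R => normc (g (toC w))) ->
  (\int[@leb2 R]_(w in square p q r) (normc (g (toC w)) `^ pp)%:E <= I%:E)%E ->
  r ^+ 2 * normc (g (p +i* q)) `^ pp <= 16 * 64 `^ (pp - 1) * I.
Proof.
move=> pp1 r0 dg mg HI; set G := normc (g _).
have I0 : 0 <= I.
  by rewrite -lee_fin; apply: le_trans HI; apply: integral_ge0 => w _; rewrite lee_fin powR_ge0.
have [G0|G0] := eqVneq G 0.
  by rewrite G0 powR0 ?gt_eqF ?(lt_le_trans ltr01)// mulr0 mulr_ge0// mulr_ge0 ?powR_ge0.
have Gp : 0 < G by rewrite lt_def G0 normc_ge0.
pose l := G / 64; have l0 : 0 < l by rewrite divr_gt0.
have dom x y : p - r <= x <= p + r -> q - r <= y <= q + r -> dble g x y /\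
    normc (g (x +i* y)) <= l + l `^ (1 - pp) * normc (g (x +i* y)) `^ pp.
  move=> hx hy; split; first exact: dg.
  set t := normc _; have [tl|tl] := leP t l.
    by rewrite (le_trans tl)// lerDl mulr_ge0// powR_ge0.
  have t0 : 0 < t by exact: lt_trans tl.
  apply: (@le_trans _ _ (l `^ (1 - pp) * t `^ pp)); last by rewrite lerDr ltW.
  rewrite [leLHS](_ : _ = t `^ (1 - pp) * t `^ pp).
    apply: ler_wpM2r; first exact: powR_ge0.
    by apply: powR_nhomo => //; [lra|exact: ltW].
  by rewrite -gt0_powRD// subrK powRr1// ltW.
have H := submean_dom r0 (ltW l0) (powR_ge0 _ _) dom mg HI.
have {}H : r ^+ 2 * G <= 16 * (l `^ (1 - pp) * I).
  move: H; rewrite -/G; set K := _ `^ _ * I.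
  rewrite (_ : l * (4 * r ^+ 2) = r ^+ 2 * G / 16); last by rewrite /l; field.
  by clear; lra.
have -> : r ^+ 2 * G `^ pp = (r ^+ 2 * G) * G `^ (pp - 1).
  rewrite -mulrA -{2}(powRr1 (ltW Gp)) -gt0_powRD//; congr (_ * _ `^ _); ring.
apply: le_trans (ler_wpM2r (powR_ge0 _ _) H) _.
rewrite [leLHS](_ : _ = 16 * (l `^ (1 - pp) * G `^ (pp - 1)) * I); last by ring.
suff -> : l `^ (1 - pp) * G `^ (pp - 1) = 64 `^ (pp - 1) by [].
have -> : G `^ (pp - 1) = l `^ (pp - 1) * 64 `^ (pp - 1).
  by rewrite -powRM ?(ltW l0)// /l divfK.
rewrite mulrA -gt0_powRD// (_ : 1 - pp + (pp - 1) = 0) ?powRr0 ?mul1r//.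
by ring.
Qed.

(** The exponent [2 / pp] is the one for which the powers of [s] combine to [s ^+ 2], the order of
    the area of the small square. *)
Lemma powR_balance (R : realType) (pp M s : R) :
  0 < pp -> 0 < M -> 0 < s ->
  (2 * s) `^ (2 / pp) * (M * s `^ (- (2 / pp))) `^ (1 - pp) =
  2 `^ (2 / pp) * M `^ (1 - pp) * s ^+ 2.
Proof.
move=> pp0 M0 s0; rewrite (powRM _ (ler0n _ 2) (ltW s0)).
rewrite (powRM _ (ltW M0) (powR_ge0 _ _)) -powRrM.
rewrite (_ : - (2 / pp) * (1 - pp) = - (2 / pp) + 2); last first.
  by field; rewrite gt_eqF.
rewrite [s `^ (- _ + 2)]gt0_powRD// powRN (powR_mulrn _ (ltW s0)).
by field; rewrite gt_eqF// powR_gt0.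
Qed.

(* For [pp < 1] one replaces [g] near the centre by its values near a point that
   almost maximizes [dist(w, boundary) `^ (2 / pp) * |g w|]; there [|g|] is
   comparable to its maximum, so [|g| <= K `^ (1 - pp) * |g| `^ pp]. *)
Lemma submeanp_lt1 (R : realType) (g : R[i] -> R[i]) (pp p q r I : R) :
  0 < pp -> pp < 1 -> 0 < r ->
  (forall x y, p - r <= x <= p + r -> q - r <= y <= q + r -> dble g x y) ->
  measurable_fun (square p q r) (fun w : plane R => normc (g (toC w))) ->
  (\int[@leb2 R]_(w in square p q r) (normc (g (toC w)) `^ pp)%:E <= I%:E)%E ->
  r ^+ 2 * normc (g (p +i* q)) `^ pp <= 2 `^ (2 / pp) * 16 * I.
Proof.
move=> pp0 pp1 r0 dg mg HI; set G := normc (g _).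
have I0 : 0 <= I.
  by rewrite -lee_fin; apply: le_trans HI; apply: integral_ge0 => w _; rewrite lee_fin powR_ge0.
have [G0|G0] := eqVneq G 0.
  by rewrite G0 powR0 ?gt_eqF// mulr0 !mulr_ge0 ?powR_ge0.
have Gp : 0 < G by rewrite lt_def G0 normc_ge0.
pose al := 2 / pp.
have al0 : 0 < al by rewrite divr_gt0.
have [B HB] := @dble_bounded R g (p - r) (p + r) (q - r) (q + r) ltac:(lra) ltac:(lra) dg.
pose dd x y := Num.max `|x - p| `|y - q|.
pose Phi x y := (r - dd x y) `^ al * normc (g (x +i* y)).
pose S := [set t | exists x y, [/\ p - r <= x <= p + r, q - r <= y <= q + r & t = Phi x y]].
have ddr x y : p - r <= x <= p + r -> q - r <= y <= q + r -> 0 <= dd x y <= r.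
  move=> hx hy; rewrite /dd ge_max le_max normr_ge0 /= !ler_norml.
  by apply/andP; split; apply/andP; split; lra.
have Sub : has_ubound S.
  exists (r `^ al * B) => _ [x [y [hx hy ->]]].
  have /andP[d1 d2] := ddr x y hx hy.
  apply: ler_pM; rewrite ?powR_ge0 ?normc_ge0//; last exact: HB.
  by apply: powR_homo; [exact: ltW|lra|lra].
have ddp : dd p q = 0 by rewrite /dd !subrr normr0 maxxx.
have Sp : S (r `^ al * G).
  exists p, q; split; [lra|lra|].
  by rewrite /Phi ddp subr0.
pose M := sup S.
have MG : r `^ al * G <= M by exact: ub_le_sup.
have M0 : 0 < M by apply: lt_le_trans MG; rewrite mulr_gt0// powR_gt0.
have [t St tM] : exists2 t, S t & M / 2 < t.
  apply: contrapT => H.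
  have : M <= M / 2.
    apply: ge_sup; first by exists (r `^ al * G).
    move=> t St; rewrite leNgt; apply/negP => Mt; apply: H; by exists t.
  by lra.
case: St => x [y [hx hy tE]].
have /andP[d1 d2] := ddr x y hx hy.
have dlt : dd x y < r.
  rewrite lt_neqAle d2 andbT; apply/eqP => dr.
  by move: tM; rewrite tE /Phi dr subrr powR0 ?gt_eqF// mul0r; lra.
(* The near-maximizer is at distance [2 * s] from the boundary, so every point of the square of half
   side [s] around it keeps distance at least [s]. Hence [|g|] is at most [K = M * s ^ (- al)]
   there. *)
pose s := (r - dd x y) / 2.
have s0 : 0 < s by rewrite divr_gt0// subr_gt0.
have [xd yd] : `|x - p| <= dd x y /\ `|y - q| <= dd x y.
  by rewrite /dd !le_max !lexx orbT.
have sE : dd x y = r - 2 * s by rewrite /s; field.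
have sub x' y' : x - s <= x' <= x + s -> y - s <= y' <= y + s ->
    [/\ p - r <= x' <= p + r, q - r <= y' <= q + r & s <= r - dd x' y'].
  move=> hx' hy'; move: xd yd; rewrite sE !ler_norml => /andP[x1 x2] /andP[y1 y2].
  have h1 : p - r <= x' <= p + r by clear -x1 x2 hx' s0; lra.
  have h2 : q - r <= y' <= q + r by clear -y1 y2 hy' s0; lra.
  split => //.
  suff : dd x' y' <= r - s by clear; lra.
  rewrite /dd ge_max !ler_norml; clear -x1 x2 y1 y2 hx' hy' s0.
  by apply/andP; split; apply/andP; split; lra.
pose K := M * s `^ (- al).
have K0 : 0 < K by rewrite mulr_gt0// powR_gt0.
have gK x' y' : x - s <= x' <= x + s -> y - s <= y' <= y + s -> normc (g (x' +i* y')) <= K.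
  move=> hx' hy'; have [h1 h2 h3] := sub x' y' hx' hy'.
  rewrite /K powRN ler_pdivlMr ?powR_gt0// mulrC.
  apply: (@le_trans _ _ (Phi x' y')).
    apply: ler_wpM2r; first exact: normc_ge0.
    by apply: powR_homo; [exact: ltW|exact: ltW|exact: h3].
  by apply: ub_le_sup => //; exists x', y'.
have sq : square x y s `<=` square p q r.
  by move=> [x' y'] /squareP[hx' hy']; have [? ? _] := sub x' y' hx' hy'; apply/squareP.
have dom x' y' : x - s <= x' <= x + s -> y - s <= y' <= y + s -> dble g x' y' /\
    normc (g (x' +i* y')) <= 0 + K `^ (1 - pp) * normc (g (x' +i* y')) `^ pp.
  move=> hx' hy'; have [h1 h2 h3] := sub x' y' hx' hy'.
  split; first exact: dg.
  rewrite add0r; have := gK x' y' hx' hy'; set u := normc _ => uK.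
  have [u0|u0] := eqVneq u 0; first by rewrite u0 mulr_ge0// powR_ge0.
  have up : 0 < u by rewrite lt_def u0 normc_ge0.
  rewrite [leLHS](_ : _ = u `^ (1 - pp) * u `^ pp); last first.
    by rewrite -gt0_powRD// subrK powRr1// ltW.
  apply: ler_wpM2r; first exact: powR_ge0.
  by apply: powR_homo; [rewrite subr_ge0 ltW|exact: ltW|exact: uK].
have mg' : measurable_fun (square x y s) (fun w : plane R => normc (g (toC w))).
  exact: measurable_funS (measurable_square p q r) sq mg.
have HI' : (\int[@leb2 R]_(w in square x y s) (normc (g (toC w)) `^ pp)%:E <= I%:E)%E.
  apply: le_trans HI; apply: ge0_subset_integral => //.
  - exact: measurable_square.
  - exact: measurable_square.
  - by apply/measurable_EFinP; exact: (measurableT_comp (measurable_powR pp) mg).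
  - by move=> w _; rewrite lee_fin powR_ge0.
have H := submean_dom s0 (lexx 0) (powR_ge0 _ _) dom mg' HI'.
move: H; rewrite mul0r add0r => H.
have e1 : M / 2 * s ^+ 2 <= (2 * s) `^ al * (8 * (K `^ (1 - pp) * I)).
  apply: (@le_trans _ _ ((2 * s) `^ al * (s ^+ 2 * normc (g (x +i* y))))); last first.
    by apply: ler_wpM2l; rewrite ?powR_ge0.
  rewrite [leRHS]mulrCA [leLHS]mulrC; apply: ler_wpM2l; first exact: sqr_ge0.
  apply: ltW; apply: (lt_le_trans tM); rewrite tE /Phi.
  by rewrite (_ : r - dd x y = 2 * s) // sE; ring.
have e2 : (2 * s) `^ al * K `^ (1 - pp) = 2 `^ al * M `^ (1 - pp) * s ^+ 2.
  exact: powR_balance.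
(* The factor [s ^+ 2] cancels, so the bound no longer depends on the near-maximizer. *)
have e3 : M <= 2 `^ al * 16 * I * M `^ (1 - pp).
  have s2 : 0 < s ^+ 2 by rewrite exprn_gt0.
  rewrite -(ler_pM2r s2).
  rewrite [leRHS](_ : _ = 2 * ((2 * s) `^ al * (8 * (K `^ (1 - pp) * I)))).
    by move: e1; set W := (_ `^ al * _); lra.
  rewrite [RHS](_ : _ = 16 * ((2 * s) `^ al * K `^ (1 - pp)) * I); last by ring.
  by rewrite e2; ring.
have e4 : M `^ pp <= 2 `^ al * 16 * I.
  have Mp : 0 < M `^ (1 - pp) by rewrite powR_gt0.
  rewrite -(ler_pM2r Mp) -gt0_powRD// (_ : pp + (1 - pp) = 1); last by ring.
  by rewrite powRr1// ltW.
apply: le_trans e4.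
rewrite [leLHS](_ : _ = (r `^ al * G) `^ pp).
  by apply: powR_homo => //; [exact: ltW|rewrite mulr_ge0 ?powR_ge0// ltW].
rewrite powRM ?powR_ge0 ?(ltW Gp)// -powRrM (_ : al * pp = 2).
  by rewrite powR_mulrn// ltW.
by rewrite /al divfK// gt_eqF.
Qed.

Lemma submeanp (R : realType) (pp : R) : 0 < pp -> exists2 C, 0 < C &
  forall (g : R[i] -> R[i]) (p q r I : R), 0 < r ->
  (forall x y, p - r <= x <= p + r -> q - r <= y <= q + r -> dble g x y) ->
  measurable_fun (square p q r) (fun w : plane R => normc (g (toC w))) ->
  (\int[@leb2 R]_(w in square p q r) (normc (g (toC w)) `^ pp)%:E <= I%:E)%E ->
  r ^+ 2 * normc (g (p +i* q)) `^ pp <= C * I.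
Proof.
move=> pp0; have [pp1|pp1] := leP 1 pp.
  exists (16 * 64 `^ (pp - 1)); first by rewrite mulr_gt0// powR_gt0.
  by move=> g p q r I *; exact: submeanp_ge1.
exists (2 `^ (2 / pp) * 16); first by rewrite mulr_gt0// powR_gt0.
by move=> g p q r I *; exact: submeanp_lt1.
Qed.

(** * The weight as a function of the modulus *)

Lemma mvt (R : realType) (f df : R -> R) (a b : R) :
  a <= b -> (forall x, a <= x <= b -> is_derive x (1 : R) f (df x)) ->
  exists2 c, a <= c <= b & f b - f a = df c * (b - a).
Proof.
move=> ab H; have [||c] := @MVT_segment R f df a b ab.
- by move=> x; rewrite in_itv /= => /andP[/ltW ax /ltW xb]; apply: H; rewrite ax.
- apply: derivable_within_continuous => x; rewrite in_itv /= => /H h.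
  exact: ex_derive.
- by rewrite in_itv /=; exists c.
Qed.

Lemma normc_real (R : realType) (r : R) : normc r%:C = `|r|.
Proof. by rewrite /normc /= expr0n addr0 sqrtr_sqr. Qed.

Lemma disk_real (R : realType) (t : R) : 0 <= t < 1 -> disk t%:C.
Proof.
move=> /andP[t0 t1]; rewrite (_ : disk _ = (normc t%:C < 1)) //.
by rewrite normc_real ger0_norm.
Qed.

Definition hyp (R : realType) (r t : R) : R := Num.sqrt (r ^+ 2 + t ^+ 2).

Lemma hyp_gt0 (R : realType) (r t : R) : 0 < r -> 0 < hyp r t.
Proof. by move=> r0; rewrite sqrtr_gt0 ltr_wpDr ?sqr_ge0 ?exprn_gt0. Qed.

Lemma is_derive_hyp (R : realType) (r t : R) : 0 < r ->
  is_derive t (1 : R) (hyp r) (t / hyp r t).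
Proof.
move=> r0; have h0 := hyp_gt0 t r0.
have s0 : 0 < r ^+ 2 + t ^+ 2 by rewrite -sqrtr_gt0.
have d1 : is_derive t (1 : R) (fun t => r ^+ 2 + t ^+ 2) (2 * t).
  rewrite (_ : (fun t => _) = cst (r ^+ 2) + (id : R -> R) ^+ 2).
    have H := is_deriveD (is_derive_cst (r ^+ 2) t (1 : R))
      (is_deriveX 2 (is_derive_id t (1 : R))).
    by move: H; rewrite add0r /GRing.scale /= mulr1 expr1.
  by apply/funext => x; rewrite exprfctE.
have := @is_derive1_comp R Num.sqrt (fun t => r ^+ 2 + t ^+ 2) t _ _ (is_derive1_sqrt s0) d1.
move=> h; apply: is_derive_eq; rewrite -/(hyp r t).
by field; rewrite gt_eqF.
Qed.

Lemma derive1_cvg (R : realType) (f : R -> R) (a : R) : derivable f a 1 ->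
  t^-1 *: (f (t + a) - f a) @[t --> 0^'] --> derive1 f a.
Proof.
move=> df; rewrite derive1E.
rewrite (_ : (fun t => _) = (fun t => t^-1 *: ((f \o shift a) (t *: 1) - f a))).
  exact: df.
by apply/funext => t /=; rewrite [t *: 1]mulr1.
Qed.

(** On the vertical line through [r] the function is [h (hyp r t)], with derivative
    [h' (hyp r t) * t / hyp r t]. This vanishes at [t = 0], and its quotient by [t] tends to
    [h' r / r] by continuity of [h']: this is the second vertical derivative. *)
Lemma radial_laplacian (R : realType) (u : R[i] -> R) (r : R) :
  radial u -> (forall z, disk z -> has_laplacian u z) -> 0 < r < 1 ->
  let h := fun t : R => u t%:C in
  [/\ derivable h r 1, derivable (derive1 h) r 1 &
      laplacian u r%:C = derive1 (derive1 h) r + derive1 h r / r].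
Proof.
move=> ru lu /andP[r0 r1] h.
have dr t : 0 < t < 1 -> derivable h t 1 /\ derivable (derive1 h) t 1.
  move=> /andP[t0 t1].
  have [a b _ _] : has_laplacian u t%:C by apply: lu; apply: disk_real; rewrite ltW.
  by split; [exact: a|exact: b].
have [h1 h2] : derivable h r 1 /\ derivable (derive1 h) r 1 by apply: dr; rewrite r0.
split => //; rewrite /laplacian; congr (_ + _).
have [_ _ _] : has_laplacian u r%:C by apply: lu; apply: disk_real; rewrite ltW.
set v := vline u r%:C => dv; rewrite /derive1n /=.
have hb t : `|t| < 1 - r -> 0 < hyp r t < 1.
  move=> tr; rewrite hyp_gt0//=.
  have := normc_le1 (r +i* t); rewrite /= -/(hyp r t).
  by rewrite (gtr0_norm r0); move=> h3; apply: le_lt_trans h3 _; lra.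
have vE t : `|t| < 1 - r -> v t = h (hyp r t).
  move=> tr; have /andP[g0 g1] := hb t tr.
  rewrite /v /vline /h; apply: ru; last by rewrite normc_real gtr0_norm.
    exact: g1.
  by apply: disk_real; rewrite ltW.
have v1 t : `|t| < 1 - r -> derive1 v t = derive1 h (hyp r t) * (t / hyp r t).
  move=> tr; have [d1 _] := dr _ (hb t tr).
  have E : \forall s \near t, v s = (h \o hyp r) s.
    have : \forall s \near t, `|s| < 1 - r.
      have := @norm_continuous _ R t; move/cvgr_lt; apply; exact: tr.
    by apply: filterS => s; exact: vE.
  rewrite derive1E (near_eq_derive _ E).
  have := @is_derive1_comp R h (hyp r) t _ _ (derivableP d1) (is_derive_hyp t r0).
  by move=> H; rewrite derive_val derive1E.
have hr0 : hyp r 0 = r by rewrite /hyp expr0n addr0 sqrtr_sqr gtr0_norm.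
have L1 : t^-1 *: (derive1 v (t + 0) - derive1 v 0) @[t --> 0^'] --> derive1 (derive1 v) 0.
  exact: derive1_cvg.
have L2 : t^-1 *: (derive1 v (t + 0) - derive1 v 0) @[t --> 0^'] --> derive1 h r / r.
  have C : (fun t => derive1 h (hyp r t) / hyp r t) t @[t --> 0^'] --> derive1 h r / r.
    apply: cvg_within_filter.
    have ch : hyp r t @[t --> 0] --> r.
      rewrite -{2}hr0; apply: differentiable_continuous; apply/derivable1_diffP.
      by have h3 := is_derive_hyp 0 r0; exact: ex_derive.
    apply: cvgM; last by apply: cvgV; [rewrite gt_eqF|exact: ch].
    have c2 : {for r, continuous (derive1 h)}.
      by apply: differentiable_continuous; apply/derivable1_diffP.
    exact: (cvg_comp (hyp r) (derive1 h) ch c2).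
  apply: cvg_trans C; apply: near_eq_cvg.
  have : \forall t \near (0 : R)^', `|t| < 1 - r /\ t != 0.
    near=> t; split; last by near: t; exact: nbhs_dnbhs_neq.
    near: t; apply: dnbhs0_lt; lra.
  apply: filterS => t [tr t0].
  rewrite addr0 !v1// ?normr0 ?mul0r ?mulr0 ?subr0; last lra.
  have hn : hyp r t != 0 by rewrite gt_eqF ?hyp_gt0.
  by rewrite /GRing.scale /=; field; rewrite hn t0.
exact: cvg_unique L1 L2.
Unshelve. all: by end_near.
Qed.

Lemma near_left1 (R : realType) (P : R -> Prop) :
  (\forall r \near 1^'-, P r) -> exists2 r0, 0 < r0 < 1 & forall r, r0 < r < 1 -> P r.
Proof.
move=> [d /= d0 H]; exists (Num.max (1 / 2) (1 - d)).
  by rewrite lt_max gt_max; apply/andP; split; [apply/orP; left|apply/andP; split]; lra.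
move=> r; rewrite gt_max => /andP[/andP[h1 h2] h3]; apply: H => //=.
by rewrite gtr0_norm; lra.
Qed.

Lemma left1_near (R : realType) (P : R -> Prop) (r0 : R) :
  r0 < 1 -> (forall r, r0 < r < 1 -> P r) -> \forall r \near 1^'-, P r.
Proof.
move=> h H; exists (1 - r0) => /=; first by rewrite subr_gt0.
move=> r /= hr r1; apply: H; move: hr; rewrite gtr0_norm ?subr_gt0//.
by move=> ?; apply/andP; split; lra.
Qed.

(* [h] is the exponent of the weight as a function of the modulus,
   [N r = r * h' r], [N' r = r * L r] with [L] the Laplacian, and [T] is tau. *)
Definition profile (R : realType) (h N L T : R -> R) (c : R) : Prop :=
  [/\ 0 < c,
      forall r : R, 0 < r < 1 -> is_derive r (1 : R) h (N r / r) /\ 0 < N r,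
      forall r : R, 0 < r < 1 -> is_derive r (1 : R) N (r * L r) /\
        (c * T r ^+ 2)^-1 <= L r <= c / T r ^+ 2,
      forall r : R, 0 <= r < 1 -> 0 < T r
    & forall e : R, 0 < e -> exists2 r0 : R, 0 < r0 < 1 &
        forall r : R, r0 < r < 1 ->
        T r < e /\ exists2 dT, is_derive r (1 : R) T dT & `|dT| < e].

Lemma sqrtV_bounds (R : realType) (l c t : R) : 0 < l -> 0 < t -> 0 < c ->
  l `^ (- 2^-1) <= c * t -> t <= c * l `^ (- 2^-1) ->
  (c ^+ 2 * t ^+ 2)^-1 <= l <= c ^+ 2 / t ^+ 2.
Proof.
move=> l0 t0 c0; rewrite powRN (powR12_sqrt (ltW l0)).
have s0 : 0 < Num.sqrt l by rewrite sqrtr_gt0.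
rewrite -{3 4}(sqr_sqrtr (ltW l0)); set s := Num.sqrt l in s0 *.
move=> h1 h2; rewrite -exprMn -exprVn -expr_div_n; apply/andP; split.
  apply: lerXn2r; rewrite ?nnegrE; [|exact: ltW|].
    by rewrite invr_ge0; apply: ltW; rewrite mulr_gt0.
  by rewrite -[s]invrK lef_pV2 ?posrE ?invr_gt0 ?mulr_gt0.
apply: lerXn2r; rewrite ?nnegrE; [exact: ltW| |].
  by apply: ltW; rewrite divr_gt0.
by rewrite ler_pdivlMr// mulrC -ler_pdivlMr.
Qed.

Lemma tau_derivable (R : realType) (tau : R[i] -> R) (r : R) :
  differentiable (tau \o @toC R) ((r, 0) : R * R) ->
  derivable (fun t : R => tau t%:C) r 1.
Proof.
move=> dt; apply/derivable1_diffP.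
rewrite (_ : (fun t => _) = (tau \o @toC R) \o (fun t : R => (t, 0) : R * R))//.
by apply: differentiable_comp => //; exact: differentiable_pair.
Qed.

Lemma class_W_profile (R : realType) (omega tau : R[i] -> R) :
  class_W omega tau -> exists h N L c,
  [/\ profile h N L (fun t => tau t%:C) c,
      (forall r s : R, 0 <= r -> r < s -> s < 1 -> h r < h s),
      (forall z, disk z -> omega z = expR (- h (normc z))),
      (forall z, disk z -> tau z = tau (normc z)%:C) &
      measurable_fun (@plane_disk R) (fun q : plane R => omega (toC q))].
Proof.
move=> [eta [omE om_int eta_rad eta_inc eta_lap]].
move=> [tau_pos [tau_rad [tau_diff [[c c0 tau_comp] [tau0 dtau0]]]]].
pose h := fun t : R => eta t%:C.
pose N := fun r => r * derive1 h r.
pose L := fun r : R => laplacian eta r%:C.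
have hinc (r s : R) : 0 <= r -> r < s -> s < 1 -> h r < h s.
  move=> r0 rs s1; have s0 : 0 <= s by exact: ltW (le_lt_trans r0 rs).
  apply: eta_inc; [apply: disk_real|apply: disk_real|].
  - by rewrite r0 (lt_trans rs).
  - by rewrite s0.
  - by rewrite !normc_real !ger0_norm.
have lapl z : disk z -> has_laplacian eta z by move=> /eta_lap[].
have D (r : R) : 0 < r < 1 -> is_derive r (1 : R) h (N r / r) /\
    is_derive r (1 : R) N (r * L r).
  move=> hr; have [d1 d2 E] := radial_laplacian eta_rad lapl hr.
  have r0 : r != 0 by case/andP: hr => r0 _; rewrite gt_eqF.
  split.
    have := derivableP d1; rewrite -derive1E.
    by rewrite (_ : N r / r = derive1 h r)// /N mulrAC divff// mul1r.
  have := is_deriveM (is_derive_id r (1 : R)) (derivableP d2).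
  rewrite -derive1E (_ : r * L r = r *: derive1 (derive1 h) r + derive1 h r *: 1)//.
  by rewrite /L E /GRing.scale /= mulr1 mulrDr mulrCA divff// mulr1.
have Lpos (r : R) : 0 < r < 1 -> 0 < L r.
  by move=> /andP[r0 r1]; have [] // := eta_lap r%:C; apply: disk_real; rewrite ltW.
have Tpos (r : R) : 0 <= r < 1 -> 0 < tau r%:C by move=> hr; apply: tau_pos; exact: disk_real.
(* The class compares [tau] with the power [-1/2] of the Laplacian; passing to [L] and [tau ^ (-2)]
   squares the constant. *)
exists h, N, L, (c ^+ 2); split => //.
- split.
  + by rewrite exprn_gt0.
  + move=> r hr; split; first by have [] := D r hr.
    have /andP[r0 r1] := hr.
    have r2 : 0 < r / 2 by rewrite divr_gt0.
    have r2r : r / 2 < r by lra.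
    (* Strict monotonicity of [h] only yields some [x <= r] with [N x > 0]; since [N' = r * L] is
       positive, this carries over to [r]. *)
    have [x hx hE] : exists2 x, r / 2 <= x <= r & h r - h (r / 2) = N x / x * (r - r / 2).
      apply: (@mvt R h (fun x => N x / x)); first exact: ltW.
      by move=> x hx; have [] // := D x; lra.
    have [y hy yE] : exists2 y, x <= y <= r & N r - N x = y * L y * (r - x).
      apply: (@mvt R N (fun x => x * L x)); first by lra.
      by move=> y hy; have [] // := D y; lra.
    have x0 : 0 < x by lra.
    have Nx : 0 < N x.
      have : 0 < N x / x * (r - r / 2).
        by rewrite -hE subr_gt0; apply: hinc => //; exact: ltW.
      by rewrite pmulr_lgt0; [rewrite pmulr_lgt0// invr_gt0|lra].
    have : 0 <= N r - N x.
      rewrite yE mulr_ge0 ?mulr_ge0//; [lra| |lra].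
      by apply: ltW; apply: Lpos; lra.
    by lra.
  + move=> r hr; split; first by have [] := D r hr.
    have /andP[r0 r1] := hr.
    have dr : disk r%:C by apply: disk_real; rewrite ltW.
    have [t1 t2] := tau_comp r%:C dr.
    by apply: sqrtV_bounds => //; [exact: Lpos|exact: tau_pos].
  + exact: Tpos.
  + move=> e e0.
    have n1 : \forall r \near (1 : R)^'-, tau r%:C < e.
      by move/cvgr_lt : tau0; apply.
    have n2 : \forall r \near (1 : R)^'-, `|derive1 (fun t : R => tau t%:C) r| < e.
      by move/cvgr0_norm_lt : dtau0; apply.
    have [r1 h1 H1] := near_left1 n1; have [r2 h2 H2] := near_left1 n2.
    exists (Num.max r1 r2); first by rewrite lt_max gt_max; lra.
    move=> r; rewrite gt_max => /andP[/andP[hr1 hr2] r_1].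
    split; first by apply: H1; rewrite hr1.
    exists (derive1 (fun t : R => tau t%:C) r); last by apply: H2; rewrite hr2.
    rewrite derive1E; apply/derivableP/tau_derivable; apply: tau_diff.
    by apply: (@disk_real R r); clear -hr1 h1 r_1; lra.
- move=> z dz; rewrite omE// /h; congr (expR (- _)); apply: eta_rad => //.
    by apply: disk_real; rewrite normc_ge0.
  by rewrite normc_real ger0_norm ?normc_ge0.
- move=> z dz; apply: tau_rad => //.
    by apply: disk_real; rewrite normc_ge0.
  by rewrite normc_real ger0_norm ?normc_ge0.
- by apply/measurable_EFinP; exact: measurable_int om_int.
Qed.

(** * Growth of the profile near the boundary *)

Lemma lnB_le (R : realType) (x y : R) : 0 < x -> 0 < y -> ln y - ln x <= (y - x) / x.
Proof.
move=> x0 y0; rewrite -ln_div ?posrE// -ler_expR lnK ?posrE ?divr_gt0//.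
apply: le_trans (expR_ge1Dx _); rewrite mulrBl divff ?gt_eqF//.
by rewrite addrC subrK.
Qed.

Lemma lnB_ge (R : realType) (x y : R) : 0 < x -> 0 < y -> (y - x) / y <= ln y - ln x.
Proof.
move=> x0 y0; have := lnB_le y0 x0.
by rewrite (_ : (x - y) / y = - ((y - x) / y)); [lra|rewrite -mulNr opprB].
Qed.

Lemma lnB_norm (R : realType) (x y : R) : 1 / 2 <= x -> 1 / 2 <= y ->
  `|ln y - ln x| <= 2 * `|y - x|.
Proof.
wlog xy : x y / x <= y.
  move=> H hx hy; have [xy|/ltW xy] := leP x y; first exact: H.
  by rewrite distrC (distrC y); exact: H.
move=> hx hy; have x0 : 0 < x by lra. have y0 : 0 < y by lra.
have h : 0 <= ln y - ln x by rewrite subr_ge0 ler_ln ?posrE.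
rewrite (ger0_norm h) ger0_norm ?subr_ge0//; apply: le_trans (lnB_le x0 y0) _.
rewrite ler_pdivrMr//.
have := mulr_ge0 (_ : 0 <= y - x) (_ : 0 <= x - 1 / 2).
by move=> /(_ ltac:(lra) ltac:(lra)); lra.
Qed.

Lemma profile_N_mono (R : realType) (h N L T : R -> R) (c : R)
    (r s : R) :
  profile h N L T c -> 0 < r -> r <= s -> s < 1 -> N r <= N s.
Proof.
move=> HP r0 rs s1; have [c0 _ HN HT _] := HP.
have [x hx xE] := @mvt R N (fun x => x * L x) r s rs
  (fun x hx => (HN x ltac:(lra)).1).
have hx1 : 0 < x < 1 by lra.
have [_ /andP[Lx _]] := HN x hx1.
have Tx : 0 < T x by apply: HT; lra.
have : 0 <= N s - N r; last by lra.
rewrite xE; apply: mulr_ge0; last by lra.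
apply: mulr_ge0; first by lra.
by apply: le_trans Lx; rewrite invr_ge0 mulr_ge0 ?sqr_ge0// ltW.
Qed.

(** Convexity of [h] in the variable [ln r]: the derivative of [h - N t * ln] at [x] is
    [(N x - N t) / x], which changes sign at [t] because [N] is nondecreasing. *)
Lemma profile_tangent (R : realType) (h N L T : R -> R) (c : R)
    (r t : R) :
  profile h N L T c -> 0 < r < 1 -> 0 < t < 1 ->
  N t * (ln r - ln t) <= h r - h t.
Proof.
move=> HP /andP[r0 r1] /andP[t0 t1]; have [c0 Hh HN HT _] := HP.
pose f (x : R) : R := h x - N t * ln x.
have df (x : R) : 0 < x < 1 -> is_derive x (1 : R) f (N x / x - N t / x).
  move=> /[dup] /andP[x0 _] hx; have [dh _] := Hh x hx.
  have H := is_deriveB dh (is_deriveM (is_derive_cst (N t) x (1 : R)) (is_derive1_ln x0)).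
  by move: H; rewrite scaler0 addr0.
suff : f t <= f r by rewrite /f; lra.
have [rt|/ltW tr] := leP r t.
  have [x hx xE] := @mvt R f (fun x => N x / x - N t / x) r t rt (fun x hx => df x ltac:(lra)).
  have x0 : 0 < x by lra.
  have Nx : N x <= N t by apply: (profile_N_mono HP); lra.
  suff : f t - f r <= 0 by lra.
  rewrite xE -mulrBl; apply: mulr_le0_ge0; last by lra.
  by apply: mulr_le0_ge0; [lra|rewrite invr_ge0 ltW].
have [x hx xE] := @mvt R f (fun x => N x / x - N t / x) t r tr (fun x hx => df x ltac:(lra)).
have x0 : 0 < x by lra.
have Nx : N t <= N x by apply: (profile_N_mono HP); lra.
suff : 0 <= f r - f t by lra.
rewrite xE -mulrBl; apply: mulr_ge0; last by lra.
by apply: mulr_ge0; [lra|rewrite invr_ge0 ltW].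
Qed.

(** The small derivative makes [T] Lipschitz with constant [e] near 1. Comparing [T r] with a value
    [T s] as [s] tends to 1, where [T] vanishes, gives [T r <= e * (1 - r)]. *)
Lemma profile_lip (R : realType) (h N L T : R -> R) (c : R)
    (e : R) :
  profile h N L T c -> 0 < e -> exists2 r0 : R, 1 / 2 < r0 < 1 &
  forall r : R, r0 < r < 1 -> [/\ 0 < T r, T r < e, T r <= e * (1 - r) &
    forall s : R, r0 < s < 1 -> `|T s - T r| <= e * `|s - r|].
Proof.
move=> HP e0; have [_ _ _ HT /(_ e e0)[r1 hr1 H1]] := HP.
have lip (r s : R) : r1 < r < 1 -> r1 < s < 1 -> `|T s - T r| <= e * `|s - r|.
  wlog rs : r s / r <= s.
    move=> H hr hs; have [rs|/ltW sr] := leP r s; first exact: H.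
    by rewrite distrC (distrC s); exact: H.
  move=> hr hs.
  have [dT HdT] : exists dT : R -> R, forall x, r1 < x < 1 ->
      is_derive x (1 : R) T (dT x) /\ `|dT x| < e.
    have : forall x : R, exists d : R, r1 < x < 1 -> is_derive x (1 : R) T d /\ `|d| < e.
      move=> x; have [hx|hx] := boolP (r1 < x < 1); last by exists 0.
      by have [_ [d ? ?]] := H1 x hx; exists d.
    by move/choice => [dT HdT]; exists dT.
  have [x hx ->] := @mvt R T dT r s rs (fun x hx => (HdT x ltac:(lra)).1).
  rewrite normrM; apply: ler_wpM2r => //.
  by apply: ltW; apply: (HdT x _).2; lra.
exists (Num.max r1 (3 / 4)).
  by rewrite lt_max gt_max; apply/andP; split; [apply/orP; right|apply/andP; split]; lra.
move=> r; rewrite gt_max => /andP[/andP[rr1 r34] r_1].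
have hr : r1 < r < 1 by rewrite rr1.
split.
- by apply: HT; lra.
- by have [] := H1 r hr.
- apply/ler_addgt0Pr => e' e'0.
  have [_ _ _ _ /(_ e' e'0)[r2 hr2 H2]] := HP.
  pose s := (1 + Num.max r r2) / 2.
  have hm : r <= Num.max r r2 by rewrite le_max lexx.
  have hm2 : r2 <= Num.max r r2 by rewrite le_max lexx orbT.
  have hm3 : Num.max r r2 < 1 by rewrite gt_max; lra.
  have hs : r < s /\ r2 < s /\ s < 1 by rewrite /s; lra.
  have [Ts _] := H2 s ltac:(lra).
  have := lip s r ltac:(lra) ltac:(lra).
  rewrite ler_norml => /andP[_].
  rewrite ler0_norm; last by lra.
  have : e * (s - r) <= e * (1 - r) by apply: ler_wpM2l; [exact: ltW|lra].
  by clear -Ts; lra.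
- move=> s; rewrite gt_max => /andP[/andP[sr1 _] s_1].
  by apply: lip; rewrite ?rr1 ?sr1.
Qed.

(** Over a distance [8 * c * M * T s] the function [T] at most doubles, so
    [N' >= 1 / 2 * (4 * c * T s ^ 2)^-1], and the product is [M / T s]. This growth pays for the
    geometric factor of the test functions. *)
Lemma profile_N_growth (R : realType) (h N L T : R -> R) (c : R)
    (M : R) :
  profile h N L T c -> 0 < M -> exists2 r0 : R, 1 / 2 < r0 < 1 &
  forall s : R, r0 < s < 1 -> s + 8 * c * M * T s < 1 /\
    N s + M / T s <= N (s + 8 * c * M * T s).
Proof.
move=> HP M0; have [c0 _ HN _ _] := HP.
pose K := 8 * c * M.
have K0 : 0 < K by rewrite !mulr_gt0.
have e0 : 0 < 1 / (2 * K) by rewrite divr_gt0// mulr_gt0.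
have [r0 hr0 H] := profile_lip HP e0; exists r0 => // s hs.
have [Ts _ T1 Tl] := H s hs; rewrite -/K.
have KT : K * T s <= (1 - s) / 2.
  rewrite mulrC -ler_pdivlMr//; apply: (le_trans T1).
  by rewrite le_eqVlt; apply/orP; left; apply/eqP; field; rewrite gt_eqF.
have KT0 : 0 < K * T s by rewrite mulr_gt0.
split; first by lra.
have [x hx xE] := @mvt R N (fun x => x * L x) s (s + K * T s) ltac:(lra)
  (fun x hx => (HN x ltac:(lra)).1).
have hx0 : 0 < x < 1 by lra.
have hx1 : r0 < x < 1 by lra.
have [_ /andP[Lx _]] := HN x hx0.
have [Tx _ _ _] := H x hx1.
have T2 : T x <= 2 * T s.
  have := Tl x hx1; rewrite ler_norml => /andP[_].
  rewrite ger0_norm; last by lra.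
  have : 1 / (2 * K) * (x - s) <= 1 / (2 * K) * (K * T s) by apply: ler_wpM2l; [exact: ltW|lra].
  by rewrite (_ : 1 / (2 * K) * (K * T s) = T s / 2); [lra|field; rewrite gt_eqF].
have L2 : (4 * c * T s ^+ 2)^-1 <= L x.
  apply: le_trans Lx; rewrite lef_pV2 ?posrE ?mulr_gt0 ?exprn_gt0//.
  have : T x ^+ 2 <= (2 * T s) ^+ 2.
    by apply: lerXn2r; rewrite ?nnegrE; [exact: ltW|rewrite mulr_ge0// ltW|].
  by rewrite exprMn => hT; rewrite (_ : 4 * c * _ = c * (2 ^+ 2 * T s ^+ 2)); [rewrite ler_pM2l|ring].
rewrite addrC -lerBrDr xE (_ : s + K * T s - s = K * T s); last by ring.
rewrite (_ : M / T s = (1 / 2 * (4 * c * T s ^+ 2)^-1) * (K * T s)); last first.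
  by rewrite /K; field; rewrite !gt_eqF.
apply: ler_wpM2r; first exact: ltW.
apply: ler_pM => //; [|lra].
by rewrite invr_ge0 !mulr_ge0 ?sqr_ge0// ltW.
Qed.

(** The tangents at [r] and at [s] give [h r - h s - N s * (ln r - ln s) <= (N r - N s) * (ln r - ln
    s)]. At distance at most [T s / 2] the first factor is bounded by [2 * c / T s] and the second
    by [T s]. *)
Lemma profile_near (R : realType) (h N L T : R -> R) (c : R)
     :
  profile h N L T c -> exists2 r0 : R, 1 / 2 < r0 < 1 &
  forall s : R, r0 < s < 1 -> [/\ 0 < T s, T s <= (1 - s) / 4 &
    forall r : R, `|r - s| <= T s / 2 ->
      [/\ 1 / 2 <= r < 1,  T s / 2 <= T r <= 2 * T s
      & h r - h s <= N s * (ln r - ln s) + 2 * c]].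
Proof.
move=> HP.
have [c0 _ HN _ _] := HP.
have q0 : 0 < 1 / 4 :> R by lra.
have [r1 hr1 H] := profile_lip HP q0.
exists ((1 + r1) / 2); first by lra.
move=> s hs; have hs1 : r1 < s < 1 by lra.
have [Ts Ts1 Ts2 Tl] := H s hs1.
split; [exact: Ts|by lra|].
move=> r hr; have [hra hrb] : - (T s / 2) <= r - s /\ r - s <= T s / 2.
  by move: hr; rewrite ler_norml => /andP[].
have hr2 : r1 < r < 1 by lra.
have Tr (x : R) : r1 < x < 1 -> `|x - s| <= T s / 2 -> T s / 2 <= T x <= 2 * T s.
  move=> hx hxs; have := Tl x hx; rewrite ler_norml => /andP[t1 t2].
  by apply/andP; split; lra.
split; [by lra|exact: Tr|].
have tg : h r - h s <= N r * (ln r - ln s).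
  by have := profile_tangent HP (r := s) (t := r) ltac:(lra) ltac:(lra); lra.
suff : (N r - N s) * (ln r - ln s) <= 2 * c by move: tg; rewrite mulrBl; lra.
apply: le_trans (ler_norm _) _; rewrite normrM.
have l1 : `|ln r - ln s| <= T s.
  by apply: le_trans (lnB_norm _ _) _; [lra|lra|lra].
have l2 : `|N r - N s| <= 4 * c / T s ^+ 2 * (T s / 2).
  have B (x : R) : r1 < x < 1 -> `|x - s| <= T s / 2 -> 0 <= x * L x <= 4 * c / T s ^+ 2.
    move=> hx hxs; have hx0 : 0 < x < 1 by lra.
    have [_ /andP[Lx0 Lx]] := HN x hx0.
    have [Tx _ _ _] := H x hx.
    have Lp : 0 <= L x by apply: le_trans Lx0; rewrite invr_ge0 mulr_ge0 ?sqr_ge0// ltW.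
    apply/andP; split; first by apply: mulr_ge0 => //; lra.
    apply: (@le_trans _ _ (L x)).
      have : 0 <= L x * (1 - x) by apply: mulr_ge0 => //; lra.
      by clear; lra.
    apply: (le_trans Lx); rewrite ler_pdivrMr ?exprn_gt0//.
    rewrite mulrAC ler_pdivlMr ?exprn_gt0//.
    have /andP[t1 _] := Tr x hx hxs.
    have : T s ^+ 2 <= (2 * T x) ^+ 2.
      by apply: lerXn2r; rewrite ?nnegrE; [exact: ltW|rewrite mulr_ge0// ltW|lra].
    by rewrite exprMn => hT; rewrite (_ : 4 * c * _ = c * (2 ^+ 2 * T x ^+ 2)); [rewrite ler_pM2l|ring].
  have [rs|/ltW sr] := leP r s.
    have [x hx xE] := @mvt R N (fun x => x * L x) r s rs (fun x hx => (HN x ltac:(lra)).1).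
    have hxs : `|x - s| <= T s / 2 by rewrite ler_norml; apply/andP; split; lra.
    have /andP[b1 b2] := B x ltac:(lra) hxs.
    rewrite distrC xE normrM (ger0_norm b1); apply: ler_pM => //.
    by rewrite distrC.
  have [x hx xE] := @mvt R N (fun x => x * L x) s r sr (fun x hx => (HN x ltac:(lra)).1).
  have hxs : `|x - s| <= T s / 2 by rewrite ler_norml; apply/andP; split; lra.
  have /andP[b1 b2] := B x ltac:(lra) hxs.
  by rewrite xE normrM (ger0_norm b1); apply: ler_pM.
apply: le_trans (ler_pM (normr_ge0 _) (normr_ge0 _) l2 l1) _.
by rewrite le_eqVlt; apply/orP; left; apply/eqP; field; rewrite gt_eqF.
Qed.

Lemma profile_h_mono (R : realType) (h N L T : R -> R) (c : R) (r s : R) :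
  profile h N L T c -> 0 < r -> r <= s -> s < 1 -> h r <= h s.
Proof.
move=> HP r0 rs s1; have [c0 Hh _ _ _] := HP.
have [_ Nr] := Hh r ltac:(lra).
have := profile_tangent HP (r := s) (t := r) ltac:(lra) ltac:(lra).
have : 0 <= N r * (ln s - ln r).
  by apply: mulr_ge0; [exact: ltW|rewrite subr_ge0 ler_ln ?posrE//; lra].
by lra.
Qed.

(** As [N] is positive, its increment over [[s - T s / 2, s]] is a lower bound:
    [1 / 2 * (4 * c * T s ^ 2)^-1 * (T s / 2)]. *)
Lemma profile_N_lower (R : realType) (h N L T : R -> R) (c : R) :
  profile h N L T c -> exists2 r0 : R, 1 / 2 < r0 < 1 &
  forall s : R, r0 < s < 1 -> (16 * c * T s)^-1 <= N s.
Proof.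
move=> HP; have [c0 Hh HN _ _] := HP.
have [r0 hr0 H] := profile_near HP; exists r0 => // s hs.
have [Ts Ts1 Hs] := H s hs.
pose r := s - T s / 2.
have h1 : `|r - s| <= T s / 2 by rewrite /r addrC addKr normrN ger0_norm//; lra.
have [/andP[r12 r1] _ _] := Hs r h1.
have rs : r <= s by rewrite /r; lra.
have [x hx xE] := @mvt R N (fun x => x * L x) r s rs (fun x hx => (HN x ltac:(lra)).1).
have hxs : `|x - s| <= T s / 2.
  by rewrite ler_norml; apply/andP; split; rewrite /r in hx; lra.
have [hx1 /andP[t1 t2] _] := Hs x hxs.
have Tx : 0 < T x by lra.
have [_ /andP[Lx _]] := HN x ltac:(lra).
have L2 : (4 * c * T s ^+ 2)^-1 <= L x.
  apply: le_trans Lx; rewrite lef_pV2 ?posrE ?mulr_gt0 ?exprn_gt0//.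
  have : T x ^+ 2 <= (2 * T s) ^+ 2.
    by apply: lerXn2r; rewrite ?nnegrE; [exact: ltW|rewrite mulr_ge0// ltW|].
  by rewrite exprMn => hT; rewrite (_ : 4 * c * _ = c * (2 ^+ 2 * T s ^+ 2)); [rewrite ler_pM2l|ring].
have [_ Nr] := Hh r ltac:(lra).
suff : (16 * c * T s)^-1 <= N s - N r by lra.
rewrite xE (_ : s - r = T s / 2); last by rewrite /r; ring.
rewrite (_ : (16 * c * T s)^-1 = 1 / 2 * (4 * c * T s ^+ 2)^-1 * (T s / 2)); last first.
  by field; rewrite !gt_eqF.
apply: ler_wpM2r; first by rewrite divr_ge0// ltW.
apply: ler_pM => //; [|lra].
by rewrite invr_ge0 !mulr_ge0 ?sqr_ge0// ltW.
Qed.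

Lemma profile_jump (R : realType) (h N L T : R -> R) (c : R) :
  profile h N L T c -> exists2 r0 : R, 1 / 2 < r0 < 1 &
  forall r s : R, r0 < r -> r <= s -> s < 1 ->
    (s - r) / (16 * c * T r) <= h s - h r.
Proof.
move=> HP; have [c0 _ _ HT _] := HP.
have [r0 hr0 H] := profile_N_lower HP; exists r0 => // r s hr rs s1.
apply: le_trans (profile_tangent HP (r := s) (t := r) ltac:(lra) ltac:(lra)).
have Nr := H r ltac:(lra).
have Tr : 0 < T r by apply: HT; lra.
have lnb : s - r <= ln s - ln r.
  apply: le_trans (lnB_ge (x := r) (y := s) ltac:(lra) ltac:(lra)).
  rewrite ler_pdivlMr; last by lra.
  have : 0 <= (s - r) * (1 - s) by apply: mulr_ge0; lra.
  by clear; lra.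
rewrite mulrC; apply: ler_pM => //; last by lra.
by rewrite invr_ge0 !mulr_ge0// ltW.
Qed.

(** By [profile_lip], [T s <= T r + (s - r)], and [profile_jump] bounds [s - r] by
    [16 * c * T r * (h s - h r)]. The difference of [h] is the logarithm of a quotient of weights:
    this is the logarithmic loss. *)
Lemma profile_tau_ratio (R : realType) (h N L T : R -> R) (c : R) :
  profile h N L T c -> exists2 r0 : R, 1 / 2 < r0 < 1 &
  forall r s : R, r0 < r -> r <= s -> s < 1 ->
    T s <= T r * (1 + 16 * c * (h s - h r)).
Proof.
move=> HP; have [c0 _ _ _ _] := HP.
have [r1 hr1 H1] := profile_lip HP ltr01.
have [r2 hr2 H2] := profile_jump HP.
exists (Num.max r1 r2); first by rewrite lt_max gt_max; lra.
move=> r s; rewrite gt_max => /andP[rr1 rr2] rs s1.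
have [Tr _ _ /(_ s ltac:(lra))] := H1 r ltac:(lra).
rewrite ler_norml mul1r (ger0_norm (_ : 0 <= s - r)) ?subr_ge0// => /andP[_ Ts].
have := H2 r s rr2 rs s1; rewrite ler_pdivrMr ?mulr_gt0// => hj.
rewrite mulrDr mulr1; move: hj; rewrite (_ : (h s - h r) * _ = T r * (16 * c * (h s - h r))).
  by lra.
by ring.
Qed.

(** From [r] to the midpoint of [r] and 1, [profile_jump] raises [h] by [(1 - r) / (32 * c * T r)],
    which is as large as desired because [T r] is small compared with [1 - r]. *)
Lemma profile_blowup (R : realType) (h N L T : R -> R) (c M : R) :
  profile h N L T c -> exists2 r0 : R, 1 / 2 < r0 < 1 &
  forall r : R, r0 < r < 1 -> M <= h r.
Proof.
move=> HP; have [c0 _ _ HT _] := HP.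
pose K := `|M| + `|h (1 / 2)| + 1.
have K0 : 0 < K by rewrite /K ltr_wpDl// addr_ge0.
have e0 : 0 < 1 / (32 * c * K) by rewrite divr_gt0// !mulr_gt0.
have [r1 hr1 H1] := profile_lip HP e0.
have [r2 hr2 H2] := profile_jump HP.
pose m := Num.max r1 r2.
have hm : 1 / 2 < m < 1 by rewrite /m lt_max gt_max; lra.
have [m1 m2] : r1 <= m /\ r2 <= m by rewrite /m !le_max !lexx orbT.
pose r := (1 + m) / 2; pose s := (1 + r) / 2.
have hr : m < r < 1 by rewrite /r; lra.
have hs : r < s < 1 by rewrite /s; lra.
exists s; first by lra.
move=> t ht.
have ts := profile_h_mono HP (r := s) (s := t) ltac:(lra) ltac:(lra) ltac:(lra).
have rh := profile_h_mono HP (r := 1 / 2) (s := r) ltac:(lra) ltac:(lra) ltac:(lra).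
have [Tr _ Tr1 _] := H1 r ltac:(lra).
have : K <= h s - h r.
  apply: le_trans (H2 r s ltac:(lra) ltac:(lra) ltac:(lra)).
  rewrite ler_pdivlMr ?mulr_gt0//.
  rewrite (_ : s - r = (1 - r) / 2); last by rewrite /s; field.
  apply: (@le_trans _ _ (K * (16 * c * (1 / (32 * c * K) * (1 - r))))).
    by rewrite ler_pM2l// ler_pM2l ?mulr_gt0.
  by rewrite le_eqVlt; apply/orP; left; apply/eqP; field; rewrite !gt_eqF.
have := ler_norm M; have := ler_norm (- h (1 / 2)); rewrite normrN /K.
by lra.
Qed.

Lemma exprM_ln (R : realType) (x : R) (n : nat) : 0 < x -> x ^+ n = expR (n%:R * ln x).
Proof. by move=> x0; rewrite expRM_natl lnK. Qed.

Lemma nat_above (R : realType) (x : R) : 0 <= x ->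
  exists n : nat, [/\ (0 < n)%N, x <= n%:R & n%:R <= x + 1].
Proof.
move=> x0; exists (Num.truncn x).+1; split => //.
  by apply: ltW; exact: truncnS_gt.
by rewrite -natr1 lerD2r truncn_le.
Qed.

(** With [n] an integer in [[N s, N s + 1]], the deviation [2 * c] from the tangent is joined by the
    rounding error [(n - N s) * (ln s - ln r) <= 1]. *)
Lemma profile_local (R : realType) (h N L T : R -> R) (c : R) :
  profile h N L T c -> exists2 r0 : R, 1 / 2 < r0 < 1 &
  forall s : R, r0 < s < 1 -> exists n : nat, forall r : R, `|r - s| <= T s / 2 ->
    expR (- h s) * s ^+ n <= expR (2 * c + 1) * (expR (- h r) * r ^+ n).
Proof.
move=> HP; have [c0 Hh HN _ _] := HP.
have [r0 hr0 H] := profile_near HP; exists r0 => // s hs.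
have [Ts Ts1 Hs] := H s hs.
have [_ Ns] := Hh s ltac:(lra).
have [n [_ n1 n2]] := nat_above (ltW Ns).
exists n => r hr; have [hr1 _ hd] := Hs r hr.
rewrite !exprM_ln; [|lra|lra].
rewrite -!expRD ler_expR.
have : (n%:R - N s) * (ln s - ln r) <= 1.
  apply: le_trans (ler_norm _) _; rewrite normrM -[leRHS]mulr1.
  apply: ler_pM => //.
    by rewrite ger0_norm; lra.
  apply: le_trans (lnB_norm _ _) _; [lra|lra|].
  by rewrite distrC; lra.
by move: hd; lra.
Qed.

(** For [r <= s] the tangent at [s] suffices, as [n >= N s]. Beyond [s] the exponent is
    [l = n + m * K <= N s + M / T s]. Up to [t], at distance comparable to [T s], the excess
    [(l - N s) * (ln r - ln s)] is bounded; beyond [t] one has [l <= N t], and the tangent at [t]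
    takes over. *)
Lemma profile_test (R : realType) (h N L T : R -> R) (c : R) (m : nat) :
  profile h N L T c ->
  exists C, 0 < C /\ exists2 r0 : R, 1 / 2 < r0 < 1 &
  forall s : R, r0 < s < 1 -> exists n K : nat, [/\ (0 < K)%N, (T s)^-1 <= K%:R &
    forall r : R, 0 <= r < 1 ->
      (r / s) ^+ n * Num.max 1 (r / s) ^+ (m * K) * expR (- h r) <= C * expR (- h s)].
Proof.
move=> HP; have [c0 Hh HN HT _] := HP.
(* [n <= N s + 1] and [K <= (T s)^-1 + 1], where [1 <= (T s)^-1], so [n + m * K] exceeds [N s] by at
   most [(2 * m + 1) / T s]. *)
pose M : R := (2 * m + 1)%:R.
have M0 : 0 < M by rewrite ltr0n addn1.
pose KK := 8 * c * M.
have KK0 : 0 < KK by rewrite !mulr_gt0.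
have [r1 hr1 H1] := profile_N_growth HP M0.
have [r2 hr2 H2] := profile_lip HP ltr01.
exists (expR (2 * M * KK)); split; first exact: expR_gt0.
exists (Num.max r1 r2); first by rewrite lt_max gt_max; lra.
move=> s; rewrite gt_max => /andP[/andP[sr1 sr2] s1].
have [Ts Ts1 _ _] := H2 s ltac:(lra).
have [t1 Nt] := H1 s ltac:(lra).
set t := s + 8 * c * M * T s in t1 Nt.
have KT : 0 < KK * T s by rewrite mulr_gt0.
have tE : t = s + KK * T s by [].
have st : s < t by rewrite tE; clear -KT; lra.
have [_ Ns] := Hh s ltac:(lra).
have [n [n0 n1 n2]] := nat_above (ltW Ns).
have iT : 1 <= (T s)^-1 by rewrite invf_ge1// ltW.
have [K [K0 K1 K2]] := nat_above (le_trans ler01 iT).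
(* At [r = 0], where logarithms are of no use, [0 < n] makes the left-hand side vanish. *)
exists n, K; split => // r /andP[]; rewrite le_eqVlt => /predU1P[<- _|r0 r_1].
  by rewrite mul0r expr0n eqn0Ngt n0 !mul0r mulr_ge0 ?expR_ge0.
have s0 : 0 < s by clear -sr1 hr1; lra.
have t0 : 0 < t by clear -s0 st; lra.
have rs0 : 0 < r / s by rewrite divr_gt0.
have [rs|sr] := leP r s.
  have m1 : Num.max 1 (r / s) = 1.
    by apply/max_idPl; rewrite ler_pdivrMr// mul1r.
  rewrite m1 expr1n mulr1 exprM_ln// ln_div ?posrE// -!expRD ler_expR.
  have tg := profile_tangent HP (r := r) (t := s) ltac:(lra) ltac:(lra).
  have : (n%:R - N s) * (ln r - ln s) <= 0.
    apply: mulr_ge0_le0; first by clear -n1; lra.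
    by rewrite subr_le0 ler_ln ?posrE.
  have : 0 <= 2 * M * KK by rewrite !mulr_ge0// ltW.
  by clear -tg; lra.
have -> : Num.max 1 (r / s) = r / s.
  by apply/max_idPr; rewrite ler_pdivlMr// mul1r ltW.
rewrite -exprD exprM_ln// ln_div ?posrE// -!expRD ler_expR.
set l := (n + m * K)%:R.
have lM : l <= N s + M / T s.
  rewrite /l natrD natrM /M natrD natrM mulr1n mulrDl mul1r.
  have : m%:R * K%:R <= m%:R * (2 * (T s)^-1) :> R.
    by apply: ler_wpM2l => //; clear -K2 iT; lra.
  by clear -n2 iT; lra.
have Nl : N s <= l.
  rewrite /l natrD natrM.
  have : 0 <= m%:R * K%:R :> R by apply: mulr_ge0.
  by clear -n1; lra.
have lns : (l - N s) * (ln t - ln s) <= 2 * M * KK.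
  apply: (@le_trans _ _ (M / T s * (2 * (KK * T s)))).
    apply: ler_pM; [by clear -Nl; lra| |by clear -lM; lra|].
      by rewrite subr_ge0 ler_ln ?posrE// ltW.
    apply: le_trans (lnB_le s0 t0) _; rewrite tE addrC addKr ler_pdivrMr//.
    have : 0 <= (KK * T s) * (2 * s - 1) by apply: mulr_ge0; [exact: ltW|clear -sr1 hr1; lra].
    by clear; lra.
  by rewrite le_eqVlt; apply/orP; left; apply/eqP; field; rewrite gt_eqF.
have tgs (x : R) : 0 < x < 1 -> N s * (ln x - ln s) <= h x - h s.
  by move=> hx; apply: (profile_tangent HP) => //; lra.
have lrs : 0 <= ln r - ln s by rewrite subr_ge0 ler_ln ?posrE// ltW.
have [rt|tr] := leP r t.
  have h1 := tgs r ltac:(lra).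
  have : (l - N s) * (ln r - ln s) <= (l - N s) * (ln t - ln s).
    apply: ler_wpM2l; first by clear -Nl; lra.
    by rewrite lerD2r ler_ln ?posrE.
  by clear -h1 lns; lra.
have h1 := tgs t ltac:(lra).
have h2 := profile_tangent HP (r := r) (t := t) ltac:(lra) ltac:(lra).
have : l * (ln r - ln t) <= N t * (ln r - ln t).
  apply: ler_wpM2r; first by rewrite subr_ge0 ler_ln ?posrE// ltW.
  exact: le_trans Nt.
by clear -h1 h2 lns; lra.
Qed.

(** * Point evaluations *)

Lemma measurable_powR_comp (R : realType) (D : set (plane R)) (f : plane R -> R) (r : R) :
  measurable_fun D f -> measurable_fun D (fun w => f w `^ r).
Proof. exact: (measurableT_comp (measurable_powR r)). Qed.

Lemma measurable_normc_comp (R : realType) (D : set (plane R)) (f : plane R -> R[i]) :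
  measurable_fun D (fun w => complex.Re (f w)) ->
  measurable_fun D (fun w => complex.Im (f w)) ->
  measurable_fun D (fun w => normc (f w)).
Proof.
move=> mr mi.
rewrite (_ : (fun w => _) =
  (fun w => (complex.Re (f w) ^+ 2 + complex.Im (f w) ^+ 2) `^ (2^-1))).
  by apply: measurable_powR_comp; apply: measurable_funD; exact: measurable_funX.
apply/funext => w; rewrite powR12_sqrt ?addr_ge0 ?sqr_ge0//.
by case: (f w).
Qed.

Lemma measurable_normc (R : realType) (D : set (plane R)) :
  measurable_fun D (fun w : plane R => normc (toC w)).
Proof.
apply: measurable_normc_comp; apply: measurable_funTS.
  exact: measurable_fst.
exact: measurable_snd.
Qed.

Lemma measurable_plane_disk (R : realType) : measurable (@plane_disk R).
Proof.
have := @measurable_fun_ltr _ (plane R) R setT (fun w => normc (toC w)) (cst 1)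
  (@measurable_normc R setT) (measurable_cst _).
move=> /(_ measurableT [set true])/(_ I); rewrite setTI.
by congr measurable; apply/seteqP; split => w.
Qed.

Definition Lp_integrand (R : realType) (omega : R[i] -> R) (p : R)
    (f : R[i] -> R[i]) (q : plane R) : R :=
  (normc (f (toC q)) * omega (toC q)) `^ p.

Lemma LpE (R : realType) (omega : R[i] -> R) (p : R) (f : R[i] -> R[i]) :
  Lp_norm omega p f =
  ((\int[@dA R]_(q in plane_disk) (Lp_integrand omega p f q)%:E) `^ p^-1)%E.
Proof. by []. Qed.

Lemma measurable_Lp_integrand (R : realType) (omega : R[i] -> R) (p : R)
    (f : R[i] -> R[i]) :
  measurable_fun plane_disk (fun q : plane R => omega (toC q)) ->
  measurable_fun plane_disk (fun q : plane R => normc (f (toC q))) ->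
  measurable_fun plane_disk (Lp_integrand omega p f).
Proof. by move=> mo mf; apply: measurable_powR_comp; exact: measurable_funM. Qed.

Lemma integral_dA (R : realType) (f : plane R -> R) :
  measurable_fun plane_disk f -> (forall w, 0 <= f w) ->
  (\int[@dA R]_(q in plane_disk) (f q)%:E =
   (pi^-1)%:E * \int[@leb2 R]_(q in plane_disk) (f q)%:E)%E.
Proof.
move=> mf f0; rewrite /dA ge0_integral_mscale//.
- exact: measurable_plane_disk.
- exact/measurable_EFinP.
- by move=> w _; rewrite lee_fin.
Qed.

Lemma Lp_norm_le_integral (R : realType) (omega : R[i] -> R) (p M : R)
    (f : R[i] -> R[i]) :
  0 < p -> 0 <= M ->
  measurable_fun plane_disk (fun q : plane R => omega (toC q)) ->
  measurable_fun plane_disk (fun q : plane R => normc (f (toC q))) ->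
  (Lp_norm omega p f <= M%:E)%E ->
  (\int[@leb2 R]_(q in plane_disk) (Lp_integrand omega p f q)%:E <=
    (pi * M `^ p)%:E)%E.
Proof.
move=> p0 M0 mo mf; rewrite LpE.
have mL := measurable_Lp_integrand p mo mf.
have := integral_dA mL (fun w => powR_ge0 _ _).
set J := (\int[@dA R]_(q in _) _)%E; set J' := (\int[@leb2 R]_(q in _) _)%E => JE HJ.
have J0 : (0 <= J')%E by apply: integral_ge0 => w _; rewrite lee_fin powR_ge0.
have pi0 : 0 < (pi : R) := pi_gt0 R.
have {}HJ : (J <= (M `^ p)%:E)%E.
  have : (0 <= J)%E by apply: integral_ge0 => w _; rewrite lee_fin powR_ge0.
  move: HJ; case: (J) => [x| |]//=.
    rewrite !lee_fin => H x0.
    rewrite -[x](powRr1 x0) -(mulVf (lt0r_neq0 p0)) powRrM.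
    by apply: powR_homo => //; [exact: ltW|exact: powR_ge0].
  by rewrite invr_eq0 (gt_eqF p0) leye_eq.
move: HJ; rewrite JE => H.
have := lee_wpmul2l (_ : (0 <= pi%:E)%E) H.
rewrite lee_fin => /(_ (ltW pi0)).
by rewrite muleA -EFinM divff ?gt_eqF// mul1e EFinM.
Qed.

Lemma Lp_norm_ge_integral (R : realType) (omega : R[i] -> R) (p B : R)
    (f : R[i] -> R[i]) :
  0 < p ->
  measurable_fun plane_disk (fun q : plane R => omega (toC q)) ->
  measurable_fun plane_disk (fun q : plane R => normc (f (toC q))) ->
  (\int[@leb2 R]_(q in plane_disk) (Lp_integrand omega p f q)%:E <= B%:E)%E ->
  (Lp_norm omega p f <= ((B / pi) `^ p^-1)%:E)%E.
Proof.
move=> p0 mo mf HB; rewrite LpE.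
have mL := measurable_Lp_integrand p mo mf.
have := integral_dA mL (fun w => powR_ge0 _ _).
set J := (\int[@dA R]_(q in _) _)%E => JE.
have pi0 : 0 < (pi : R) := pi_gt0 R.
have HJ : (J <= (B / pi)%:E)%E.
  rewrite JE mulrC EFinM; apply: lee_wpmul2l => //.
  by rewrite lee_fin invr_ge0 ltW.
have : (0 <= J)%E by apply: integral_ge0 => w _; rewrite lee_fin powR_ge0.
move: HJ; case: (J) => [x| |]//=; rewrite !lee_fin => H x0.
by apply: powR_homo => //; rewrite invr_ge0 ltW.
Qed.

Lemma hder_divX (R : realType) (g : R[i] -> R[i]) (n : nat) (w : R[i]) :
  hder g w -> w ^+ n != 0 -> hder (fun w => g w * (w ^+ n)^-1) w.
Proof.
move=> dg wn.
have d1 : hder (fun w : R[i] => w ^+ n) w.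
  exact: (@hderX _ (fun w : R[i] => w) n w (hder_id w)).
have d2 : hder (fun w : R[i] => (w ^+ n)^-1) w.
  exact: (@hderV _ (fun w : R[i] => w ^+ n) w wn d1).
exact: (@hderM _ g (fun w : R[i] => (w ^+ n)^-1) w dg d2).
Qed.

(* The factor [zeta ^- n] makes the radial weight almost constant on the square. *)
Lemma weighted_submean (R : realType) (pp : R) : 0 < pp -> exists2 C, 0 < C &
  forall (omega : R[i] -> R) (g : R[i] -> R[i]) (z : R[i]) (r A I : R) (n : nat),
  0 < r -> 0 < A ->
  measurable_fun plane_disk (fun q : plane R => omega (toC q)) ->
  measurable_fun plane_disk (fun q : plane R => normc (g (toC q))) ->
  (forall w, disk w -> hder g w) ->
  (forall w, `|complex.Re w - complex.Re z| <= r -> `|complex.Im w - complex.Im z| <= r ->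
    [/\ disk w, w ^+ n != 0, 0 < omega w &
        omega z * normc z ^+ n <= A * (omega w * normc w ^+ n)]) ->
  (\int[@leb2 R]_(q in plane_disk) (Lp_integrand omega pp g q)%:E <= I%:E)%E ->
  r ^+ 2 * (normc (g z) * omega z) `^ pp <= C * A `^ pp * I.
Proof.
move=> pp0; have [C C0 HC] := submeanp pp0; exists C => // omega g z r A I n r0 A0.
move=> mo mg dg Hw HI; set p := complex.Re z; set q := complex.Im z.
have zE : z = p +i* q by rewrite /p /q; case: (z).
pose G (w : R[i]) : R[i] := g w * (w ^+ n)^-1.
have sqin (x y : R) : p - r <= x <= p + r -> q - r <= y <= q + r ->
    [/\ disk (x +i* y), (x +i* y) ^+ n != 0, 0 < omega (x +i* y) &
        omega z * normc z ^+ n <= A * (omega (x +i* y) * normc (x +i* y) ^+ n)].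
  by move=> hx hy; apply: Hw => /=; rewrite ler_norml -/p -/q; lra.
have nG w : normc (G w) = normc (g w) / normc w ^+ n.
  by rewrite /G normcM normcV normc_exp.
have sub : square p q r `<=` plane_disk.
  by move=> [x y] /squareP[hx hy]; have [] := sqin x y hx hy.
have dG x y : p - r <= x <= p + r -> q - r <= y <= q + r -> dble G x y.
  move=> hx hy; have [dw wn _ _] := sqin x y hx hy.
  exact: hder_divX (dg _ dw) wn.
have mpd := @measurable_plane_disk R.
have msq := measurable_square p q r.
have mG : measurable_fun (square p q r) (fun w : plane R => normc (G (toC w))).
  rewrite (_ : (fun w => _) =
     (fun w : plane R => normc (g (toC w)) * (normc (toC w) ^+ n) `^ (-1))); last first.
    by apply/funext => w; rewrite nG powR_inv1// exprn_ge0// normc_ge0.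
  apply: measurable_funM; first exact: measurable_funS mg.
  by apply: measurable_powR_comp; apply: measurable_funX; exact: measurable_normc.
have zin : [/\ disk z, z ^+ n != 0, 0 < omega z & 0 < omega z * normc z ^+ n].
  have [] := sqin p q; [lra|lra|]; rewrite -zE => d1 d2 d3 _; split => //.
  by rewrite mulr_gt0// -normc_exp normc_gt0.
have [dz z0 oz P0] := zin.
set P := omega z * normc z ^+ n in P0.
have nz0 : 0 < normc z ^+ n by rewrite -normc_exp normc_gt0.
pose k := (A / P) `^ pp.
have AP : 0 <= A / P by rewrite divr_ge0// ltW.
have k0 : 0 <= k by exact: powR_ge0.
have HG : (\int[@leb2 R]_(w in square p q r) (normc (G (toC w)) `^ pp)%:E <= (k * I)%:E)%E.
  apply: (@le_trans _ _ (\int[@leb2 R]_(w in square p q r)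
       (k%:E * (Lp_integrand omega pp g w)%:E))%E).
    apply: ge0_le_integral => //.
    - by move=> w _; rewrite lee_fin powR_ge0.
    - by apply/measurable_EFinP; exact: measurable_powR_comp.
    - apply: measurable_funeM; apply/measurable_EFinP.
      by apply: measurable_funS sub _ => //; exact: measurable_Lp_integrand.
    - move=> [x y] /squareP[hx hy]; rewrite -EFinM lee_fin.
      have [dw wn ow H] := sqin x y hx hy.
      rewrite /k /Lp_integrand -powRM//; last first.
        by rewrite mulr_ge0 ?normc_ge0// ltW.
      apply: powR_homo; [exact: ltW|exact: normc_ge0|].
      rewrite nG /toC /=.
      have w0 : 0 < normc (x +i* y) ^+ n by rewrite -normc_exp normc_gt0.
      rewrite ler_pdivrMr// [leRHS](_ : _ = normc (g (x +i* y)) *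
         (A * (omega (x +i* y) * normc (x +i* y) ^+ n) / P)); last by field; rewrite gt_eqF.
      rewrite -{1}[normc (g _)]mulr1; apply: ler_wpM2l; first exact: normc_ge0.
      by rewrite ler_pdivlMr// mul1r.
  rewrite ge0_integralZl//; last 2 first.
  - apply/measurable_EFinP.
    by apply: measurable_funS sub _ => //; exact: measurable_Lp_integrand.
  - by move=> w _; rewrite lee_fin powR_ge0.
  rewrite EFinM; apply: lee_wpmul2l => //.
  apply: le_trans HI; apply: ge0_subset_integral => //.
  - by apply/measurable_EFinP; exact: measurable_Lp_integrand.
  - by move=> w _; rewrite lee_fin powR_ge0.
have := HC G p q r (k * I) r0 dG mG HG; rewrite -zE nG => H.
have e1 : (normc (g z) * omega z) `^ pp = (normc (g z) / normc z ^+ n) `^ pp * P `^ pp.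
  rewrite -powRM; [|by rewrite divr_ge0 ?normc_ge0// ltW|exact: ltW].
  by congr (_ `^ _); rewrite /P; field; rewrite gt_eqF.
have e2 : k * P `^ pp = A `^ pp.
  by rewrite /k -powRM//; [rewrite divfK// gt_eqF|exact: ltW].
rewrite e1 mulrA; apply: le_trans (ler_wpM2r (powR_ge0 _ _) H) _.
by rewrite -e2 le_eqVlt; apply/orP; left; apply/eqP; ring.
Qed.

(** What the estimates retain of the class: one-variable data, and the measurability of the weight.
    Monotonicity of [h] is recorded from [r = 0] on, a point outside the derivative conditions of
    [profile]. *)
Definition wdata (R : realType) (omega : R[i] -> R) (h N L T : R -> R) (c : R) : Prop :=
  [/\ profile h N L T c,
      (forall r s : R, 0 <= r -> r < s -> s < 1 -> h r < h s),
      (forall z, disk z -> omega z = expR (- h (normc z))) &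
      measurable_fun (@plane_disk R) (fun q : plane R => omega (toC q))].

Lemma powR_root (R : realType) (p T X K M : R) :
  0 < p -> 0 <= T -> 0 <= X -> 0 <= K -> 0 <= M ->
  T ^+ 2 * X `^ p <= K * M `^ p -> T `^ (2 / p) * X <= K `^ p^-1 * M.
Proof.
move=> p0 T0 X0 K0 M0 H.
have e (Y : R) : 0 <= Y -> (Y `^ p) `^ p^-1 = Y.
  by move=> Y0; rewrite -powRrM divff ?gt_eqF// powRr1.
have ip : 0 <= p^-1 by rewrite invr_ge0 ltW.
have T20 : 0 <= T ^+ 2 by exact: sqr_ge0.
have := powR_homo ip (mulr_ge0 T20 (powR_ge0 _ _)) H.
by rewrite (powRM _ T20 (powR_ge0 _ _)) (powRM _ K0 (powR_ge0 _ _)) !e// -powR_mulrn// -powRrM.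
Qed.

Lemma Ap_props (R : realType) (omega : R[i] -> R) (p : R) (g : R[i] -> R[i]) :
  Ap omega p g -> measurable_fun plane_disk (fun q : plane R => normc (g (toC q))) /\
  forall w, disk w -> hder g w.
Proof. by move=> [[mr mi _] hg]; split => //; exact: measurable_normc_comp. Qed.

Lemma submean_near (R : realType) (omega : R[i] -> R) (h N L T : R -> R) (c p : R) :
  wdata omega h N L T c -> 0 < p ->
  exists2 C, 0 < C & exists2 r0 : R, 1 / 2 < r0 < 1 &
    forall (g : R[i] -> R[i]) (M : R) (z : R[i]),
      Ap omega p g -> 0 <= M -> (Lp_norm omega p g <= M%:E)%E ->
      r0 < normc z < 1 ->
      T (normc z) `^ (2 / p) * (normc (g z) * omega z) <= C * M.
Proof.
move=> [HP hinc hom mo] p0; have [C C0 HC] := weighted_submean p0.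
have [r1 hr1 H1] := profile_near HP; have [r2 hr2 H2] := profile_local HP.
pose A := expR (2 * c + 1); have A0 : 0 < A by exact: expR_gt0.
have pi0 : 0 < (pi : R) := pi_gt0 R.
pose K := 16 * (C * A `^ p * pi).
have K0 : 0 < K by rewrite !mulr_gt0 ?powR_gt0.
exists (K `^ p^-1); first exact: powR_gt0.
exists (Num.max r1 r2); first by rewrite lt_max gt_max; lra.
move=> g M z Ag M0 HM; rewrite gt_max => /andP[/andP[z1 z2] z3].
have [mg dg] := Ap_props Ag.
have [Ts Ts1 Hs] := H1 (normc z) ltac:(by rewrite z1).
have [n Hn] := H2 (normc z) ltac:(by rewrite z2).
set s := normc z in z1 z2 z3 Ts Ts1 Hs Hn *.
have s12 : 1 / 2 < s by clear -z1 hr1; lra.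
have dz : disk z by exact: z3.
have I := Lp_norm_le_integral p0 M0 mo mg HM.
(* Two coordinates moving by [T s / 4] each change the modulus by at most [T s / 2], the range of
   [profile_local]. *)
have r0 : 0 < T s / 4 by rewrite divr_gt0.
have close w : `|complex.Re w - complex.Re z| <= T s / 4 ->
    `|complex.Im w - complex.Im z| <= T s / 4 -> `|normc w - s| <= T s / 2.
  move=> h1 h2; apply: le_trans (normc_lip w z) _.
  apply: le_trans (normc_le1 _) _; rewrite !raddfB /=.
  by clear -h1 h2; lra.
have W w : `|complex.Re w - complex.Re z| <= T s / 4 -> `|complex.Im w - complex.Im z| <= T s / 4 ->
    [/\ disk w, w ^+ n != 0, 0 < omega w &
        omega z * normc z ^+ n <= A * (omega w * normc w ^+ n)].
  move=> h1 h2; have cw := close w h1 h2; have [hw _ _] := Hs _ cw.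
  have dw : disk w by case/andP: hw.
  split => //.
  - rewrite expf_eq0 negb_and; apply/orP; right.
    by apply/eqP => w0; move: hw; rewrite w0 normc0; clear; lra.
  - by rewrite hom// expR_gt0.
  - by rewrite !hom//; apply: Hn.
have := HC omega g z (T s / 4) A _ n r0 A0 mo mg dg W I.
move=> H; apply: powR_root => //; [exact: ltW|by rewrite mulr_ge0 ?normc_ge0// hom// expR_ge0|exact: ltW|].
rewrite (_ : T s ^+ 2 = 16 * (T s / 4) ^+ 2); last by field.
rewrite -mulrA (_ : K * M `^ p = 16 * (C * A `^ p * (pi * M `^ p))); last by rewrite /K; ring.
by rewrite ler_pM2l.
Qed.

Lemma wdata_h_le (R : realType) (omega : R[i] -> R) (h N L T : R -> R) (c r s : R) :
  wdata omega h N L T c -> 0 <= r -> r <= s -> s < 1 -> h r <= h s.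
Proof.
move=> [_ hinc _ _] r0; rewrite le_eqVlt => /predU1P[->//|rs] s1.
by apply: ltW; exact: hinc.
Qed.

(** Away from the boundary the weight lies between positive constants, so the exponent [n = 0] does
    in [weighted_submean]; [C] depends on [rho]. *)
Lemma submean_compact (R : realType) (omega : R[i] -> R) (h N L T : R -> R) (c p rho : R) :
  wdata omega h N L T c -> 0 < p -> 0 <= rho < 1 ->
  exists2 C, 0 < C &
    forall (g : R[i] -> R[i]) (M : R) (z : R[i]),
      Ap omega p g -> 0 <= M -> (Lp_norm omega p g <= M%:E)%E ->
      normc z <= rho -> normc (g z) <= C * M.
Proof.
move=> HW p0 hrho; have [HP hinc hom mo] := HW.
have [C C0 HC] := weighted_submean p0.
(* A square of half side [r] around a point of modulus at most [rho] stays in modulus at most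
   [rho + 2 * r = rho']. *)
pose r := (1 - rho) / 4; have r0 : 0 < r by rewrite /r; lra.
pose rho' := (1 + rho) / 2.
pose A := expR (h rho' - h 0); have A0 : 0 < A by exact: expR_gt0.
have pi0 : 0 < (pi : R) := pi_gt0 R.
pose K := C * A `^ p * pi.
have K0 : 0 < K by rewrite !mulr_gt0 ?powR_gt0.
have e0 : 0 < expR (- h rho) * r `^ (2 / p) by rewrite mulr_gt0 ?expR_gt0 ?powR_gt0.
exists (K `^ p^-1 / (expR (- h rho) * r `^ (2 / p))); first by rewrite divr_gt0// powR_gt0.
move=> g M z Ag M0 HM zr.
have [mg dg] := Ap_props Ag.
have I := Lp_norm_le_integral p0 M0 mo mg HM.
have z1 : normc z < 1 by clear -zr hrho; lra.
have W w : `|complex.Re w - complex.Re z| <= r -> `|complex.Im w - complex.Im z| <= r ->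
    [/\ disk w, w ^+ 0 != 0, 0 < omega w &
        omega z * normc z ^+ 0 <= A * (omega w * normc w ^+ 0)].
  move=> h1 h2.
  have wr : normc w <= rho'.
    have := normcD (w - z) z; rewrite subrK.
    have := normc_le1 (w - z); rewrite !raddfB /= /rho'.
    by move: h1 h2; rewrite /r; clear -zr; lra.
  have w1 : normc w < 1 by move: wr; rewrite /rho'; clear -hrho; lra.
  have rho'1 : rho' < 1 by rewrite /rho'; clear -hrho; lra.
  have dw : disk w by exact: w1.
  split => //.
  - by rewrite expr0 oner_neq0.
  - by rewrite hom// expR_gt0.
  - rewrite !expr0 !mulr1 !hom// -expRD ler_expR.
    have := wdata_h_le HW (normc_ge0 w) wr rho'1.
    have := wdata_h_le HW (lexx 0) (normc_ge0 z) z1.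
    by clear; lra.
have := HC omega g z r A _ 0%N r0 A0 mo mg dg W I.
move=> H.
have oz : expR (- h rho) <= omega z.
  rewrite hom// ler_expR lerN2.
  by apply: (wdata_h_le HW) => //; [exact: normc_ge0|case/andP: hrho].
have oz0 : 0 <= omega z by apply: le_trans oz; exact: expR_ge0.
have := @powR_root _ p r (normc (g z) * omega z) K M p0 (ltW r0)
  (mulr_ge0 (normc_ge0 _) oz0) (ltW K0) M0.
rewrite /K -[in _ <= _ * pi * _]mulrA => /(_ H) H'.
rewrite mulrAC ler_pdivlMr//; apply: le_trans H'.
rewrite mulrCA [leRHS]mulrCA [leLHS]mulrC mulrA.
rewrite [leLHS](_ : _ = r `^ (2 / p) * (normc (g z) * expR (- h rho))); last by ring.
rewrite [leRHS](_ : _ = r `^ (2 / p) * (normc (g z) * omega z)); last by ring.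
apply: ler_wpM2l; first exact: powR_ge0.
by apply: ler_wpM2l; first exact: normc_ge0.
Qed.

(** * Test functions *)

Definition entire_meas (R : realType) (f : R[i] -> R[i]) : Prop :=
  [/\ forall w, hder f w,
      measurable_fun setT (fun q : plane R => complex.Re (f (toC q))) &
      measurable_fun setT (fun q : plane R => complex.Im (f (toC q)))].

Lemma entire_cst (R : realType) (k : R[i]) : entire_meas (fun=> k).
Proof. by split=> [w||]; [exact: hder_cst|exact: measurable_cst|exact: measurable_cst]. Qed.

Lemma entire_id (R : realType) : entire_meas (fun w : R[i] => w).
Proof.
by split=> [w||]; [exact: hder_id|exact: measurable_fst|exact: measurable_snd].
Qed.

Lemma entireD (R : realType) (f g : R[i] -> R[i]) :
  entire_meas f -> entire_meas g -> entire_meas (fun w => f w + g w).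
Proof.
move=> [df rf imf] [dg rg img]; split=> [w||]; first exact: hderD (df w) (dg w).
  rewrite (_ : (fun q => _) =
    (fun q : plane R => complex.Re (f (toC q)) + complex.Re (g (toC q)))).
    exact: measurable_funD.
  by apply/funext => q; rewrite raddfD.
rewrite (_ : (fun q => _) =
    (fun q : plane R => complex.Im (f (toC q)) + complex.Im (g (toC q)))).
  exact: measurable_funD.
by apply/funext => q; rewrite raddfD.
Qed.

Lemma entireM (R : realType) (f g : R[i] -> R[i]) :
  entire_meas f -> entire_meas g -> entire_meas (fun w => f w * g w).
Proof.
move=> [df rf imf] [dg rg img]; split=> [w||]; first exact: hderM (df w) (dg w).
  rewrite (_ : (fun q => _) = (fun q : plane R =>
     complex.Re (f (toC q)) * complex.Re (g (toC q)) -
     complex.Im (f (toC q)) * complex.Im (g (toC q)))).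
    by apply: measurable_funB; exact: measurable_funM.
  by apply/funext => q; case: (f _) => ? ?; case: (g _).
rewrite (_ : (fun q => _) = (fun q : plane R =>
     complex.Re (f (toC q)) * complex.Im (g (toC q)) +
     complex.Im (f (toC q)) * complex.Re (g (toC q)))).
  by apply: measurable_funD; exact: measurable_funM.
by apply/funext => q; case: (f _) => ? ?; case: (g _).
Qed.

Lemma entireX (R : realType) (f : R[i] -> R[i]) (n : nat) :
  entire_meas f -> entire_meas (fun w => f w ^+ n).
Proof.
move=> ef; elim: n => [|n IH]; first exact: entire_cst.
rewrite (_ : (fun w => _) = (fun w => f w * f w ^+ n)); first exact: entireM.
by apply/funext => w; rewrite exprS.
Qed.

Definition geom (R : realType) (K : nat) (A : R[i]) : R[i] :=
  (K%:R^-1)%:C * \sum_(k < K) A ^+ k.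

Lemma entire_geom (R : realType) (f : R[i] -> R[i]) (K : nat) :
  entire_meas f -> entire_meas (fun w => geom K (f w)).
Proof.
move=> ef; rewrite /geom; apply: entireM; first exact: entire_cst.
suff H n : entire_meas (fun w => \sum_(k < n) f w ^+ k) by exact: H.
elim: n => [|n IH].
  rewrite (_ : (fun w => _) = (fun=> 0)); first exact: entire_cst.
  by apply/funext => w; rewrite big_ord0.
rewrite (_ : (fun w => _) = (fun w => \sum_(k < n) f w ^+ k + f w ^+ n)).
  by apply: entireD => //; exact: entireX.
by apply/funext => w; rewrite big_ord_recr.
Qed.

Lemma geom1 (R : realType) (K : nat) : (0 < K)%N -> geom K (1 : R[i]) = 1.
Proof.
move=> K0; rewrite /geom (eq_bigr (fun=> 1)); last by move=> i _; rewrite expr1n.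
rewrite sumr_const card_ord.
have -> : (1 *+ K : R[i]) = (K%:R : R)%:C by rewrite rmorph_nat.
by rewrite -rmorphM /= mulVf// pnatr_eq0 -lt0n.
Qed.

(** Two bounds are added: each term of the mean is at most [mx ^+ K], and the telescoped product
    [(A - 1) * \sum A ^+ k = A ^+ K - 1] is at most [2 * mx ^+ K]. *)
Lemma geom_bound (R : realType) (K : nat) (A : R[i]) : (0 < K)%N ->
  normc (geom K A) * (1 + K%:R * normc (A - 1)) <= 3 * Num.max 1 (normc A) ^+ K.
Proof.
move=> K0; set mx := Num.max 1 (normc A).
have mx1 : 1 <= mx by rewrite le_max lexx.
have mxA : normc A <= mx by rewrite le_max lexx orbT.
have k0 : 0 < K%:R :> R by rewrite ltr0n.
have powle k : (k <= K)%N -> normc A ^+ k <= mx ^+ K.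
  move=> kK; apply: (@le_trans _ _ (mx ^+ k)).
    by apply: lerXn2r; rewrite ?nnegrE ?normc_ge0// (le_trans ler01).
  by rewrite ler_weXn2l.
have S n : (n <= K)%N -> normc (\sum_(k < n) A ^+ k) <= n%:R * mx ^+ K.
  elim: n => [|n IH] nK; first by rewrite big_ord0 normc0 mul0r.
  rewrite big_ord_recr /= -natr1 mulrDl mul1r; apply: le_trans (normcD _ _) _.
  apply: lerD; first by apply: IH; exact: ltnW.
  by rewrite normc_exp; apply: powle; exact: ltnW.
have iE : normc (K%:R^-1)%:C = K%:R^-1 :> R.
  by rewrite normc_real ger0_norm// invr_ge0.
have b1 : normc (geom K A) <= mx ^+ K.
  rewrite /geom normcM iE mulrC ler_pdivrMr// mulrC; exact: S.
have b2 : normc (geom K A) * (K%:R * normc (A - 1)) <= 2 * mx ^+ K.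
  rewrite mulrCA -normcM /geom -mulrA normcM iE mulrA divff ?gt_eqF// mul1r.
  rewrite mulrC -subrX1; apply: le_trans (normcD _ _) _.
  rewrite normcN normc1 normc_exp mulr_natl mulr2n; apply: lerD; first exact: powle.
  by rewrite exprn_ege1.
by rewrite mulrDr mulr1; lra.
Qed.

Lemma integral_atan (R : realType) (a t : R) : 0 < t ->
  (\int[@lebesgue_measure R]_(x in `[(-1)%R, 1%R]) ((1 + ((x - a) / t) ^+ 2)^-1)%:E
    <= (pi * t)%:E)%E.
Proof.
move=> t0; pose F (x : R) := t * atan ((x - a) / t).
have dF (x : R) : is_derive x (1 : R) F ((1 + ((x - a) / t) ^+ 2)^-1).
  have d1 : is_derive x (1 : R) (fun x => (x - a) / t) t^-1.
    have H := is_deriveM (is_deriveB (is_derive_id x (1 : R)) (is_derive_cst a x (1 : R)))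
      (is_derive_cst t^-1 x (1 : R)).
    by move: H; rewrite scaler0 add0r subr0 /GRing.scale /= mulr1.
  have d2 := @is_derive1_comp R atan (fun x => (x - a) / t) x _ _ (is_derive1_atan _) d1.
  have H := is_deriveM (is_derive_cst t x (1 : R)) d2.
  move: H; rewrite scaler0 addr0 /GRing.scale /= mulrCA divff ?gt_eqF// mulr1.
  by [].
have cf : continuous (fun x : R => (1 + ((x - a) / t) ^+ 2)^-1).
  move=> x; apply: cvgV; first by rewrite gt_eqF// ltr_pwDl// sqr_ge0.
  apply: cvgD; first exact: cvg_cst.
  rewrite expr2; under eq_fun do rewrite expr2.
  have h1 : (fun y : R => (y - a) / t) y @[y --> x] --> (x - a) / t.
    by apply: cvgM; [apply: cvgB; [exact: cvg_id|exact: cvg_cst]|exact: cvg_cst].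
  exact: cvgM.
rewrite (@continuous_FTC2 R _ F (-1) 1)//.
- rewrite -EFinB lee_fin /F -mulrBr mulrC ler_wpM2r ?(ltW t0)//.
  have := atan_ltpi2 ((1 - a) / t); have := atan_gtNpi2 ((-1 - a) / t).
  by lra.
- by apply: continuous_subspaceT => x; exact: cf.
- split.
  + by move=> x _; exact: ex_derive.
  + apply: cvg_at_right_filter; apply: differentiable_continuous.
    by apply/derivable1_diffP; have := dF (-1) => ?; exact: ex_derive.
  + apply: cvg_at_left_filter; apply: differentiable_continuous.
    by apply/derivable1_diffP; have := dF 1 => ?; exact: ex_derive.
- by move=> x _; rewrite derive1E; exact: derive_val.
Qed.

(** The derivative of [t * atan ((x - a) / t)], so its integral is at most [pi * t]. The product of
    one such kernel per coordinate majorizes [(1 + |w - a| / t) ^ (-4)] and is integrated by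
    Tonelli's theorem. *)
Definition cauchy_ker (R : realType) (a t x : R) : R := (1 + ((x - a) / t) ^+ 2)^-1.

Lemma cauchy_ker_ge0 (R : realType) (a t x : R) : 0 <= cauchy_ker a t x.
Proof. by rewrite invr_ge0 addr_ge0// sqr_ge0. Qed.

Lemma measurable_cauchy_ker (R : realType) (a t : R) :
  measurable_fun setT (cauchy_ker a t).
Proof.
rewrite (_ : cauchy_ker a t = (fun x => (1 + ((x - a) / t) ^+ 2) `^ (-1))).
  apply: (measurableT_comp (measurable_powR (-1))).
  apply: measurable_funD; first exact: measurable_cst.
  apply: measurable_funX; apply: measurable_funM; last exact: measurable_cst.
  by apply: measurable_funB; [exact: measurable_id|exact: measurable_cst].
by apply/funext => x; rewrite powR_inv1// addr_ge0// sqr_ge0.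
Qed.

Lemma integral_kernel2 (R : realType) (a1 a2 t : R) : 0 < t ->
  (\int[@leb2 R]_(q in plane_disk) (cauchy_ker a1 t q.1 * cauchy_ker a2 t q.2)%:E
    <= ((pi * t) ^+ 2)%:E)%E.
Proof.
move=> t0.
pose U (a : R) : R -> \bar R := (fun x => (cauchy_ker a t x)%:E) \_ `[(-1)%R, 1%R].
have mU a : measurable_fun setT (U a).
  apply/(measurable_restrictT _ (measurable_itv _)); apply/measurable_EFinP.
  exact: measurable_funTS (measurable_cauchy_ker a t).
have U0 a x : (0 <= U a x)%E.
  by rewrite /U patchE; case: ifP => // _; rewrite lee_fin cauchy_ker_ge0.
have IU a : (\int[@lebesgue_measure R]_x U a x <= (pi * t)%:E)%E.
  by rewrite /U -integral_mkcond; exact: integral_atan.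
pose f (q : plane R) : \bar R := (U a1 q.1 * U a2 q.2)%E.
have mf : measurable_fun setT f.
  by apply: emeasurable_funM; [exact: (measurableT_comp (mU a1) measurable_fst)|
     exact: (measurableT_comp (mU a2) measurable_snd)].
have f0 q : (0 <= f q)%E by exact: mule_ge0.
apply: (@le_trans _ _ (\int[@leb2 R]_q f q)%E).
  rewrite integral_mkcond; apply: ge0_le_integral => //.
  - move=> q _; rewrite patchE; case: ifP => // _.
    by rewrite lee_fin mulr_ge0 ?cauchy_ker_ge0.
  - apply/(measurable_restrictT _ (@measurable_plane_disk R)); apply/measurable_EFinP.
    apply: measurable_funTS; apply: measurable_funM.
      exact: (measurableT_comp (measurable_cauchy_ker a1 t) measurable_fst).
    exact: (measurableT_comp (measurable_cauchy_ker a2 t) measurable_snd).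
  - move=> [x y] _; rewrite patchE; case: ifPn => [/set_mem /= dq|_]; last exact: f0.
    have n1 : normc (x +i* y) < 1 by exact: dq.
    have hx := le_lt_trans (normc_Re (x +i* y)) n1.
    have hy := le_lt_trans (normc_Im (x +i* y)) n1.
    move: hx hy; rewrite /= !ltr_norml => /andP[? ?] /andP[? ?].
    rewrite /f /U /= !patchE !mem_set ?EFinM//= in_itv /=; apply/andP; split; exact: ltW.
rewrite tonelli12// /f /=.
apply: (@le_trans _ _ (\int[@lebesgue_measure R]_x ((pi * t)%:E * U a1 x))%E).
  apply: ge0_le_integral => //.
  - by move=> x _; apply: integral_ge0 => y _; exact: mule_ge0.
  - exact: (measurable_fun_fubini_tonelli_F _ mf).
  - by apply: emeasurable_funM; [exact: measurable_cst|exact: mU].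
  - move=> x _; rewrite ge0_integralZl//; last exact: mU.
    by rewrite muleC; apply: lee_wpmul2r.
rewrite ge0_integralZl//; last 2 first.
- exact: mU.
- by rewrite lee_fin mulr_ge0 ?pi_ge0// ltW.
rewrite [leRHS](_ : _ = ((pi * t)%:E * (pi * t)%:E)%E); last by rewrite -EFinM.
apply: lee_wpmul2l; last exact: IU.
by rewrite lee_fin mulr_ge0 ?pi_ge0// ltW.
Qed.

(* [(w / a) ^ n] balances the radial weight around [|w| = |a|]; the [m]-th power of
   the mean of [(w / a) ^ k] over [k < K] concentrates it at [a] at scale [1 / K]. *)
Definition peak (R : realType) (n K m : nat) (a b w : R[i]) : R[i] :=
  (w * a^-1) ^+ n * geom K (w * a^-1) ^+ m * (w - b).

Lemma entire_peak (R : realType) (n K m : nat) (k a b : R[i]) :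
  entire_meas (fun w => k * peak n K m a b w).
Proof.
have eA : entire_meas (fun w : R[i] => w * a^-1).
  by apply: entireM; [exact: entire_id|exact: entire_cst].
apply: entireM; first exact: entire_cst.
apply: entireM; last by apply: entireD; [exact: entire_id|exact: entire_cst].
apply: entireM; first exact: entireX.
by apply: entireX; exact: entire_geom.
Qed.

Lemma peak_at (R : realType) (n K m : nat) (a b : R[i]) :
  (0 < K)%N -> a != 0 -> peak n K m a b a = a - b.
Proof. by move=> K0 a0; rewrite /peak divff// geom1// !expr1n !mul1r. Qed.

(** Each of the [m.+1] geometric factors gains [1 / (1 + d)], with [d = |w - a| / t], because
    [K >= 1 / t] and [|a| <= 1]. One gain is spent on [|w - b| <= (1 + d) * (t + |a - b|)]; [m]
    remain. *)
Lemma peak_bound (R : realType) (n K m : nat) (a b w : R[i]) (t Ww Wa C : R) :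
  (0 < K)%N -> t^-1 <= K%:R -> 0 < t -> a != 0 -> normc a <= 1 -> 0 <= Ww ->
  (normc w / normc a) ^+ n * Num.max 1 (normc w / normc a) ^+ (m.+1 * K) * Ww <= C * Wa ->
  normc (peak n K m.+1 a b w) * Ww * (1 + normc (w - a) / t) ^+ m <=
    3 ^+ m.+1 * C * Wa * (t + normc (a - b)).
Proof.
move=> K0 tK t0 a0 a1 W0 HW; set d := normc (w - a) / t.
have na : 0 < normc a by exact: normc_gt0.
have d0 : 0 <= d by rewrite divr_ge0 ?normc_ge0// ltW.
have nA : normc (w * a^-1) = normc w / normc a by rewrite normcM normcV.
set mx := Num.max 1 (normc w / normc a) in HW.
have mx1 : 1 <= mx by rewrite le_max lexx.
have g1 : normc (geom K (w * a^-1)) * (1 + d) <= 3 * mx ^+ K.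
  apply: le_trans (_ : normc (geom K (w / a)) * (1 + K%:R * normc (w / a - 1)) <= _); last first.
    by rewrite /mx -nA; exact: geom_bound.
  apply: ler_wpM2l; first exact: normc_ge0.
  rewrite lerD2l /d mulrC; apply: ler_pM => //; [by rewrite invr_ge0 ltW|exact: normc_ge0|].
  have -> : w - a = (w / a - 1) * a by rewrite mulrBl mul1r divfK.
  by rewrite normcM ler_piMr// normc_ge0.
have g2 : normc (geom K (w * a^-1)) ^+ m.+1 * (1 + d) ^+ m.+1 <= 3 ^+ m.+1 * mx ^+ (m.+1 * K).
  rewrite -exprMn mulnC exprM -exprMn; apply: lerXn2r; rewrite ?nnegrE.
  - by rewrite mulr_ge0 ?normc_ge0// addr_ge0.
  - by rewrite mulr_ge0// exprn_ge0// (le_trans ler01).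
  - exact: g1.
have wb : normc (w - b) <= (1 + d) * (t + normc (a - b)).
  have -> : w - b = (w - a) + (a - b) by rewrite addrA subrK.
  apply: le_trans (normcD _ _) _.
  have : normc (w - a) = d * t by rewrite /d divfK// gt_eqF.
  have : 0 <= d * normc (a - b) by rewrite mulr_ge0 ?normc_ge0.
  by move=> h1 ->; rewrite mulrDl mul1r mulrDr; lra.
rewrite /peak !normcM !normc_exp nA.
set X := (_ / _) ^+ n; set g := normc (geom _ _).
have X0 : 0 <= X by rewrite exprn_ge0// divr_ge0 ?normc_ge0// ltW.
have tb : 0 <= t + normc (a - b) by rewrite addr_ge0 ?normc_ge0// ltW.
have g0 : 0 <= g by exact: normc_ge0.
apply: (@le_trans _ _ (X * g ^+ m.+1 * ((1 + d) * (t + normc (a - b))) * Ww * (1 + d) ^+ m)).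
  apply: ler_wpM2r; first by rewrite exprn_ge0// addr_ge0.
  apply: ler_wpM2r => //.
  by apply: ler_wpM2l => //; rewrite mulr_ge0// exprn_ge0.
rewrite [leLHS](_ : _ = X * (g ^+ m.+1 * (1 + d) ^+ m.+1) * Ww * (t + normc (a - b))); last first.
  by rewrite [(1 + d) ^+ m.+1]exprS; ring.
apply: ler_wpM2r => //.
apply: (@le_trans _ _ (X * (3 ^+ m.+1 * mx ^+ (m.+1 * K)) * Ww)).
  by apply: ler_wpM2r => //; apply: ler_wpM2l.
rewrite [leLHS](_ : _ = 3 ^+ m.+1 * (X * mx ^+ (m.+1 * K) * Ww)); last by ring.
by rewrite -[leRHS]mulrA; apply: ler_wpM2l => //; exact: exprn_ge0.
Qed.

Lemma ker_ge (R : realType) (a w : R[i]) (t : R) : 0 < t ->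
  ((1 + normc (w - a) / t) ^+ 4)^-1 <=
  cauchy_ker (complex.Re a) t (complex.Re w) * cauchy_ker (complex.Im a) t (complex.Im w).
Proof.
move=> t0; set d := normc (w - a) / t.
have d0 : 0 <= d by rewrite divr_ge0 ?normc_ge0// ltW.
have B (x : R) : `|x| <= normc (w - a) -> 1 + (x / t) ^+ 2 <= (1 + d) ^+ 2.
  move=> hx; have : (x / t) ^+ 2 <= d ^+ 2.
    rewrite -real_normK ?num_real//; apply: lerXn2r; rewrite ?nnegrE//.
    by rewrite normrM normfV (gtr0_norm t0) ler_wpM2r// invr_ge0 ltW.
  by rewrite sqrrD expr1n mul1r mulr2n; lra.
have P (x : R) : 0 < 1 + (x / t) ^+ 2 by rewrite ltr_pwDl// sqr_ge0.
have d1 : 0 < 1 + d by rewrite ltr_pwDl.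
rewrite /cauchy_ker -invfM lef_pV2 ?posrE ?mulr_gt0 ?exprn_gt0 ?P//.
rewrite (_ : (1 + d) ^+ 4 = (1 + d) ^+ 2 * (1 + d) ^+ 2); last by rewrite -exprD.
apply: ler_pM; try exact: ltW.
  by apply: B; rewrite -raddfB; exact: normc_Re.
by apply: B; rewrite -raddfB; exact: normc_Im.
Qed.

(** Since [m * p >= 4], the power [p] of the decay is below [(1 + d) ^ (-4)], whose integral is at
    most [(pi * t) ^ 2]. The normalization [t ^ (- (2 / p))] contributes [t ^ (-2)] and cancels the
    scale. *)
Lemma peak_norm (R : realType) (omega : R[i] -> R) (p C t : R) (m : nat) (a : R[i])
    (f : R[i] -> R[i]) :
  0 < p -> 0 < C -> 0 < t -> 4 <= m%:R * p ->
  measurable_fun plane_disk (fun q : plane R => omega (toC q)) ->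
  (forall w, disk w -> 0 <= omega w) ->
  entire_meas f ->
  (forall w, disk w ->
     normc (f w) * omega w * (1 + normc (w - a) / t) ^+ m <= C * t `^ (- (2 / p))) ->
  (Lp_norm omega p f <= ((C `^ p * pi) `^ p^-1)%:E)%E.
Proof.
move=> p0 C0 t0 mp mo o0 [_ mr mi] H.
have pi0 : 0 < (pi : R) := pi_gt0 R.
have mf : measurable_fun plane_disk (fun q : plane R => normc (f (toC q))).
  by apply: measurable_normc_comp; exact: measurable_funTS.
have mpd := @measurable_plane_disk R.
have -> : C `^ p * pi = (C `^ p * t ^- 2 * (pi * t) ^+ 2) / pi.
  have pn : (pi : R) != 0 by rewrite gt_eqF.
  have tn : t != 0 by rewrite gt_eqF.
  have e (q A : R) : q != 0 -> A * q = A * t ^- 2 * (q * t) ^+ 2 / q.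
    by move=> q0; field; rewrite q0 tn.
  exact: e.
apply: Lp_norm_ge_integral => //.
have k0 : 0 <= C `^ p * t ^- 2 by rewrite mulr_ge0 ?powR_ge0// invr_ge0 sqr_ge0.
have mk : measurable_fun plane_disk (fun q : plane R =>
    (cauchy_ker (complex.Re a) t q.1 * cauchy_ker (complex.Im a) t q.2)%:E).
  apply/measurable_EFinP; apply: measurable_funTS; apply: measurable_funM.
    exact: (measurableT_comp (measurable_cauchy_ker _ t) measurable_fst).
  exact: (measurableT_comp (measurable_cauchy_ker _ t) measurable_snd).
apply: (@le_trans _ _ (\int[@leb2 R]_(q in plane_disk) ((C `^ p * t ^- 2)%:E *
    (cauchy_ker (complex.Re a) t q.1 * cauchy_ker (complex.Im a) t q.2)%:E))%E).
  apply: ge0_le_integral => //.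
  - by move=> w _; rewrite lee_fin powR_ge0.
  - by apply/measurable_EFinP; exact: measurable_Lp_integrand.
  - by apply: measurable_funeM.
  - move=> q dq; rewrite -EFinM lee_fin /Lp_integrand.
    have dw : disk (toC q) by exact: dq.
    set w := toC q in dw *; pose d := normc (w - a) / t.
    have d0 : 0 <= d by rewrite divr_ge0 ?normc_ge0// ltW.
    have d1 : 0 < 1 + d by rewrite ltr_pwDl.
    apply: (@le_trans _ _ (C `^ p * t ^- 2 * ((1 + d) ^+ 4)^-1)); last first.
      apply: ler_wpM2l => //; exact: (ker_ge a w t0).
    have h1 : normc (f w) * omega w <= C * t `^ (- (2 / p)) * (1 + d) `^ (- m%:R).
      rewrite [(1 + d) `^ _]powRN (powR_mulrn _ (ltW d1)).
      by rewrite ler_pdivlMr ?exprn_gt0//; exact: H.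
    apply: le_trans (powR_homo (ltW p0) _ h1) _.
      by rewrite mulr_ge0 ?normc_ge0// o0.
    rewrite !powRM ?mulr_ge0 ?powR_ge0 ?(ltW C0)// -!powRrM.
    rewrite (_ : - (2 / p) * p = - 2); last by field; rewrite gt_eqF.
    rewrite powR_invn; last exact: ltW.
    apply: ler_wpM2l => //.
    rewrite mulNr powRN lef_pV2 ?posrE ?powR_gt0 ?exprn_gt0//.
    rewrite -powR_mulrn; last exact: ltW.
    by apply: ler_powR; [rewrite lerDl|exact: mp].
rewrite ge0_integralZl//; last first.
  by move=> w _; rewrite lee_fin mulr_ge0 ?cauchy_ker_ge0.
rewrite [leRHS](_ : _ = ((C `^ p * t ^- 2)%:E * ((pi * t) ^+ 2)%:E)%E); last by rewrite -EFinM.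
by apply: lee_wpmul2l; [rewrite lee_fin|exact: integral_kernel2].
Qed.

(** The last clause is the quantitative form of convergence to 0: for [w] fixed and [|a|] tending to
    1, the distance [|w - a|] stays away from 0 while [T |a|] tends to 0. *)
Lemma test_function (R : realType) (omega : R[i] -> R) (h N L T : R -> R) (c p : R) :
  wdata omega h N L T c -> 0 < p ->
  exists (C0 : R) (M : nat), 0 < C0 /\ exists2 r0 : R, 1 / 2 < r0 < 1 &
    forall a b : R[i], r0 < normc a < 1 ->
    exists f : R[i] -> R[i],
      [/\ Ap omega p f, (Lp_norm omega p f <= C0%:E)%E, f b = 0,
        T (normc a) `^ (2 / p) * (normc (f a) * omega a) =
          normc (a - b) / (T (normc a) + normc (a - b)) &
        forall w, disk w -> normc (f w) * omega w * normc (w - a) ^+ M <= C0 * T (normc a)].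
Proof.
move=> [HP hinc hom mo] p0.
(* [m >= 6 / p + 1] serves twice: [m * p >= 4] for the norm, and [m - 2 / p >= 1] for the factor [T]
   in the pointwise decay. *)
have p6 : 0 <= 6 / p + 1 by rewrite addr_ge0// divr_ge0// ltW.
have [m [_ hm _]] := nat_above p6.
have [C1 [C10 [r1 hr1 H1]]] := profile_test m.+1 HP.
have [r2 hr2 H2] := profile_lip HP ltr01.
have pi0 : 0 < (pi : R) := pi_gt0 R.
pose C' : R := 3 ^+ m.+1 * C1.
have C'0 : 0 < C' by rewrite mulr_gt0// exprn_gt0.
pose C2 := (C' `^ p * pi) `^ p^-1.
exists (C' + C2), m; split; first by rewrite ltr_pwDl// powR_ge0.
exists (Num.max r1 r2); first by rewrite lt_max gt_max; lra.
move=> a b; rewrite gt_max => /andP[/andP[s1 s2] s_1].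
set s := normc a in s1 s2 s_1 *.
have [Ts Ts1 _ _] := H2 s ltac:(by rewrite s2).
have [n [K [K0 TK HK]]] := H1 s ltac:(by rewrite s1).
have s0 : 0 < s by clear -s1 hr1; lra.
have a0 : a != 0 by apply/eqP => a0; move: s0; rewrite /s a0 normc0 ltxx.
have da : disk a by exact: s_1.
have oa : 0 < omega a by rewrite hom// expR_gt0.
have tb : 0 < T s + normc (a - b) by rewrite ltr_pwDl// normc_ge0.
(* The inverse of the factors [omega a * (T s + |a - b|)] left by [peak_bound], times the scale that
   [peak_norm] expects. *)
pose k := T s `^ (- (2 / p)) / (omega a * (T s + normc (a - b))).
have k0 : 0 < k by rewrite divr_gt0 ?powR_gt0// mulr_gt0.
pose f (w : R[i]) : R[i] := k%:C * peak n K m.+1 a b w.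
have ef : entire_meas f by exact: entire_peak.
have fE w : normc (f w) = k * normc (peak n K m.+1 a b w).
  by rewrite /f normcM normc_real gtr0_norm.
have B w : disk w -> normc (f w) * omega w * (1 + normc (w - a) / T s) ^+ m <= C' * T s `^ (- (2 / p)).
  move=> dw.
  have ow : 0 <= omega w by rewrite hom// expR_ge0.
  have HW : (normc w / normc a) ^+ n * Num.max 1 (normc w / normc a) ^+ (m.+1 * K) * omega w <= C1 * omega a.
    by rewrite !hom//; apply: HK; rewrite normc_ge0.
  have := peak_bound b K0 TK Ts a0 (ltW s_1) ow HW.
  move=> /(ler_wpM2l (ltW k0)); rewrite -/C'.
  rewrite fE [leRHS](_ : _ = C' * T s `^ (- (2 / p))); last first.
    by rewrite /k; field; rewrite !gt_eqF.
  by rewrite !mulrA.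
have Nf : (Lp_norm omega p f <= C2%:E)%E.
  apply: (@peak_norm _ _ _ C' (T s) m a) => //.
  - have : 6 <= (m%:R - 1) * p by rewrite -ler_pdivrMr//; clear -hm; lra.
    by clear -p0; lra.
  - by move=> w dw; rewrite hom// expR_ge0.
exists f; split.
- have [df mr mi] := ef; split; last by move=> w _; exact: df.
  split; [exact: measurable_funTS|exact: measurable_funTS|].
  exact: le_lt_trans Nf (ltry _).
- by apply: (le_trans Nf); rewrite lee_fin lerDr ltW.
- by rewrite /f /peak subrr !mulr0.
- rewrite fE peak_at// /k powRN; field.
  by rewrite !gt_eqF// powR_gt0.
- move=> w dw.
  have d0 : 0 <= normc (w - a) / T s by rewrite divr_ge0 ?normc_ge0// ltW.
  have fo : 0 <= normc (f w) * omega w by rewrite mulr_ge0 ?normc_ge0// hom// expR_ge0.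
  apply: (@le_trans _ _ (C' * T s `^ (- (2 / p)) * T s ^+ m)).
    have := ler_wpM2r (exprn_ge0 m (ltW Ts)) (B w dw); apply: le_trans.
    rewrite -[leRHS]mulrA; apply: ler_wpM2l => //; rewrite -exprMn.
    apply: lerXn2r; rewrite ?nnegrE ?normc_ge0//.
      by rewrite mulr_ge0 ?addr_ge0// ltW.
    by rewrite mulrDl mul1r divfK ?gt_eqF// lerDr ltW.
  rewrite -mulrA; apply: (@le_trans _ _ (C' * T s)); last first.
    by apply: ler_wpM2r; [exact: ltW|rewrite lerDl powR_ge0].
  apply: ler_wpM2l; first exact: ltW.
  rewrite -(powR_mulrn m (ltW Ts)) -gt0_powRD//.
  rewrite -[leRHS](powRr1 (ltW Ts)).
  apply: ger_powR; first by rewrite Ts ltW.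
  have : 0 <= 4 / p by rewrite divr_ge0// ltW.
  by move: hm; clear; lra.
Qed.

(** * The distance of tau *)

Definition segment (R : realType) (a b : R[i]) (t : R) : R[i] :=
  (complex.Re a + t * (complex.Re b - complex.Re a)) +i*
  (complex.Im a + t * (complex.Im b - complex.Im a)).

Lemma is_derive_affine (R : realType) (x y t : R) :
  is_derive t (1 : R) (fun t => x + t * y) y.
Proof.
have H := is_deriveD (is_derive_cst x t (1 : R))
  (is_deriveM (is_derive_id t (1 : R)) (is_derive_cst y t (1 : R))).
by move: H; rewrite scaler0 !add0r /GRing.scale /= mulr1.
Qed.

Lemma C1_affine (R : realType) (a b x y : R) : C1_on a b (fun t => x + t * y).
Proof.
exists (fun=> y); first by apply: continuous_subspaceT => t; exact: cst_continuous.
move=> t _; apply: cvg_near_cst.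
have : \forall s \near t^', s != t by exact: nbhs_dnbhs_neq.
apply: filterS => s st _; rewrite opprD addrACA subrr add0r -mulrBl mulrAC.
by rewrite divff ?mul1r// subr_eq0.
Qed.

Lemma speed_segment (R : realType) (a b : R[i]) (t : R) :
  speed (segment a b) t = normc (b - a).
Proof.
rewrite /speed /segment /=.
rewrite !derive1E.
have H x y := @derive_val _ _ _ _ _ _ _ (@is_derive_affine R x y t).
by rewrite !H; case: a; case: b.
Qed.

Lemma curve_segment (R : realType) (a b : R[i]) :
  (forall t, 0 <= t <= 1 -> disk (segment a b t)) -> curve a b (segment a b).
Proof.
move=> D; split.
- exists 1%N, (fun i => i%:R); split => // i; rewrite ltnS leqn0 => /eqP ->.
  by split; [exact: ltr01|exact: C1_affine|exact: C1_affine].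
- by move=> t; rewrite in_itv /=; exact: D.
- by rewrite /segment !mul0r !addr0; case: a {D}.
- by rewrite /segment !mul1r !addrA !(addrC _ (complex.Re b)) !(addrC _ (complex.Im b)) !addrK; case: b {D}.
Qed.

Lemma tau_length_ge0 (R : realType) (tau : R[i] -> R) (a b : R[i]) (gamma : R -> R[i]) :
  (forall z, disk z -> 0 < tau z) -> curve a b gamma -> 0 <= tau_length tau gamma.
Proof.
move=> tau0 [_ D _ _]; apply: Rintegral_ge0 => t ht.
by apply: divr_ge0; [exact: normc_ge0|apply: ltW; apply: tau0; exact: D].
Qed.

Lemma d_tau_ge0 (R : realType) (tau : R[i] -> R) (a b : R[i]) :
  (forall z, disk z -> 0 < tau z) -> 0 <= d_tau tau a b.
Proof.
move=> tau0; rewrite /d_tau; set S := [set _ | _ in _].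
(* If no curve joins the points, [inf] takes its default value 0. *)
have [S0|/set0P S0] := eqVneq S set0; first by rewrite S0 inf0.
by apply: lb_le_inf => // _ [gamma Cg <-]; exact: tau_length_ge0 Cg.
Qed.

Lemma d_tau_le (R : realType) (tau : R[i] -> R) (a b : R[i]) (k : R) :
  (forall z, disk z -> 0 < tau z) ->
  (forall q : R * R, disk (toC q) -> differentiable (tau \o @toC R) q) ->
  0 < k ->
  (forall t, 0 <= t <= 1 -> disk (segment a b t) /\ k <= tau (segment a b t)) ->
  d_tau tau a b <= normc (a - b) / k.
Proof.
move=> tau0 dtau k0 H.
have C : curve a b (segment a b) by apply: curve_segment => t /H[].
apply: (@le_trans _ _ (tau_length tau (segment a b))).
  apply: ge_inf; last by exists (segment a b).
  by exists 0 => _ [gamma Cg <-]; exact: tau_length_ge0 Cg.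
rewrite -opprB normcN.
rewrite [leRHS](_ : _ = sint 0 1 (fun=> normc (b - a) / k)); last first.
  by rewrite sint_cst// subr0 mulr1.
rewrite /tau_length -/(sint 0 1 _).
apply: sint_le; last 2 first.
- exact: cont_seg_cst.
- move=> t ht; have [_ kt] := H t ht; rewrite speed_segment.
  by apply: ler_wpM2l; [exact: normc_ge0|rewrite lef_pV2 ?posrE// (lt_le_trans k0)].
move=> t ht; have [dt kt] := H t ht.
rewrite (_ : (fun t => _) = (fun t => normc (b - a) / tau (segment a b t))); last first.
  by apply/funext => s; rewrite speed_segment.
apply: cvgM; first exact: cvg_cst.
apply: cvgV; first by rewrite gt_eqF// (lt_le_trans k0).
pose q (s : R) : R * R := (complex.Re a + s * (complex.Re b - complex.Re a),
  complex.Im a + s * (complex.Im b - complex.Im a)).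
have cA (x y : R) : {for t, continuous (fun s : R => x + s * y)}.
  apply: differentiable_continuous; apply/derivable1_diffP.
  by have := is_derive_affine x y t => ?; exact: ex_derive.
have cq : {for t, continuous q}.
  exact: (cvg_pair (cA (complex.Re a) (complex.Re b - complex.Re a))
                   (cA (complex.Im a) (complex.Im b - complex.Im a))).
have ct : {for q t, continuous (tau \o @toC R)}.
  by apply: differentiable_continuous; exact: dtau.
exact: (cvg_comp q (tau \o @toC R) cq ct).
Qed.

Lemma rho_tau_ge0 (R : realType) (tau : R[i] -> R) (a b : R[i]) :
  (forall z, disk z -> 0 < tau z) -> 0 <= rho_tau tau a b <= 1.
Proof.
move=> tau0; have d0 := d_tau_ge0 a b tau0.
rewrite /rho_tau subr_ge0 -expR0 ler_expR oppr_le0 d0 /=.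
by rewrite lerBlDr lerDl expR_ge0.
Qed.

(** With [t = tau |w|] and [d = |a - b|]: if [d > t / 2], the right-hand side exceeds 1. Otherwise
    [tau >= t / 2] along the segment, so [rho_tau <= d_tau <= 2 * d / t <= 3 * d / (t + d)]. Letting
    [w] be either end point serves both maps without invoking symmetry of [d_tau]. *)
Lemma rho_tau_le (R : realType) (tau : R[i] -> R) (h N L : R -> R) (c : R) :
  profile h N L (fun t => tau t%:C) c ->
  (forall z, disk z -> 0 < tau z) ->
  (forall z, disk z -> tau z = tau (normc z)%:C) ->
  (forall q : R * R, disk (toC q) -> differentiable (tau \o @toC R) q) ->
  exists2 r0 : R, 1 / 2 < r0 < 1 & forall a b w : R[i], disk a -> disk b ->
    w = a \/ w = b -> r0 < normc w < 1 ->
    rho_tau tau a b <= 3 * (normc (a - b) / (tau (normc w)%:C + normc (a - b))).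
Proof.
move=> HP tau0 tauE dtau; have [r0 hr0 H] := profile_near HP; exists r0 => //.
move=> a b w da db wab hw; set s := normc w in hw *; set d := normc (a - b).
have [Ts _ Hs] := H s hw; set t := tau s%:C in Ts Hs *.
have d0 : 0 <= d by exact: normc_ge0.
have [rho0 rho1] := andP (@rho_tau_ge0 _ tau a b tau0).
have [dt|td] := leP d (t / 2); last first.
  apply: (le_trans rho1); rewrite mulrA ler_pdivlMr; last by lra.
  by lra.
have dle : d_tau tau a b <= d / (t / 2).
  apply: d_tau_le => //; first by rewrite divr_gt0.
  move=> u hu.
  have cl : normc (segment a b u - w) <= d.
    have [->|->] := wab.
      have -> : segment a b u - a = u%:C * (b - a).
        by rewrite /segment; case: (a) => ? ?; case: (b) => ? ?; apply/eqP;
          rewrite eq_complex /=; apply/andP; split; apply/eqP; ring.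
      rewrite normcM normc_real ger0_norm; last by case/andP: hu.
      rewrite -opprB normcN -/d; apply: ler_piMl => //; by case/andP: hu.
    have -> : segment a b u - b = (1 - u)%:C * (a - b).
      by rewrite /segment; case: (a) => ? ?; case: (b) => ? ?; apply/eqP;
        rewrite eq_complex /=; apply/andP; split; apply/eqP; ring.
    have /andP[u0 u1] := hu.
    rewrite normcM normc_real ger0_norm ?subr_ge0// -/d.
    by apply: ler_piMl => //; rewrite gerBl.
  have nl : `|normc (segment a b u) - s| <= t / 2.
    by apply: le_trans (normc_lip _ _) _; exact: le_trans dt.
  have [h1 /andP[h2 _] _] := Hs _ nl.
  have ds : disk (segment a b u) by case/andP: h1.
  by split => //; rewrite tauE.
apply: (@le_trans _ _ (d / (t / 2))).
  apply: le_trans dle; rewrite /rho_tau.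
  by have := expR_ge1Dx (- d_tau tau a b); lra.
rewrite mulrCA; apply: ler_wpM2l => //.
rewrite [leRHS](_ : _ = ((t + d) / 3)^-1); last by rewrite invfM invrK mulrC.
by rewrite lef_pV2 ?posrE; lra.
Qed.

(** * One-sided estimates *)

(** [1 + k * Y <= A * (1 + Y / (2 * q)) <= A * expR (Y / (2 * q))]; the power [2 * q] turns the
    exponential into [expR Y]. *)
Lemma log_absorb (R : realType) (k q : R) : 0 <= k -> 0 < q ->
  exists2 D, 0 < D & forall Y, 0 <= Y -> ((1 + k * Y) `^ q) ^+ 2 <= D * expR Y.
Proof.
move=> k0 q0; pose A := 1 + 2 * q * k.
have A0 : 0 < A by rewrite ltr_pwDl// !mulr_ge0// ltW.
exists ((A `^ q) ^+ 2); first by rewrite exprn_gt0// powR_gt0.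
move=> Y Y0.
have Y2 : expR Y = (expR (Y / (2 * q)) `^ q) ^+ 2.
  rewrite -expRM (_ : Y / (2 * q) * q = Y / 2); last by field; rewrite gt_eqF.
  by rewrite -expRM_natl; congr expR; field.
rewrite Y2 -exprMn -powRM ?expR_ge0 ?(ltW A0)//.
apply: lerXn2r; rewrite ?nnegrE ?powR_ge0//.
apply: powR_homo; [exact: ltW|by rewrite addr_ge0// mulr_ge0|].
apply: (@le_trans _ _ (A * (1 + Y / (2 * q)))).
  rewrite /A (_ : _ * (_ + _) = 1 + k * Y + (2 * q * k + Y / (2 * q))); last first.
    by field; rewrite gt_eqF.
  have q2 : 0 <= 2 * q by rewrite mulr_ge0// ltW.
  by rewrite lerDl; apply: addr_ge0; [exact: mulr_ge0|exact: divr_ge0].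
by rewrite ler_pM2l// expR_ge1Dx.
Qed.

(** If [T] drops below half of [T r], its small Lipschitz constant forces [s - r] to be a large
    multiple of [T r]; [profile_jump] then makes [h s - h r] exceed [- ln e0]. *)
Lemma profile_deep (R : realType) (h N L T : R -> R) (c e0 : R) :
  profile h N L T c -> 0 < e0 -> exists2 r0 : R, 1 / 2 < r0 < 1 &
  forall r s : R, r0 < r -> r <= s -> s < 1 ->
    T r <= 2 * T s \/ expR (h r - h s) <= e0.
Proof.
move=> HP e00; have [c0 _ _ _ _] := HP.
pose E := `|ln e0| + 1; have E0 : 0 < E by rewrite ltr_wpDl.
have d0 : 0 < 1 / (32 * c * E) by rewrite divr_gt0// !mulr_gt0.
have [r1 hr1 H1] := profile_lip HP d0.
have [r2 hr2 H2] := profile_jump HP.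
exists (Num.max r1 r2); first by rewrite lt_max gt_max; lra.
move=> r s; rewrite gt_max => /andP[rr1 rr2] rs s1.
have [Tr _ _ /(_ s ltac:(lra))] := H1 r ltac:(lra).
rewrite ler_norml (ger0_norm (_ : 0 <= s - r)) ?subr_ge0// => /andP[Ts _].
have [|Trs] := leP (T r) (2 * T s); [by left|right].
have j := H2 r s rr2 rs s1.
have T2 : T r / 2 <= (s - r) / (32 * c * E).
  by move: Ts; rewrite mulrC mul1r; clear -Trs; lra.
have : E <= h s - h r.
  apply: le_trans j; rewrite ler_pdivlMr ?mulr_gt0//.
  move: T2; rewrite ler_pdivlMr ?mulr_gt0//.
  by rewrite (_ : E * _ = T r / 2 * (32 * c * E)) //; field.
move=> hE; rewrite -[leRHS]lnK ?posrE// ler_expR.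
by have := ler_norm (- ln e0); rewrite normrN; move: hE; rewrite /E; clear; lra.
Qed.

(* Let [X = omega z / omega a]. Point evaluation at [z] gives
   [rho * X <= C * M * (T |a| / T |z|) `^ (2 / p)]. If [|z| < |a|], the quotient of
   the [T]s is at most [1 + C * ln X], so [(rho * X) ^ 2 <= C * M ^ 2 * X] since
   powers of logarithms are absorbed by [X]. *)
Lemma core_estimate (R : realType) (omega : R[i] -> R) (h N L T : R -> R) (c p : R) :
  wdata omega h N L T c -> 0 < p ->
  exists2 D, 0 < D & forall e0, 0 < e0 -> exists2 r0 : R, 1 / 2 < r0 < 1 &
    forall (z a : R[i]) (g : R[i] -> R[i]) (M kap rho : R),
      r0 < normc z < 1 -> r0 < normc a < 1 ->
      Ap omega p g -> 0 <= M -> (Lp_norm omega p g <= M%:E)%E ->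
      T (normc a) `^ (2 / p) * (normc (g z) * omega a) = kap ->
      0 <= rho <= 1 -> rho <= 3 * kap ->
      rho ^+ 2 * (omega z / omega a) <= e0 + D * (M + M ^+ 2).
Proof.
move=> HW p0; have [HP hinc hom mo] := HW; have [c0 _ _ HT _] := HP.
pose q := 2 / p; have q0 : 0 < q by rewrite divr_gt0.
have [C C0 [r1 hr1 H1]] := submean_near HW p0.
have k0 : 0 <= 16 * c by rewrite mulr_ge0// ltW.
have [D1 D10 HD1] := log_absorb k0 q0.
have [r2 hr2 H2] := profile_tau_ratio HP.
pose E1 := 3 * (2 `^ q * C); pose E2 := 9 * (C ^+ 2 * D1).
have E10 : 0 < E1 by rewrite !mulr_gt0// powR_gt0.
have E20 : 0 < E2 by rewrite !mulr_gt0// exprn_gt0.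
exists (E1 + E2); first exact: addr_gt0.
move=> e0 e00; have [r3 hr3 H3] := profile_deep HP e00.
exists (Num.max r1 (Num.max r2 r3)); first by rewrite !lt_max !gt_max; lra.
move=> z a g M kap rho; rewrite !gt_max => /andP[/andP[z1 /andP[z2 z3]] z_1].
move=> /andP[/andP[a1 /andP[a2 a3]] a_1] Ag M0 HM kE /andP[rho0 rho1] rhok.
have dz : disk z by exact: z_1. have da : disk a by exact: a_1.
have := H1 g M z Ag M0 HM ltac:(by rewrite z1).
rewrite -/q in kE *; set Ta := T (normc a) in kE *; set Tz := T (normc z) => HM1.
have Ta0 : 0 < Ta by apply: HT; rewrite normc_ge0.
have Tz0 : 0 < Tz by apply: HT; rewrite normc_ge0.
have oz : 0 < omega z by rewrite hom// expR_gt0.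
have oa : 0 < omega a by rewrite hom// expR_gt0.
set X := omega z / omega a; have X0 : 0 < X by rewrite divr_gt0.
have XE : X = expR (h (normc a) - h (normc z)).
  by rewrite /X !hom// -expRN -expRD opprK addrC.
have kX : kap * X <= (Ta / Tz) `^ q * (C * M).
  rewrite -kE (_ : _ * X = (Ta / Tz) `^ q * (Tz `^ q * (normc (g z) * omega z))).
    by apply: ler_wpM2l => //; exact: powR_ge0.
  have -> : Ta `^ q = (Ta / Tz) `^ q * Tz `^ q.
    by rewrite -powRM ?divfK ?gt_eqF ?divr_ge0// ltW.
  by rewrite /X; field; rewrite gt_eqF.
have rX : rho * X <= 3 * ((Ta / Tz) `^ q * (C * M)).
  by have := ler_wpM2r (ltW X0) rhok; rewrite -mulrA; lra.
(* When [|a| <= |z|] the first power of [rho] is enough; the square serves only the other case. *)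
have rr : rho ^+ 2 * X <= rho * X.
  by rewrite expr2 -mulrA; apply: ler_piMl => //; rewrite mulr_ge0// ltW.
have CM : 0 <= C * M by rewrite mulr_ge0// ltW.
have T1 : 0 <= E1 * M by rewrite mulr_ge0// ltW.
have T2 : 0 <= E2 * M ^+ 2 by rewrite mulr_ge0 ?sqr_ge0// ltW.
have T3 : 0 <= E1 * M ^+ 2 by rewrite mulr_ge0 ?sqr_ge0// ltW.
have T4 : 0 <= E2 * M by rewrite mulr_ge0// ltW.
rewrite mulrDr !(mulrDl E1 E2).
have [az|za] := leP (normc a) (normc z).
  have [T2z|Xe] := H3 (normc a) (normc z) a3 az z_1.
    have : (Ta / Tz) `^ q * (C * M) <= 2 `^ q * (C * M).
      apply: ler_wpM2r => //; apply: powR_homo; [exact: ltW|by rewrite divr_ge0// ltW|].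
      by rewrite ler_pdivrMr.
    have -> : E1 * M = 3 * (2 `^ q * (C * M)) by rewrite /E1; ring.
    by move: rX rr T2 T3 T4; clear -e00; lra.
  rewrite -XE in Xe.
  have : rho * X <= X by apply: ler_piMl => //; exact: ltW.
  by move: rr T1 T2 T3 T4 Xe; clear; lra.
pose Y := h (normc a) - h (normc z).
have Y0 : 0 <= Y by rewrite subr_ge0; apply: (wdata_h_le HW); rewrite ?normc_ge0// ltW.
have TaY : Ta / Tz <= 1 + 16 * c * Y.
  by rewrite ler_pdivrMr// mulrC; apply: H2 => //; exact: ltW.
pose W := (1 + 16 * c * Y) `^ q.
have rX2 : rho * X <= 3 * (W * (C * M)).
  apply: (le_trans rX); rewrite ler_pM2l//; apply: ler_wpM2r => //.
  by apply: powR_homo; [exact: ltW|rewrite divr_ge0// ltW|].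
have W2 : W ^+ 2 <= D1 * X by rewrite XE; exact: HD1.
have fin : rho ^+ 2 * X <= E2 * M ^+ 2.
  rewrite -(ler_pM2r X0).
  apply: (@le_trans _ _ ((3 * (W * (C * M))) ^+ 2)).
    rewrite [leLHS](_ : _ = (rho * X) ^+ 2); last by ring.
    apply: lerXn2r; rewrite ?nnegrE; [by rewrite mulr_ge0// ltW| |exact: rX2].
    by apply: mulr_ge0 => //; apply: mulr_ge0 => //; exact: powR_ge0.
  rewrite [leLHS](_ : _ = W ^+ 2 * (9 * (C ^+ 2 * M ^+ 2))); last by ring.
  rewrite [leRHS](_ : _ = (D1 * X) * (9 * (C ^+ 2 * M ^+ 2))); last by rewrite /E2; ring.
  by apply: ler_wpM2r => //; apply: mulr_ge0 => //; apply: mulr_ge0; exact: sqr_ge0.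
by move: fin T1 T2 T3 T4; clear -e00; lra.
Qed.

(** [Top] enters only through the modulus of its values, so the two maps may be exchanged, which
    merely changes a sign. [core_estimate] covers the case where [z] and [al z] are both near the
    boundary; the others are elementary. *)
Lemma one_sided_bounded (R : realType) (omega : R[i] -> R) (h N L T : R -> R) (c p : R)
    (al be : R[i] -> R[i]) (rho : R[i] -> R) (Top : (R[i] -> R[i]) -> R[i] -> R[i]) (rr : R) :
  wdata omega h N L T c -> 0 < p -> rr < 1 ->
  (forall z, disk z -> disk (al z)) ->
  (forall f w, normc (Top f w) = normc (f (al w) - f (be w))) ->
  (forall z, disk z -> 0 <= rho z <= 1) ->
  (forall z, disk z -> rr < normc (al z) ->
     rho z <= 3 * (normc (al z - be z) / (T (normc (al z)) + normc (al z - be z)))) ->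
  bounded_op omega p Top ->
  exists B, forall z, disk z -> rho z ^+ 2 * (omega z / omega (al z)) <= B.
Proof.
move=> HW p0 rr1 dal TopE rho01 rhok [TopA [CT HCT]].
have [HP hinc hom mo] := HW; have [c0 _ _ HT _] := HP.
have [C0 [M [C00 [r1 hr1 H1]]]] := test_function HW p0.
have [D D0 HD] := core_estimate HW p0.
have [r2 hr2 H2] := HD 1 ltr01.
have [r3 hr3 H3] := profile_lip HP ltr01.
pose r0 := Num.max (Num.max rr r1) (Num.max r2 r3).
have hr0 : 1 / 2 < r0 < 1 by rewrite /r0 !lt_max !gt_max; lra.
have [m1 m2 m3 m4] : [/\ rr <= r0, r1 <= r0, r2 <= r0 & r3 <= r0].
  by rewrite /r0 !le_max !lexx ?orbT.
have hr01 : 0 <= r0 < 1 by clear -hr0; lra.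
have [C C_0 HC] := submean_compact HW p0 hr01.
pose M1 := `|CT| * C0; have M10 : 0 <= M1 by rewrite mulr_ge0// ltW.
(* [B1] serves when both moduli exceed [r0], [B2] when [|al z| <= r0], where the quotient of weights
   is itself bounded, and [B3] when [|z| <= r0 < |al z|], where [submean_compact] replaces the
   estimate near the boundary. *)
pose B1 := 1 + D * (M1 + M1 ^+ 2).
pose B2 := expR (h r0 - h 0).
pose B3 := 3 * (C * M1 * expR (- h 0)).
exists (Num.max B1 (Num.max B2 B3)) => z dz; rewrite !le_max.
have da := dal z dz; set a := al z in da *; set b := be z.
have z_1 : normc z < 1 by exact: dz. have a_1 : normc a < 1 by exact: da.
have /andP[rho0 rho1] := rho01 z dz.
have oz : 0 < omega z by rewrite hom// expR_gt0.
have oa : 0 < omega a by rewrite hom// expR_gt0.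
set X := omega z / omega a; have X0 : 0 < X by rewrite divr_gt0.
have rX1 : rho z ^+ 2 * X <= rho z * X.
  by rewrite expr2 -mulrA; apply: ler_piMl => //; rewrite mulr_ge0// ltW.
have [ar|ra] := leP (normc a) r0.
  apply/orP; right; apply/orP; left.
  have rX2 : rho z * X <= X by apply: ler_piMl => //; exact: ltW.
  apply: le_trans rX1 _; apply: le_trans rX2 _.
  rewrite /X !hom// -expRN -expRD opprK ler_expR.
  have := wdata_h_le HW (normc_ge0 a) ar ltac:(lra).
  have := wdata_h_le HW (lexx 0) (normc_ge0 z) z_1.
  by clear; lra.
have [f [Af Nf fb fa _]] := H1 a b ltac:(by rewrite a_1 (le_lt_trans m2)).
have Ag := TopA f Af; set g := Top f in Ag.
have gz : normc (g z) = normc (f a) by rewrite /g TopE -/a -/b fb subr0.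
have Ng : (Lp_norm omega p g <= M1%:E)%E.
  apply: (le_trans (HCT f Af)).
  have [L0|L0] := leP 0%E (Lp_norm omega p f); last first.
    by exfalso; move: L0; rewrite ltNge /Lp_norm poweR_ge0.
  apply: (@le_trans _ _ (`|CT|%:E * Lp_norm omega p f)%E).
    by apply: lee_wpmul2r => //; rewrite lee_fin ler_norm.
  by rewrite EFinM; apply: lee_wpmul2l.
have rk := rhok z dz ltac:(by rewrite (le_lt_trans m1)).
rewrite -/a -/b in rk.
rewrite -gz in fa.
have [zr|rz] := leP (normc z) r0.
  apply/orP; right; apply/orP; right.
  apply: (le_trans rX1).
  apply: (@le_trans _ _ (3 * (T (normc a) `^ (2 / p) * (normc (g z) * omega a)) * X)).
    by apply: ler_wpM2r; [exact: ltW|rewrite fa].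
  rewrite -mulrA ler_pM2l// [leLHS](_ : _ = T (normc a) `^ (2 / p) * (normc (g z) * omega z)); last first.
    by rewrite /X; field; rewrite gt_eqF.
  have [Ta Ta1 _ _] := H3 (normc a) ltac:(by rewrite a_1 (le_lt_trans m4)).
  rewrite -[leRHS]mul1r; apply: ler_pM.
  - exact: powR_ge0.
  - by rewrite mulr_ge0 ?normc_ge0// ltW.
  - rewrite -[leRHS](powRr0 (T (normc a))); apply: ger_powR; first by rewrite Ta ltW.
    by rewrite divr_ge0// ltW.
  apply: ler_pM; [exact: normc_ge0|exact: ltW|exact: HC|].
  rewrite hom// ler_expR lerN2.
  exact: wdata_h_le HW (lexx 0) (normc_ge0 z) z_1.
apply/orP; left.
apply: (H2 z a g M1 _ (rho z) _ _ Ag M10 Ng fa).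
- by rewrite z_1 (le_lt_trans m3).
- by rewrite a_1 (le_lt_trans m3).
- by rewrite rho0.
- exact: rk.
Qed.

(** * The compact case *)

Lemma Lp_norm_ext (R : realType) (omega : R[i] -> R) (p : R) (f g : R[i] -> R[i]) :
  (forall w, disk w -> f w = g w) -> Lp_norm omega p f = Lp_norm omega p g.
Proof.
move=> fg; rewrite !LpE (eq_integral (fun q => (Lp_integrand omega p g q)%:E))//.
by move=> q /set_mem dq; rewrite /Lp_integrand fg.
Qed.

Lemma cvge0_le (R : realType) (u : nat -> \bar R) (e : R) : 0 < e ->
  u n @[n --> \oo] --> 0%E -> exists n0, forall n, (n0 <= n)%N -> (u n <= e%:E)%E.
Proof.
move=> e0 /fine_cvgP[[n1 _ H1] /cvgr0_norm_le /(_ e e0)[n2 _ H2]].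
exists (maxn n1 n2) => n; rewrite geq_max => /andP[h1 h2].
rewrite -(fineK (H1 n h1)) lee_fin.
exact: le_trans (ler_norm _) (H2 n h2).
Qed.

Lemma Ap_sub (R : realType) (omega : R[i] -> R) (p : R) (f g : R[i] -> R[i]) :
  Ap omega p f -> Ap omega p g -> (Lp_norm omega p (f \- g)%R < +oo)%E ->
  Ap omega p (f \- g).
Proof.
move=> [[rf imf _] hf] [[rg img _] hg] fin; split; [split => //|].
- rewrite (_ : (fun q => _) = (fun q : plane R =>
    complex.Re (f (toC q)) - complex.Re (g (toC q)))).
    exact: measurable_funB.
  by apply/funext => q; rewrite /= raddfB.
- rewrite (_ : (fun q => _) = (fun q : plane R =>
    complex.Im (f (toC q)) - complex.Im (g (toC q)))).
    exact: measurable_funB.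
  by apply/funext => q; rewrite /= raddfB.
- by move=> z dz; exact: hderB (hf z dz) (hg z dz).
Qed.

(** [omega z] tends to 0 at the boundary, while [omega (al z)] is bounded below for [|al z| <= r].
    Hence points near the boundary violating the conclusion have images near the boundary, where
    test functions exist. *)
Lemma weight_ratio_far (R : realType) (omega : R[i] -> R) (h N L T : R -> R) (c e r : R)
    (al : R[i] -> R[i]) (rho : R[i] -> R) :
  wdata omega h N L T c -> 0 < e -> r < 1 ->
  (forall z, disk z -> disk (al z)) -> (forall z, disk z -> 0 <= rho z <= 1) ->
  exists2 r', r' < 1 & forall z, r' < normc z < 1 ->
    e <= rho z ^+ 2 * (omega z / omega (al z)) -> r < normc (al z).
Proof.
move=> HW e0 r1 dal rho01; have [HP _ hom _] := HW.
pose r2 := Num.max r (1 / 2).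
have hr2 : r2 < 1 by rewrite /r2 gt_max; lra.
have rr2 : r <= r2 by rewrite le_max lexx.
have [r' hr' H] := profile_blowup (h r2 - ln e + 1) HP.
exists r'; first by lra.
move=> z hz He; rewrite ltNge; apply/negP => ar.
have dz : disk z by case/andP: hz.
have da := dal z dz; have /andP[rho0 rho1] := rho01 z dz.
have X0 : 0 <= omega z / omega (al z) by rewrite !hom// divr_ge0// expR_ge0.
have : rho z ^+ 2 * (omega z / omega (al z)) < e; last by rewrite ltNge He.
apply: (@le_lt_trans _ _ (omega z / omega (al z))).
  by apply: ler_piMl => //; rewrite exprn_ile1.
rewrite !hom// -expRN -expRD opprK -[ltRHS]lnK ?posrE// ltr_expR.
have h1 := H (normc z) hz.
have h2 := wdata_h_le HW (normc_ge0 (al z)) (le_trans ar rr2) hr2.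
by clear -h1 h2; lra.
Qed.

(** By contradiction, points [z_ n] tending to the boundary give test functions [f_ n] peaked at
    [al (z_ n)], bounded in norm and pointwise null. A norm limit [g] of a subsequence of
    [Top (f_ n)] is also a pointwise limit, by point evaluation, so [g] vanishes on the disk. The
    norms of this subsequence thus tend to 0, and [core_estimate] contradicts the lower bound
    [e]. *)
Lemma one_sided_compact (R : realType) (omega : R[i] -> R) (h N L T : R -> R) (c p : R)
    (al be : R[i] -> R[i]) (rho : R[i] -> R) (Top : (R[i] -> R[i]) -> R[i] -> R[i]) (rr : R) :
  wdata omega h N L T c -> 0 < p -> rr < 1 ->
  (forall z, disk z -> disk (al z)) -> (forall z, disk z -> disk (be z)) ->
  (forall f w, normc (Top f w) = normc (f (al w) - f (be w))) ->
  (forall z, disk z -> 0 <= rho z <= 1) ->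
  (forall z, disk z -> rr < normc (al z) ->
     rho z <= 3 * (normc (al z - be z) / (T (normc (al z)) + normc (al z - be z)))) ->
  compact_op omega p Top ->
  forall e, 0 < e -> exists2 r0, r0 < 1 & forall z, r0 < normc z < 1 ->
    rho z ^+ 2 * (omega z / omega (al z)) < e.
Proof.
move=> HW p0 rr1 dal dbe TopE rho01 rhok [TopA comp] e e0.
have [HP hinc hom mo] := HW; have [c0 _ _ HT _] := HP.
have [C0 [M [C00 [r1 hr1 H1]]]] := test_function HW p0.
apply: contrapT => nH.
pose Q z := rho z ^+ 2 * (omega z / omega (al z)).
pose rT := Num.max rr r1.
have hrT : rT < 1 by rewrite /rT gt_max; lra.
have [rs hrs far] := weight_ratio_far HW e0 hrT dal rho01.
have bad n : exists z, [/\ Num.max rs (1 - n.+1%:R^-1) < normc z < 1 & e <= Q z].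
  apply: contrapT => nz; apply: nH; exists (Num.max rs (1 - n.+1%:R^-1)).
    by rewrite gt_max hrs ltrBlDr ltrDl invr_gt0 ltr0n.
  by move=> z hz; rewrite ltNge; apply/negP => He; apply: nz; exists z.
have [z_ zP] := choice bad.
have zd n : disk (z_ n) by have [/andP[]] := zP n.
have zfar (r : R) : r < 1 -> exists n0, forall n, (n0 <= n)%N -> r < normc (z_ n) < 1.
  move=> r_1.
  have r0 : 0 <= (1 - r)^-1 by rewrite invr_ge0 subr_ge0 ltW.
  have [n0 [_ hn0 _]] := nat_above r0.
  exists n0 => n nn; have [/andP[+ ->] _] := zP n; rewrite andbT gt_max => /andP[_].
  apply: le_lt_trans; rewrite lerBrDr -lerBrDl.
  rewrite -[leRHS]invrK lef_pV2 ?posrE ?invr_gt0 ?subr_gt0//.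
  by apply: (le_trans hn0); rewrite ler_nat (leq_trans nn).
pose a_ n := al (z_ n); pose b_ n := be (z_ n).
have aT n : rT < normc (a_ n).
  have [hz He] := zP n; apply: far => //.
  by move: hz; rewrite gt_max => /andP[/andP[-> _] ->].
have afar (r : R) : r < 1 -> exists n0, forall n, (n0 <= n)%N -> r < normc (a_ n) < 1.
  move=> r_1; have [r' hr' H] := weight_ratio_far HW e0 r_1 dal rho01.
  have [n0 Hn0] := zfar r' hr'; exists n0 => n nn.
  have [_ He] := zP n; rewrite (H _ (Hn0 n nn) He) /=.
  exact: dal.
have tf n : exists f : R[i] -> R[i],
      [/\ Ap omega p f, (Lp_norm omega p f <= C0%:E)%E, f (b_ n) = 0,
        T (normc (a_ n)) `^ (2 / p) * (normc (f (a_ n)) * omega (a_ n)) =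
          normc (a_ n - b_ n) / (T (normc (a_ n)) + normc (a_ n - b_ n)) &
        forall w, disk w -> normc (f w) * omega w * normc (w - a_ n) ^+ M <= C0 * T (normc (a_ n))].
  apply: H1; have := aT n; rewrite gt_max => /andP[_ -> /=]; exact: dal.
have [f_ fP] := choice tf.
have [s [g [s_inc Ag cvg]]] := comp f_ (fun n => let: And5 A _ _ _ _ := fP n in A)
  (ex_intro _ C0 (fun n => let: And5 _ A _ _ _ := fP n in A)).
have s_ge n : (n <= s n)%N.
  elim: n => [//|n IH]; apply: leq_ltn_trans IH _; exact: s_inc.
have f0 w (d : R) : disk w -> 0 < d -> exists n0, forall n, (n0 <= n)%N -> normc (f_ n w) <= d.
  move=> dw d0; have w1 : normc w < 1 by exact: dw.
  pose de := (1 - normc w) / 2; have de0 : 0 < de by rewrite divr_gt0 ?subr_gt0.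
  have ow : 0 < omega w by rewrite hom// expR_gt0.
  have k0 : 0 < omega w * de ^+ M by rewrite mulr_gt0// exprn_gt0.
  (* The size of [T] at which the decay clause yields [|f_ n w| <= d], once [|w - a_ n| >= de]. *)
  have e'0 : 0 < d * (omega w * de ^+ M) / C0 by rewrite divr_gt0// mulr_gt0.
  have [r3 hr3 H3] := profile_lip HP e'0.
  have [|n0 Hn0] := afar (Num.max r3 ((1 + normc w) / 2)).
    by rewrite gt_max; lra.
  exists n0 => n nn; have := Hn0 n nn; rewrite gt_max => /andP[/andP[h1 h2] h3].
  have [_ _ _ _ /(_ w dw) B] := fP n.
  have [_ Tle _ _] := H3 (normc (a_ n)) ltac:(by rewrite h1).
  have dn : de <= normc (w - a_ n).
    have := normcD (a_ n - w) w; rewrite subrK -opprB normcN /de.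
    by clear -h2; lra.
  rewrite -(ler_pM2r k0).
  apply: (@le_trans _ _ (C0 * T (normc (a_ n)))); last first.
    rewrite [leRHS](_ : _ = C0 * (d * (omega w * de ^+ M) / C0)); last first.
      by field; rewrite gt_eqF.
    by rewrite ler_pM2l// ltW.
  apply: le_trans B; rewrite mulrA; apply: ler_wpM2l.
    by rewrite mulr_ge0 ?normc_ge0// ltW.
  by apply: lerXn2r => //; rewrite nnegrE ?normc_ge0// ltW.
have g0 w : disk w -> g w = 0.
  move=> dw; apply: eq0_normc; apply/le_anti; rewrite normc_ge0 andbT.
  have w1 : 0 <= normc w < 1 by rewrite normc_ge0.
  have [Cw Cw0 HC] := submean_compact HW p0 w1.
  apply/ler_addgt0Pr => d d0; rewrite add0r.
  (* [Cw * d'] pays for evaluating the difference at [w], and [2 * d'] for the two values of the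
     test function. *)
  pose d' := d / (Cw + 2); have d'0 : 0 < d' by rewrite divr_gt0// addr_gt0.
  have [n1 Hn1] := cvge0_le d'0 cvg.
  have [n2 Hn2] := f0 (al w) d' (dal w dw) d'0.
  have [n3 Hn3] := f0 (be w) d' (dbe w dw) d'0.
  pose n := maxn n1 (maxn n2 n3).
  have m1 : (n1 <= n)%N by rewrite leq_maxl.
  have m2 : (n2 <= s n)%N by apply: leq_trans (s_ge n); rewrite /n !leq_max leqnn orbT.
  have m3 : (n3 <= s n)%N by apply: leq_trans (s_ge n); rewrite /n !leq_max leqnn !orbT.
  have [Af _ _ _ _] := fP (s n).
  have Au : Ap omega p (Top (f_ (s n)) \- g).
    apply: (Ap_sub (TopA _ Af) Ag).
    exact: le_lt_trans (Hn1 n m1) (ltry _).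
  have := HC _ _ w Au (ltW d'0) (Hn1 n m1) (lexx _) => /= B.
  have B2 : normc (Top (f_ (s n)) w) <= 2 * d'.
    rewrite TopE; apply: le_trans (normcD _ _) _; rewrite normcN.
    by have := Hn2 (s n) m2; have := Hn3 (s n) m3; clear; lra.
  have -> : g w = Top (f_ (s n)) w - (Top (f_ (s n)) w - g w) by rewrite opprB addrC subrK.
  apply: le_trans (normcD _ _) _; rewrite normcN.
  have -> : d = (Cw + 2) * d' by rewrite /d' mulrC divfK// gt_eqF// addr_gt0.
  by clear -B B2; lra.
have [D D0 HD] := core_estimate HW p0.
have e4 : 0 < e / 4 by rewrite divr_gt0.
have [r4 hr4 H4] := HD _ e4.
(* As [M1 <= 1], [D * (M1 + M1 ^+ 2) <= 2 * D * M1 <= e / 4]; with the other [e / 4] the total is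
   [e / 2], below [e]. *)
pose M1 := Num.min 1 (e / (8 * D)).
have eD : 0 < e / (8 * D) by rewrite divr_gt0// mulr_gt0.
have M10 : 0 < M1 by rewrite /M1 lt_min ltr01.
have M11 : M1 <= 1 by rewrite /M1 ge_min lexx.
have M12 : M1 <= e / (8 * D) by rewrite /M1 ge_min lexx orbT.
have MD : D * (M1 + M1 ^+ 2) <= e / 4.
  have : M1 ^+ 2 <= M1 by rewrite expr2; apply: ler_piMl => //; exact: ltW.
  move=> h1; have h2 : M1 + M1 ^+ 2 <= 2 * (e / (8 * D)) by clear -h1 M12; lra.
  apply: le_trans (ler_wpM2l (ltW D0) h2) _.
  by rewrite le_eqVlt; apply/orP; left; apply/eqP; field; rewrite gt_eqF.
have [n1 Hn1] := cvge0_le M10 cvg.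
have r41 : r4 < 1 by clear -hr4; lra.
have [n2 Hn2] := zfar r4 r41; have [n3 Hn3] := afar r4 r41.
pose n := maxn n1 (maxn n2 n3).
have m1 : (n1 <= n)%N by rewrite leq_maxl.
have m2 : (n2 <= s n)%N by apply: leq_trans (s_ge n); rewrite /n !leq_max leqnn orbT.
have m3 : (n3 <= s n)%N by apply: leq_trans (s_ge n); rewrite /n !leq_max leqnn !orbT.
have [Af _ fb fa _] := fP (s n).
(* [g] vanishes on the disk, so subtracting it does not change the norm; the triangle inequality,
   false for [p < 1], is not involved. *)
have NT : (Lp_norm omega p (Top (f_ (s n))) <= M1%:E)%E.
  rewrite (@Lp_norm_ext _ _ _ _ (Top (f_ (s n)) \- g)); first exact: Hn1.
  by move=> w dw /=; rewrite g0// subr0.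
have gz : normc (Top (f_ (s n)) (z_ (s n))) = normc (f_ (s n) (a_ (s n))).
  by rewrite TopE -/(a_ (s n)) -/(b_ (s n)) fb subr0.
rewrite -gz in fa.
have := H4 (z_ (s n)) (a_ (s n)) _ M1 _ (rho (z_ (s n))) (Hn2 _ m2) (Hn3 _ m3)
  (TopA _ Af) (ltW M10) NT fa (rho01 _ (zd _)).
have rk := rhok _ (zd (s n)) (le_lt_trans (_ : rr <= rT) (aT (s n))).
move=> /(_ (rk _)).
have rTr : rr <= rT by rewrite /rT le_max lexx.
move=> /(_ rTr) F.
have [_ He] := zP (s n).
move: (le_trans He F); move: MD; clear -e0; lra.
Qed.

Theorem theorem1p1 (R : realType) (omega tau : R[i] -> R) (p : R)
    (phi psi : R[i] -> R[i]) :
  class_W omega tau -> 0 < p -> self_map phi -> self_map psi ->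
  let T := fun f : R[i] -> R[i] => comp_op phi f \- comp_op psi f in
  let Q := fun z : R[i] =>
    rho_tau_maps tau phi psi z ^+ 2 *
      (omega z / omega (phi z) + omega z / omega (psi z)) in
  (bounded_op omega p T ->
     (ereal_sup [set (Q z)%:E | z in disk] < +oo)%E) /\
  (compact_op omega p T ->
     forall e : R, 0 < e ->
       \forall r \near 1^'-, forall z, normc z = r -> `|Q z| < e).
Proof.
move=> W p0 [_ dphi] [_ dpsi] Top Q.
have [h [N [L [c [HP hinc omE tauE om_meas]]]]] := class_W_profile W.
have HW : wdata omega h N L (fun t => tau t%:C) c by [].
have {W} [tau0 dtau] : (forall z, disk z -> 0 < tau z) /\
    (forall q : R * R, disk (toC q) -> differentiable (tau \o @toC R) q).
  by case: W => eta _ [? [_ [? _]]].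
have [rr /andP[_ rr1] rhoH] := rho_tau_le HP tau0 tauE dtau.
pose rho := rho_tau_maps tau phi psi.
have rho01 z : disk z -> 0 <= rho z <= 1 by move=> _; exact: rho_tau_ge0.
have rho_phi z : disk z -> rr < normc (phi z) ->
    rho z <= 3 * (normc (phi z - psi z) /
                  (tau (normc (phi z))%:C + normc (phi z - psi z))).
  move=> dz rz; apply: rhoH; [exact: dphi|exact: dpsi|by left|].
  by rewrite rz; exact: dphi.
have rho_psi z : disk z -> rr < normc (psi z) ->
    rho z <= 3 * (normc (psi z - phi z) /
                  (tau (normc (psi z))%:C + normc (psi z - phi z))).
  move=> dz rz; rewrite -opprB normcN.
  apply: rhoH; [exact: dphi|exact: dpsi|by right|].
  by rewrite rz; exact: dpsi.
have Tphi f w : normc (Top f w) = normc (f (phi w) - f (psi w)) by [].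
(* Exchanging the maps only changes the sign of the difference, so the one-sided estimates apply to
   each summand of [Q], with the same operator and the same [rho]. *)
have Tpsi f w : normc (Top f w) = normc (f (psi w) - f (phi w)).
  by rewrite Tphi -opprB normcN.
have QE z : Q z = rho z ^+ 2 * (omega z / omega (phi z)) +
                  rho z ^+ 2 * (omega z / omega (psi z)) by rewrite /Q mulrDr.
split=> [bT|cT e e0].
- have [B1 H1] := one_sided_bounded HW p0 rr1 dphi Tphi rho01 rho_phi bT.
  have [B2 H2] := one_sided_bounded HW p0 rr1 dpsi Tpsi rho01 rho_psi bT.
  apply: le_lt_trans (ltry (B1 + B2)); apply: ge_ereal_sup => _ [z dz <-].
  by rewrite lee_fin QE; apply: lerD; [exact: H1|exact: H2].
- have e20 : 0 < e / 2 by rewrite divr_gt0.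
  have [r1 r11 H1] := one_sided_compact HW p0 rr1 dphi dpsi Tphi rho01 rho_phi cT e20.
  have [r2 r21 H2] := one_sided_compact HW p0 rr1 dpsi dphi Tpsi rho01 rho_psi cT e20.
  apply: (@left1_near _ _ (Num.max r1 r2)); first by rewrite gt_max r11.
  move=> r; rewrite gt_max => /andP[/andP[h1 h2] h3] z zr.
  have dz : disk z by rewrite /disk /= zr.
  have Q1 : rho z ^+ 2 * (omega z / omega (phi z)) < e / 2.
    by apply: H1; rewrite zr h1.
  have Q2 : rho z ^+ 2 * (omega z / omega (psi z)) < e / 2.
    by apply: H2; rewrite zr h2.
  rewrite ger0_norm QE; first by clear -Q1 Q2; lra.
  have X0 w : disk w -> 0 <= rho z ^+ 2 * (omega z / omega w).
    by move=> dw; rewrite mulr_ge0 ?sqr_ge0// !omE// divr_ge0// expR_ge0.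
  by rewrite addr_ge0// X0//; [exact: dphi|exact: dpsi].
Qed.
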